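(* Let $m\ge 3$, let $\Sigma$ be an oriented surface and let $\Phi:\Sigma\to\mathbb{R}^m$ be a smooth immersion with induced metric $g$, Gauss map $\vec n$ and mean curvature vector $\vec H$. Then the Willmore Euler-Lagrange equation $$\Delta_\perp \vec H-2|\vec H|^2\,\vec H+\tilde A(\vec H)=0$$ is equivalent to $$d\left(\ast_g\, d\vec H-3\ast_g \pi_{\vec n}(d\vec H)\right)+d\left(\vec H\wedge d\vec n\right)=0 ,$$ where $\ast_g$ is the Hodge operator on $\Sigma$ associated to the induced metric $g$. Moreover, if $\Sigma=D^2$ is the flat unit disc and $\Phi:D^2\to\mathbb{R}^m$ is conformal, then $\Phi$ is Willmore if and only if $$\Delta\vec H-3\,\mathrm{div}\left(\pi_{\vec n}(\nabla\vec H)\right)-\mathrm{div}\left(\vec H\wedge\nabla^\perp\vec n\right)=0 ,$$ where $\Delta=\partial_{x_1}^2+\partial_{x_2}^2$, $\mathrm{div}$ and $\nabla=(\partial_{x_1},\partial_{x_2})$ are taken with respect to the flat metric on $D^2$ and $\nabla^\perp:=(-\partial_{x_2},\partial_{x_1})$.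
   Context: $g$ is the metric induced on $\Sigma$ by $\Phi$ from the Euclidean metric of $\mathbb{R}^m$. $N_{\Phi(x)}\Phi(\Sigma)$ is the orthogonal complement in $\mathbb{R}^m$ of the tangent plane $T_{\Phi(x)}\Phi(\Sigma)$. The Gauss map $\vec n$ assigns to $x\in\Sigma$ the unit simple $(m-2)$-vector $\vec n=\vec n_1\wedge\cdots\wedge\vec n_{m-2}$ representing the oriented plane $N_{\Phi(x)}\Phi(\Sigma)$; here $(\vec n_1,\dots,\vec n_{m-2})$ is an orthonormal basis of the normal plane such that $(\vec e_1,\vec e_2,\vec n_1,\dots,\vec n_{m-2})$ is a positive basis of $\mathbb{R}^m$ when $(\vec e_1,\vec e_2)$ is a positive orthonormal basis of the tangent plane. $\pi_{\vec n}$ is the orthogonal projection of $\mathbb{R}^m$ onto $N_{\Phi(x)}\Phi(\Sigma)$; it acts on $\mathbb{R}^m$-valued forms and gradients componentwise. The second fundamental form is $\vec B_x=\pi_{\vec n}\circ d^2\Phi$, a symmetric bilinear form on $T_x\Sigma$ with values in the normal space, and $\vec H=\frac12\left(\vec B(e_1,e_1)+\vec B(e_2,e_2)\right)$ for any $g$-orthonormal basis $(e_1,e_2)$ of $T_x\Sigma$. For a normal vector $\vec L$, $\tilde A(\vec L)=\sum_{i,j}\left(\vec B(e_i,e_j)\cdot\vec L\right)\vec B(e_i,e_j)$. $\Delta_\perp$ is the Laplacian (trace of the second covariant derivative, a negative operator) of the normal connection $D_X\sigma=\pi_{\vec n}(d\sigma(X))$ on sections $\sigma$ of the normal bundle. $\Phi$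 is called Willmore if it is a critical point of $W=\int_\Sigma|\vec H|^2\,d\mathrm{vol}_g$ for perturbations $\Phi+t\phi$, with $\phi$ an arbitrary smooth map from $\Sigma$ to $\mathbb{R}^m$ (compactly supported when $\Sigma$ is not closed); it is known that this holds if and only if $\Delta_\perp \vec H-2|\vec H|^2\vec H+\tilde A(\vec H)=0$. $(m-1)$-vectors of $\mathbb{R}^m$ are identified with vectors via the standard volume form: $\eta\in\Lambda^{m-1}\mathbb{R}^m$ is identified with the vector $u$ such that $w\wedge\eta=(w\cdot u)\,\epsilon_1\wedge\cdots\wedge\epsilon_m$ for all $w\in\mathbb{R}^m$, where $(\epsilon_i)$ is the canonical basis. (For $m=3$, $\wedge$ is then the cross product.) With this identification $\vec H\wedge d\vec n$ is a 1-form on $\Sigma$ with values in $\mathbb{R}^m$. *)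

(* Defs.v *)
From mathcomp Require Export all_boot all_order all_algebra.
From mathcomp Require Export all_classical all_reals all_analysis.
Export Order.TTheory GRing.Theory Num.Theory.
Export numFieldNormedType.Exports.

Set Implicit Arguments.
Unset Strict Implicit.
Unset Printing Implicit Defensive.

Global Open Scope classical_set_scope.
Global Open Scope ring_scope.

(* Indices in 'I_2 are 0-based: the coordinates x_1, x_2 of the plane are
   numbered 0, 1. *)

Section PlaneCalculus.
Context {R : realType}.

Definition ebasis (i : 'I_2) : R * R := if i == 0 then (1, 0) else (0, 1).

Section PartialDerivatives.
Context {V : normedModType R}.

Definition pd (i : 'I_2) (f : R * R -> V) (u : R * R) : V := 'D_(ebasis i) f u.

Fixpoint Ck_on (k : nat) (U : set (R * R)) (f : R * R -> V) : Prop :=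
  (forall u, U u -> {for u, continuous f}) /\
  (if k is k'.+1 then
     forall i, (forall u, U u -> derivable f u (ebasis i)) /\ Ck_on k' U (pd i f)
   else True).

(* C^oo on U; used for open sets U only. *)
Definition smooth_on (U : set (R * R)) (f : R * R -> V) : Prop :=
  forall k, Ck_on k U f.

Definition grad (f : R * R -> V) (u : R * R) (i : 'I_2) : V := pd i f u.

Definition div (X : R * R -> 'I_2 -> V) (u : R * R) : V :=
  \sum_i pd i (fun v => X v i) u.

Definition laplacian (f : R * R -> V) (u : R * R) : V :=
  \sum_i pd i (pd i f) u.

(* A V-valued 1-form a_1 dx_1 + a_2 dx_2 is the family of its components a_j;
   its exterior derivative is the coefficient of dx_1 /\ dx_2. *)
Definition extd (a : R * R -> 'I_2 -> V) (u : R * R) : V :=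
  pd 0 (fun v => a v 1) u - pd 1 (fun v => a v 0) u.

End PartialDerivatives.

Definition jacobian_det (f : R * R -> R * R) (u : R * R) : R :=
  (pd 0 f u).1 * (pd 1 f u).2 - (pd 0 f u).2 * (pd 1 f u).1.

Definition unit_disc : set (R * R) := [set u | u.1 ^+ 2 + u.2 ^+ 2 < 1].

End PlaneCalculus.

Section Surface.
Context {R : realType}.

(* Only the values of cmap on cdom and of cinv on [ccod c] are meaningful. *)
Record chart (T : topologicalType) := Chart {
  cdom : set T;
  cmap : T -> R * R;
  cinv : R * R -> T;
  cdom_open : open cdom;
  ccod_open : open (cmap @` cdom);
  cmapK : forall x, cdom x -> cinv (cmap x) = x;
  cmap_cont : {within cdom, continuous cmap};
  cinv_cont : {within cmap @` cdom, continuous cinv} }.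

Definition ccod (T : topologicalType) (c : chart T) : set (R * R) :=
  cmap c @` cdom c.

Definition oriented_compatible (T : topologicalType) (c c' : chart T) : Prop :=
  let U := cmap c @` (cdom c `&` cdom c') in
  smooth_on U (cmap c' \o cinv c) /\
  (forall u, U u -> 0 < jacobian_det (cmap c' \o cinv c) u).

End Surface.
Arguments chart : clear implicits.

Record oriented_surface (R : realType) := OrientedSurface {
  surface_carrier :> topologicalType;
  surface_hausdorff : hausdorff_space surface_carrier;
  surface_second_countable : @second_countable surface_carrier;
  atlas : set (chart R surface_carrier);
  atlas_cover : forall x, exists2 c, atlas c & cdom c x;
  atlas_oriented : forall c c', atlas c -> atlas c' -> oriented_compatible c c' }.

(* The exterior algebra of R^m, in coordinates: x S is the coefficient of
   eps_{s_1} /\ ... /\ eps_{s_k}, where s_1 < ... < s_k are the elements of S. *)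
Definition multivector (R : realType) (m : nat) := {ffun {set 'I_m} -> R}.

Section Multivectors.
Context {R : realType} {m : nat}.
Implicit Types x y eta : multivector R m.

Definition inversions (S T : {set 'I_m}) : nat :=
  #|[set p : 'I_m * 'I_m | [&& p.1 \in S, p.2 \in T & (p.2 < p.1)%N]]|.

Definition wedge x y : multivector R m :=
  [ffun U : {set 'I_m} => \sum_(S : {set 'I_m} | S \subset U)
     (-1) ^+ inversions S (U :\: S) * x S * y (U :\: S)].

Definition mv1 : multivector R m := [ffun S : {set 'I_m} => (S == finset.set0)%:R].

Definition mv_of (v : 'rV[R]_m) : multivector R m :=
  [ffun S : {set 'I_m} => \sum_i v 0 i * (S == [set i]%SET)%:R].

(* The vector u with w /\ eta = (w . u) eps_1 /\ ... /\ eps_m for all w, when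
   eta is an (m-1)-vector: its i-th coordinate is the coefficient of eps_i /\ eta. *)
Definition vec_of (eta : multivector R m) : 'rV[R]_m :=
  \row_i wedge (mv_of (delta_mx 0 i)) eta [set: 'I_m]%SET.

Definition mv_pd (i : 'I_2) (n : R * R -> multivector R m) (u : R * R) :
    multivector R m :=
  [ffun S : {set 'I_m} => pd i (fun v => n v S) u].

End Multivectors.

Section LocalGeometry.
Context {R : realType} {m : nat}.
Implicit Types (f s : R * R -> 'rV[R]_m) (u : R * R).

(* f is a parametrization, n the Gauss map, s a map with values in R^m; all
   components are relative to the coordinate basis (d/dx_1, d/dx_2). *)

Definition dot (v w : 'rV[R]_m) : R := \sum_i v 0 i * w 0 i.

Definition immersion_at f u : Prop := row_free (\matrix_(i < 2) pd i f u).

Definition metric f u : 'M[R]_2 := \matrix_(i, j) dot (pd i f u) (pd j f u).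

Definition vol_density f u : R := Num.sqrt (\det (metric f u)).

(* A positive g-orthonormal basis (e_1, e_2) of the plane: row a gives the
   coordinates of e_a. It is the Gram-Schmidt basis of (d/dx_1, d/dx_2). *)
Definition onframe f u : 'M[R]_2 :=
  let g := metric f u in
  \matrix_(a, i)
    if a == 0 then (if i == 0 then (Num.sqrt (g 0 0))^-1 else 0)
    else (if i == 0 then - g 0 1 else g 0 0) /
         (Num.sqrt (g 0 0) * vol_density f u).

(* The value on e_a, resp. on (e_a, e_b), of the linear, resp. bilinear, form
   with components T i, resp. T i j. *)
Definition on_frame1 f u (T : 'I_2 -> 'rV[R]_m) (a : 'I_2) : 'rV[R]_m :=
  \sum_i onframe f u a i *: T i.

Definition on_frame2 f u (T : 'I_2 -> 'I_2 -> 'rV[R]_m) (a b : 'I_2) : 'rV[R]_m :=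
  \sum_i \sum_j (onframe f u a i * onframe f u b j) *: T i j.

Definition tframe f u (a : 'I_2) : 'rV[R]_m :=
  on_frame1 f u (fun i => pd i f u) a.

Definition nproj f u (v : 'rV[R]_m) : 'rV[R]_m :=
  v - \sum_a dot v (tframe f u a) *: tframe f u a.

Definition second_ff f u (i j : 'I_2) : 'rV[R]_m := nproj f u (pd i (pd j f) u).

Definition mean_curv f u : 'rV[R]_m :=
  2^-1 *: \sum_a on_frame2 f u (second_ff f u) a a.

Definition Atilde f u (L : 'rV[R]_m) : 'rV[R]_m :=
  \sum_a \sum_b let Bab := on_frame2 f u (second_ff f u) a b in dot Bab L *: Bab.

Definition christoffel f u (k i j : 'I_2) : R :=
  2^-1 * \sum_l invmx (metric f u) k l *
    (pd i (fun v => metric f v j l) u + pd j (fun v => metric f v i l) u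
     - pd l (fun v => metric f v i j) u).

Definition ncov f (i : 'I_2) s u : 'rV[R]_m := nproj f u (pd i s u).

Definition ncov2 f s u (i j : 'I_2) : 'rV[R]_m :=
  ncov f i (ncov f j s) u - \sum_k christoffel f u k i j *: ncov f k s u.

Definition laplacian_perp f s u : 'rV[R]_m :=
  \sum_a on_frame2 f u (ncov2 f s u) a a.

(* *(theta^1) = theta^2 and *(theta^2) = - theta^1 on the coframe dual to
   (e_1, e_2), and theta^a (d/dx_j) = g (e_a, d/dx_j). *)
Definition hodge f (w : R * R -> 'I_2 -> 'rV[R]_m) u (j : 'I_2) : 'rV[R]_m :=
  dot (tframe f u 1) (pd j f u) *: on_frame1 f u (w u) 0
  - dot (tframe f u 0) (pd j f u) *: on_frame1 f u (w u) 1.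

Definition nproj_form f (w : R * R -> 'I_2 -> 'rV[R]_m) u (j : 'I_2) : 'rV[R]_m :=
  nproj f u (w u j).

(* The rows of P form a positive orthonormal basis
   (e_1, e_2, n_1, ..., n_(m-2)) of R^m. *)
Definition gauss_at f u (eta : multivector R m) : Prop :=
  exists P : 'M[R]_m,
    [/\ P *m P^T = 1%:M,
        0 < \det P,
        forall (i : 'I_m) (a : 'I_2), i = a :> nat -> row i P = tframe f u a
      & eta = \big[wedge/mv1]_(i < m | (2 <= i)%N) mv_of (row i P)].

Definition wedge_dn s (n : R * R -> multivector R m) u (j : 'I_2) : 'rV[R]_m :=
  vec_of (wedge (mv_of (s u)) (mv_pd j n u)).

Definition wedge_gradperp_n s (n : R * R -> multivector R m) u (j : 'I_2) :
    'rV[R]_m :=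
  vec_of (wedge (mv_of (s u)) (if j == 0 then - mv_pd 1 n u else mv_pd 0 n u)).

Definition conformal_at f u : Prop :=
  metric f u 0 0 = metric f u 1 1 /\ metric f u 0 1 = 0.

Definition willmore_energy (K : set (R * R)) f : R :=
  \int[(@lebesgue_measure R \x @lebesgue_measure R)%E]_(u in K)
    (dot (mean_curv f u) (mean_curv f u) * vol_density f u).

(* W may be infinite on the open set U, so the energy is taken over a compact
   set outside of which the perturbation vanishes. *)
Definition willmore_on (U : set (R * R)) f : Prop :=
  forall (K : set (R * R)) (phi : R * R -> 'rV[R]_m),
    compact K -> K `<=` U -> smooth_on U phi -> (forall u, ~ K u -> phi u = 0) ->
    is_derive (0 : R) (1 : R)
      (fun t : R => willmore_energy K (fun u => f u + t *: phi u)) 0.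

Definition smooth_immersion_on (U : set (R * R)) f : Prop :=
  smooth_on U f /\ (forall u, U u -> immersion_at f u).

End LocalGeometry.

Section OnSurface.
Context {R : realType} {m : nat} (S : oriented_surface R).

Definition smooth_immersion (Phi : S -> 'rV[R]_m) : Prop :=
  forall c, atlas c -> smooth_immersion_on (ccod c) (Phi \o cinv c).

Definition gauss_map (Phi : S -> 'rV[R]_m) (n : S -> multivector R m) : Prop :=
  forall c, atlas c ->
    forall u, ccod c u -> gauss_at (Phi \o cinv c) u (n (cinv c u)).

End OnSurface.

(* Main.v *)
Require Import Defs.
From mathcomp Require Import ring lra zify.

(** Write f for a parametrization, f_j and f_ij for its derivatives, g for the
    metric and s = sqrt (det g) for the area density, H for the mean curvature
    vector, and h_ij = H . f_ij. Differentiating H . f_k = 0 shows that the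
    tangential part of d_j H is - T_j with T_j = g^ik h_ij f_k. Both halves of
    the theorem are statements about one R^m-valued 1-form, the flux
        V_j = pi (d_j H) + T_j - |H|^2 f_j.

    Conservation law. Three facts about V give the first half.
    - The Gauss map enters through one formula. If (e_1, e_2, n_1, ..., n_(m-2))
      is a positive orthonormal basis, expanding a determinant gives
        w /\ v /\ n = (w . e_1) (v . e_2) - (w . e_2) (v . e_1),
      that is ((w . f_0) (v . f_1) - (w . f_1) (v . f_0)) / s (gauss_wedge).
      This shows that n is smooth, since it exhibits every coefficient of n as a
      function of the first derivatives of f, and it can be differentiated: for
      a normal vector v only the derivatives of f_0, f_1 paired with v survive,
      whence (H /\ dn)_j = (h_j1 f_0 - h_j0 f_1) / s (wedge_dn_mean_curv).
    - Consequently the 1-form under the exterior derivative is - 2 times the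
      Hodge dual of V (conservation_form). The multiples of pi (d_j H) add up to
      1 - 3 = - 2; for the tangential parts the trace identity
      2 |H|^2 = g^ij h_ij is what is needed.
    - The exterior derivative of the Hodge dual of V is s times the Willmore
      operator (extd_hodge_flux_willmore). Its pairing with a normal vector is
      the normal Laplacian, the term A~(H) and the term - 2 |H|^2 H, one for each
      summand of V, once the Christoffel symbols are expressed by f_ij . f_k.
      Its pairing with f_0, f_1 vanishes: V is the Noether current of the
      invariance of the energy under translations, and reparametrizations do not
      change the energy. In formulas the vanishing follows from the derivatives of
      the trace identity and of H . f_k = 0 (flux_tangential).
    Hence the left-hand side of the conservation law is - 2 s times the Willmore
    operator, and s > 0 (conservation_law).

    Conformal case. The Hodge operator is then a rotation by a right angle, and
    the same pointwise identity shows that the equation in the disc is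
    - 2 (d_0 V_0 + d_1 V_1) = 0 (conformal_equation). It remains to see that the
    first variation in the direction phi is the integral of div V . phi. The
    density |H|^2 s is an explicit smooth function of the 2-jet of f
    (energy_density); its derivative along f + t phi is continuous jointly in t
    and the point, so the integral over a compact set can be differentiated under
    the sign (is_derive_willmore_energy). At t = 0 conformality, which makes
    f_00 + f_11 normal, reduces the derivative to
        H . (phi_00 + phi_11) - 2 T_j . phi_j + |H|^2 f_j . phi_j,
    and this is the divergence of H . phi_j - V_j . phi plus div V . phi
    (first_variationE). The divergence of a field supported in a compact set
    integrates to 0, by Fubini and the fundamental theorem of calculus, and the
    fundamental lemma of the calculus of variations, tested with bump functions
    built from exp (- 1 / x), concludes (willmore_on_conformal). *)

Set Implicit Arguments.
Unset Strict Implicit.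
Unset Printing Implicit Defensive.

(** * Directional derivatives *)

Section DirectionalDerivatives.
Context {R : realType} {V : normedModType R} {m : nat}.
Implicit Types (s : V -> R) (f g : V -> 'rV[R]_m).

Lemma is_derive_rowP f u v (df : 'rV[R]_m) :
  is_derive u v f df <-> forall i, is_derive u v (fun x => f x 0 i) (df 0 i).
Proof.
split=> [[df1 df2] i | H].
  have di := (derivable_mxP f u v).1 df1 0 i.
  by apply: DeriveDef => //; rewrite -df2 (derive_mx df1) mxE.
have der : derivable f u v.
  by apply/derivable_mxP => i j; rewrite ord1; case: (H j).
apply: DeriveDef => //; rewrite (derive_mx der); apply/rowP => i.
by rewrite mxE; case: (H i).
Qed.

(** The rules of this part are stated for functions given by their values, so
    that applying them one after the other yields the derivative of a formula. *)
Lemma is_derive_funD (W : normedModType R) (f g : V -> W) u v df dg :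
  is_derive u v f df -> is_derive u v g dg ->
  is_derive u v (fun x => f x + g x) (df + dg).
Proof. by move=> hf hg; apply: is_deriveD. Qed.

Lemma is_derive_funB (W : normedModType R) (f g : V -> W) u v df dg :
  is_derive u v f df -> is_derive u v g dg ->
  is_derive u v (fun x => f x - g x) (df - dg).
Proof. by move=> hf hg; apply: is_deriveB. Qed.

Lemma is_derive_funN (W : normedModType R) (f : V -> W) u v df :
  is_derive u v f df -> is_derive u v (fun x => - f x) (- df).
Proof. by move=> hf; apply: is_deriveN. Qed.

Lemma is_derive_funM (s t : V -> R) u v ds dt :
  is_derive u v s ds -> is_derive u v t dt ->
  is_derive u v (fun x => s x * t x) (ds * t u + s u * dt).
Proof.
move=> hs ht; have h := is_deriveM hs ht.
by apply: is_derive_eq h _; rewrite /GRing.scale /= addrC (mulrC (t u)).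
Qed.

Lemma is_derive_funcst (W : normedModType R) (c : W) (u v : V) :
  is_derive u v (fun=> c) 0.
Proof. exact: is_derive_cst. Qed.

Lemma is_derive_funV s u v ds : s u != 0 -> is_derive u v s ds ->
  is_derive u v (fun x => (s x)^-1) (- (s u)^-2 * ds).
Proof.
move=> s0 [h1 h2]; apply: DeriveDef; first exact: derivableV.
by rewrite deriveV // h2.
Qed.

Lemma is_derive_funsum (W : normedModType R) (I : finType) (f : I -> V -> W)
    u v df : (forall i, is_derive u v (f i) (df i)) ->
  is_derive u v (fun x => \sum_i f i x) (\sum_i df i).
Proof.
move=> h.
have -> : (fun x => \sum_i f i x) = \sum_(i < #|I|) f (enum_val i).
  apply/funext => x; rewrite (reindex (@enum_val I I)) /=; last first.
    by exists enum_rank => i _; rewrite ?enum_valK ?enum_rankK.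
  by rewrite (big_morph (fun g : V -> W => g x) (op1:=+%R) (id1:=0)).
have -> : \sum_i df i = \sum_(i < #|I|) df (enum_val i).
  rewrite (reindex (@enum_val I I)) //=.
  by exists enum_rank => i _; rewrite ?enum_valK ?enum_rankK.
exact: is_derive_sum.
Qed.

Lemma is_derive_scale s f u v ds df :
  is_derive u v s ds -> is_derive u v f df ->
  is_derive u v (fun x => s x *: f x) (ds *: f u + s u *: df).
Proof.
move=> hs /is_derive_rowP hf; apply/is_derive_rowP => i; rewrite !mxE.
have -> : (fun x => (s x *: f x) 0 i) = (fun x => s x * f x 0 i).
  by apply/funext => x; rewrite mxE.
exact: is_derive_funM.
Qed.

Lemma is_derive_dot f g u v df dg :
  is_derive u v f df -> is_derive u v g dg ->
  is_derive u v (fun x => dot (f x) (g x)) (dot df (g u) + dot (f u) dg).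
Proof.
move=> /is_derive_rowP hf /is_derive_rowP hg; rewrite /dot -big_split /=.
by apply: is_derive_funsum => i; apply: is_derive_funM.
Qed.

End DirectionalDerivatives.

(** The chain rule along a line: t |-> s (u + t v) is a real function of one
    real variable, so the one-dimensional rule applies although V is arbitrary. *)
Lemma is_derive_comp1 (R : realType) (V : normedModType R) (h : R -> R)
    (s : V -> R) u v ds dh :
  is_derive (s u) (1 : R) h dh -> is_derive u v s ds ->
  is_derive u v (fun x => h (s x)) (dh * ds).
Proof.
move=> [hd hE] [sd sE].
have sd1 : derivable (fun t : R => s (t *: v + u)) 0 1 := (derivable1P s u v).1 sd.
set p := fun t : R => s (t *: v + u).
have p0 : p 0 = s u by rewrite /p scale0r add0r.
have hp : derivable h (p 0) 1 by rewrite p0.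
have comp := derive1_comp sd1 hp.
have dE (g : V -> R) : 'D_v g u = derive1 (fun t : R => g (t *: v + u)) 0.
  rewrite derive1E /derive; set a := (X in lim (X @ _)); set b := (X in _ = lim (X @ _)).
  suff -> : a = b by [].
  by apply/funext => t; rewrite /a /b /= addr0 scale0r add0r [_%:A]mulr1.
apply: DeriveDef.
  apply: (derivable1P _ u v).2; apply/derivable1_diffP.
  apply: (@differentiable_comp _ _ _ _ p h); exact/derivable1_diffP.
have hE' : derive1 h (p 0) = dh by rewrite p0 derive1E.
have sE' : derive1 p 0 = ds by rewrite -dE.
by rewrite dE -hE' -sE' -comp.
Qed.

(** * Maps of class C^k on an open set of the plane *)

(** Turns a directional derivative into an ordinary one, for the mean value
    theorem and the fundamental theorem of calculus along a line. *)
Lemma is_derive_line (R : realType) (V W : normedModType R) (g : V -> W)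
    (w v : V) (t : R) d :
  is_derive (w + t *: v) v g d -> is_derive t (1 : R) (fun r => g (w + r *: v)) d.
Proof.
move=> [gd gE].
have E : (fun h : R => h^-1 *: (((fun r => g (w + r *: v)) \o shift t) (h *: 1)
              - g (w + t *: v))) =
         (fun h : R => h^-1 *: ((g \o shift (w + t *: v)) (h *: v) - g (w + t *: v))).
  apply/funext => h /=; congr (_ *: (g _ - _)).
  by rewrite [_%:A]mulr1 scalerDl addrCA addrA.
by apply: DeriveDef; rewrite /derivable /derive E.
Qed.

Section CkOn.
Context {R : realType}.
Implicit Types (U : set (R * R)).

Section Generic.
Context {W : normedModType R}.
Implicit Types f g : R * R -> W.

Lemma Ck_on_pd k U f i : Ck_on k.+1 U f -> Ck_on k U (pd i f).
Proof. by move=> [_ /(_ i)[]]. Qed.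

Lemma Ck_on_continuous k U f u : Ck_on k U f -> U u -> {for u, continuous f}.
Proof. by case: k => [|k] [h _]; exact: h. Qed.

Lemma Ck_on_derivable k U f u i :
  Ck_on k.+1 U f -> U u -> is_derive u (ebasis i) f (pd i f u).
Proof. by move=> [_ /(_ i)[h _]] Uu; apply/derivableP/h. Qed.

Lemma Ck_onW k U f : Ck_on k.+1 U f -> Ck_on k U f.
Proof.
elim: k f => [|k IH] f; first by case.
move=> [h1 h2]; split=> // i; split; first by have [] := h2 i.
by apply: IH; have [] := h2 i.
Qed.

Lemma near_in U u (P : R * R -> Prop) : open U -> U u ->
  (forall v, U v -> P v) -> \forall v \near u, P v.
Proof. by move=> oU Uu h; apply: filterS (open_nbhs_nbhs (conj oU Uu)). Qed.

Lemma eq_pd U f g i u : open U -> (forall v, U v -> f v = g v) -> U u ->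
  pd i f u = pd i g u.
Proof.
by move=> oU fg Uu; apply: near_eq_derive; exact: (near_in oU Uu).
Qed.

(** Differentiating an identity that holds on an open set only: this is how
    all relations between derivatives of f and of its curvature are obtained. *)
Lemma eq_is_derive U f g v u df : open U -> (forall v, U v -> f v = g v) ->
  U u -> is_derive u v f df -> is_derive u v g df.
Proof.
by move=> oU fg Uu; apply: near_eq_is_derive; exact: (near_in oU Uu).
Qed.

Lemma eq_Ck_on k U f g : open U -> (forall u, U u -> f u = g u) ->
  Ck_on k U f -> Ck_on k U g.
Proof.
move=> oU; elim: k f g => [|k IH] f g fg [h1 h2]; split.
- move=> u Uu; rewrite /prop_for /continuous_at -fg //.
  by apply: cvg_trans (h1 u Uu); apply: near_eq_cvg; exact: (near_in oU Uu).
- by [].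
- move=> u Uu; rewrite /prop_for /continuous_at -fg //.
  by apply: cvg_trans (h1 u Uu); apply: near_eq_cvg; exact: (near_in oU Uu).
- move=> i; have [d1 d2] := h2 i; split.
    move=> u Uu; apply: near_eq_derivable (d1 _ Uu).
    exact: (near_in oU Uu).
  by apply: IH d2 => u Uu; exact: eq_pd oU fg Uu.
Qed.

(** The induction step for the closure properties below: the candidate
    derivative df is only required to be right on U, where it can be chosen to be
    the formula given by a differentiation rule. *)
Lemma Ck_on_step k U f df : open U ->
  (forall u, U u -> {for u, continuous f}) ->
  (forall i u, U u -> is_derive u (ebasis i) f (df i u)) ->
  (forall i, Ck_on k U (df i)) -> Ck_on k.+1 U f.
Proof.
move=> oU fc fd dc; split=> // i; split; first by move=> u /(fd i u) [].
by apply: eq_Ck_on (dc i) => // u /(fd i u) [].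
Qed.

Lemma Ck_on_cst k U (c : W) : Ck_on k U (fun=> c).
Proof.
elim: k c => [|k IH] c; split=> //; try by move=> *; exact: cvg_cst.
move=> i; split; first by move=> *; exact: derivable_cst.
suff -> : pd i (fun=> c) = (fun=> 0) by exact: IH.
by apply/funext => u; exact: derive_cst.
Qed.

Lemma Ck_onD k U f g : open U -> Ck_on k U f -> Ck_on k U g ->
  Ck_on k U (fun u => f u + g u).
Proof.
move=> oU; elim: k f g => [|k IH] f g hf hg.
  by split=> // u Uu; apply: cvgD; apply: Ck_on_continuous; eauto.
apply: (Ck_on_step (df := fun i u => pd i f u + pd i g u)) => //.
- by move=> u Uu; apply: cvgD; apply: Ck_on_continuous; eauto.
- by move=> i u Uu; apply: is_derive_funD; apply: Ck_on_derivable; eauto.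
- by move=> i; apply: IH; apply: Ck_on_pd.
Qed.

Lemma Ck_onN k U f : open U -> Ck_on k U f -> Ck_on k U (fun u => - f u).
Proof.
move=> oU; elim: k f => [|k IH] f hf.
  by split=> // u Uu; apply: cvgN; apply: Ck_on_continuous; eauto.
apply: (Ck_on_step (df := fun i u => - pd i f u)) => //.
- by move=> u Uu; apply: cvgN; apply: Ck_on_continuous; eauto.
- by move=> i u Uu; apply: is_derive_funN; apply: Ck_on_derivable; eauto.
- by move=> i; apply: IH; apply: Ck_on_pd.
Qed.

Lemma Ck_onB k U f g : open U -> Ck_on k U f -> Ck_on k U g ->
  Ck_on k U (fun u => f u - g u).
Proof. by move=> oU hf hg; apply: Ck_onD => //; exact: Ck_onN. Qed.

Lemma Ck_on_sum k U (I : finType) (f : I -> R * R -> W) : open U ->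
  (forall i, Ck_on k U (f i)) -> Ck_on k U (fun u => \sum_i f i u).
Proof.
move=> oU h; rewrite (_ : (fun u => _) = \sum_i f i); last first.
  apply/funext => u.
  by rewrite (big_morph (fun g : R * R -> W => g u) (op1:=+%R) (id1:=0)).
elim/big_rec: _ => [|i g _ hg]; first exact: Ck_on_cst.
exact: Ck_onD.
Qed.

End Generic.

Lemma Ck_onM k U (s t : R * R -> R) : open U -> Ck_on k U s -> Ck_on k U t ->
  Ck_on k U (fun u => s u * t u).
Proof.
move=> oU; elim: k s t => [|k IH] f g hf hg.
  by split=> // u Uu; apply: cvgM; apply: Ck_on_continuous; eauto.
apply: (Ck_on_step (df := fun i u => pd i f u * g u + f u * pd i g u)) => //.
- by move=> u Uu; apply: cvgM; apply: Ck_on_continuous; eauto.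
- by move=> i u Uu; apply: is_derive_funM; apply: Ck_on_derivable; eauto.
- move=> i; apply: Ck_onD => //; apply: IH.
  + exact: Ck_on_pd. + exact: Ck_onW. + exact: Ck_onW. + exact: Ck_on_pd.
Qed.

Lemma Ck_onV k U (s : R * R -> R) : open U -> (forall u, U u -> s u != 0) ->
  Ck_on k U s -> Ck_on k U (fun u => (s u)^-1).
Proof.
move=> oU s0; elim: k => [|k IH] hf.
  by split=> // u Uu; apply: cvgV; [exact: s0 | exact: Ck_on_continuous hf Uu].
apply: (Ck_on_step (df := fun i u => - ((s u)^-1 * (s u)^-1) * pd i s u)) => //.
- by move=> u Uu; apply: cvgV; [exact: s0 | exact: Ck_on_continuous hf Uu].
- move=> i u Uu; apply: is_derive_eq.
    apply: is_derive_funV; [exact: s0 | exact: Ck_on_derivable hf Uu].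
  by rewrite expr2 invfM.
- move=> i; have h := IH (Ck_onW hf).
  apply: Ck_onM => //; last exact: Ck_on_pd.
  by apply: Ck_onN => //; apply: Ck_onM.
Qed.

Lemma is_derive_sqrt (V : normedModType R) (s : V -> R) u v ds :
  0 < s u -> is_derive u v s ds ->
  is_derive u v (fun x => Num.sqrt (s x)) (ds / (2 * Num.sqrt (s u))).
Proof.
move=> s0 hs; rewrite mulrC.
apply: (is_derive_comp1 (h := Num.sqrt)) => //.
exact: is_derive1_sqrt.
Qed.

Lemma Ck_on_sqrt k U (s : R * R -> R) : open U -> (forall u, U u -> 0 < s u) ->
  Ck_on k U s -> Ck_on k U (fun u => Num.sqrt (s u)).
Proof.
move=> oU s0; have cs u : {for u, continuous s} ->
    {for u, continuous (fun u => Num.sqrt (s u))}.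
  by move=> h; apply: continuous_comp; [exact: h | exact: sqrt_continuous].
elim: k => [|k IH] hf.
  by split=> // u Uu; apply: cs; exact: Ck_on_continuous hf Uu.
apply: (Ck_on_step (df := fun i u => pd i s u * (2 * Num.sqrt (s u))^-1)) => //.
- by move=> u Uu; apply: cs; exact: Ck_on_continuous hf Uu.
- by move=> i u Uu; apply: is_derive_sqrt; [exact: s0|exact: Ck_on_derivable hf Uu].
- move=> i; apply: Ck_onM => //; first exact: Ck_on_pd.
  apply: Ck_onV => //.
    by move=> u Uu; rewrite mulf_neq0 // gt_eqF // sqrtr_gt0 s0.
  apply: Ck_onM => //; [exact: Ck_on_cst | exact: IH (Ck_onW hf)].
Qed.

Section Rows.
Context {m : nat}.
Implicit Types f g : R * R -> 'rV[R]_m.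

Lemma continuous_rowP f u : {for u, continuous f} <->
  forall i, {for u, continuous (fun v => f v 0 i)}.
Proof.
split=> [h i | h].
  apply: (continuous_comp (g := fun M : 'rV[R]_m => M 0 i)) => //.
  exact: coord_continuous.
apply/cvgrPdist_le => /= e e0; near=> x.
rewrite /Num.Def.normr/= mx_normrE (bigmax_le _ (ltW e0))//= => i _.
rewrite !mxE/=.
move: i; near: x; apply: filter_forall => /= -[a i].
have /cvgrPdist_le := h i; rewrite ord1; exact.
Unshelve. all: by end_near. Qed.

Lemma pd_row f u i j : derivable f u (ebasis i) ->
  pd i f u 0 j = pd i (fun v => f v 0 j) u.
Proof. by move=> h; rewrite /pd derive_mx // mxE. Qed.

Lemma Ck_on_rowP k U f : open U ->
  Ck_on k U f <-> forall i, Ck_on k U (fun v => f v 0 i).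
Proof.
move=> oU; elim: k f => [|k IH] f; split.
- by move=> [h _] i; split=> // u Uu; have /continuous_rowP := h u Uu.
- move=> h; split=> // u Uu; apply/continuous_rowP => i.
  exact: Ck_on_continuous (h i) Uu.
- move=> h j; apply: (Ck_on_step (df := fun i u => pd i f u 0 j)) => //.
  + by move=> u Uu; have /continuous_rowP := Ck_on_continuous h Uu.
  + by move=> i u Uu; have /is_derive_rowP := Ck_on_derivable i h Uu.
  + by move=> i; move: j; apply/IH; exact: Ck_on_pd.
- move=> h; apply: (Ck_on_step
    (df := fun i u => \row_j pd i (fun v => f v 0 j) u)) => //.
  + by move=> u Uu; apply/continuous_rowP => i; exact: Ck_on_continuous (h i) Uu.
  + move=> i u Uu; apply/is_derive_rowP => j; rewrite mxE.
    exact: Ck_on_derivable (h j) Uu.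
  + move=> i; apply/IH => j.
    rewrite (_ : (fun v => _) = pd i (fun v => f v 0 j)); first exact: Ck_on_pd.
    by apply/funext => v; rewrite mxE.
Qed.

Lemma Ck_on_dot k U f g : open U -> Ck_on k U f -> Ck_on k U g ->
  Ck_on k U (fun u => dot (f u) (g u)).
Proof.
move=> oU /Ck_on_rowP hf /Ck_on_rowP hg.
by apply: Ck_on_sum => // i; apply: Ck_onM => //; [exact: hf | exact: hg].
Qed.

Lemma Ck_on_scale k U (s : R * R -> R) f : open U -> Ck_on k U s -> Ck_on k U f ->
  Ck_on k U (fun u => s u *: f u).
Proof.
move=> oU hs /Ck_on_rowP hf; apply/Ck_on_rowP => // i.
rewrite (_ : (fun v => _) = fun v => s v * f v 0 i).
  by apply: Ck_onM => //; exact: hf.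
by apply/funext => v; rewrite mxE.
Qed.

End Rows.
End CkOn.

(** * Symmetry of second derivatives *)

Lemma ord2P (i : 'I_2) : i = 0 \/ i = 1.
Proof. by case: i => -[|[|?]] // p; [left | right]; exact: val_inj. Qed.

Lemma is_derive_translate (R : realType) (V W : normedModType R) (g : V -> W)
    (w c v : V) d :
  is_derive (w + c) v g d -> is_derive w v (fun x => g (x + c)) d.
Proof.
move=> [gd gE].
have E : (fun h : R => h^-1 *: (((fun x => g (x + c)) \o shift w) (h *: v)
              - g (w + c))) =
         (fun h : R => h^-1 *: ((g \o shift (w + c)) (h *: v) - g (w + c))).
  by apply/funext => h /=; rewrite addrA.
by apply: DeriveDef; rewrite /derivable /derive E.
Qed.

Section Schwarz.
Context {R : realType}.
Implicit Types (g : R * R -> R) (u : R * R).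

Lemma mvt_line g (w v : R * R) (h : R) : 0 < h ->
  (forall t, 0 <= t <= h -> derivable g (w + t *: v) v) ->
  exists2 t, 0 < t < h & g (w + h *: v) - g w = h * 'D_v g (w + t *: v).
Proof.
move=> h0 dg.
pose p t := g (w + t *: v); pose dp t := 'D_v g (w + t *: v).
have der t : 0 <= t <= h -> is_derive t (1 : R) p (dp t).
  by move=> th; apply/is_derive_line/derivableP/dg.
have [||t] := @MVT _ p dp 0 h h0.
- by move=> t; rewrite in_itv /= => /andP[t0 th]; apply: der; rewrite !ltW.
- apply: derivable_within_continuous => t; rewrite in_itv /= => th.
  by have [] := der t th.
rewrite in_itv /= => th; rewrite /p scale0r addr0 subr0 mulrC => e.
by exists t.
Qed.

(** The second difference of g over a square of side h at u equals h ^ 2 times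
    each of the mixed derivatives at some point of the square; continuity of these
    at u lets h tend to 0. *)
Lemma pd_sym g U u : open U -> Ck_on 2 U g -> U u ->
  pd 0 (pd 1 g) u = pd 1 (pd 0 g) u.
Proof.
move=> oU hg Uu.
set a := pd 0 (pd 1 g) u; set b := pd 1 (pd 0 g) u.
apply/eqP; rewrite -subr_eq0 -normr_le0; apply/ler_addgt0Pr => e e0; rewrite add0r.
have c1 : {for u, continuous (pd 0 (pd 1 g))}.
  by apply: Ck_on_continuous Uu; apply/Ck_on_pd/Ck_on_pd; exact: hg.
have c2 : {for u, continuous (pd 1 (pd 0 g))}.
  by apply: Ck_on_continuous Uu; apply/Ck_on_pd/Ck_on_pd; exact: hg.
have e2 : 0 < e / 2 by rewrite divr_gt0.
have /cvgrPdist_lt /(_ _ e2) /= n1 := c1.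
have /cvgrPdist_lt /(_ _ e2) /= n2 := c2.
have nU : \forall v \near u, U v by exact: near_in oU Uu _.
have [d /= d0 hd] := (nbhs_ballP _ _).1 (filterI (filterI n1 n2) nU).
pose h := d / 2; have h0 : 0 < h by rewrite divr_gt0.
have hdlt : h < d by rewrite /h ltr_pdivrMr // ltr_pMr // ltr1n.
pose pt x y : R * R := (u.1 + x, u.2 + y).
have inb x y : 0 <= x <= h -> 0 <= y <= h -> ball u d (pt x y).
  move=> /andP[x0 xh] /andP[y0 yh]; split; rewrite /ball /= /pt /=.
    by rewrite opprD addNKr normrN ger0_norm // (le_lt_trans xh).
  by rewrite opprD addNKr normrN ger0_norm // (le_lt_trans yh).
have inU x y : 0 <= x <= h -> 0 <= y <= h -> U (pt x y).
  by move=> xh yh; have [] := hd _ (inb _ _ xh yh).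
have z0h : 0 <= (0 : R) <= h by apply/andP; split => //; exact: ltW.
have h0h : 0 <= h <= h by apply/andP; split => //; exact: ltW.
have mv0 x y t : pt x y + t *: ebasis 0 = pt (x + t) y.
  rewrite /pt /ebasis /=; congr pair; rewrite /= /GRing.scale /=; ring.
have mv1 x y t : pt x y + t *: ebasis 1 = pt x (y + t).
  rewrite /pt /ebasis /=; congr pair; rewrite /= /GRing.scale /=; ring.
have dg i v : U v -> is_derive v (ebasis i) g (pd i g v).
  by move=> Uv; exact: Ck_on_derivable hg Uv.
have ddg i j v : U v -> is_derive v (ebasis i) (pd j g) (pd i (pd j g) v).
  by move=> Uv; apply: Ck_on_derivable Uv; apply: Ck_on_pd; exact: hg.
pose Del := g (pt h h) - g (pt h 0) - (g (pt 0 h) - g (pt 0 0)).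
(* The second difference of g over the square of side h is expanded by two
   applications of the mean value theorem, in one order and then in the other. *)
have [x [y [xh yh E1]]] : exists x y, [/\ 0 <= x <= h, 0 <= y <= h &
    Del = h * (h * pd 1 (pd 0 g) (pt x y))].
  pose q v := g (v + h *: ebasis 1) - g v.
  have dq t : 0 <= t <= h -> is_derive (pt 0 0 + t *: ebasis 0) (ebasis 0) q
      (pd 0 g (pt t h) - pd 0 g (pt t 0)).
    move=> th; rewrite mv0 add0r; apply: is_derive_funB; last by apply: dg; exact: inU.
    have := dg 0 (pt t h) (inU _ _ th h0h).
    have -> : pt t h = pt t 0 + h *: ebasis 1 by rewrite mv1 add0r.
    exact: is_derive_translate.
  have [|x /andP[x0 xh] e1] := @mvt_line q (pt 0 0) (ebasis 0) h h0.
    by move=> t /dq [].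
  have xh' : 0 <= x <= h by rewrite !ltW.
  have [|y /andP[y0 yh] e2'] := @mvt_line (pd 0 g) (pt x 0) (ebasis 1) h h0.
    by move=> t th; rewrite mv1 add0r; have [] := ddg 1 0 _ (inU _ _ xh' th).
  exists x, y; split; [exact: xh' | by apply/andP; split; exact: ltW | ].
  have [_ dqE] := dq x xh'; rewrite dqE in e1.
  move: e2'; rewrite !mv1 !add0r => e2'.
  by rewrite /pd -e2' -/(pd 0 g) -e1 /q !mv0 !mv1 !add0r /Del.
have [x' [y' [xh' yh' E2]]] : exists x y, [/\ 0 <= x <= h, 0 <= y <= h &
    Del = h * (h * pd 0 (pd 1 g) (pt x y))].
  pose q v := g (v + h *: ebasis 0) - g v.
  have dq t : 0 <= t <= h -> is_derive (pt 0 0 + t *: ebasis 1) (ebasis 1) q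
      (pd 1 g (pt h t) - pd 1 g (pt 0 t)).
    move=> th; rewrite mv1 add0r; apply: is_derive_funB; last by apply: dg; exact: inU.
    have := dg 1 (pt h t) (inU _ _ h0h th).
    have -> : pt h t = pt 0 t + h *: ebasis 0 by rewrite mv0 add0r.
    exact: is_derive_translate.
  have [|y' /andP[x0 xh'] e1] := @mvt_line q (pt 0 0) (ebasis 1) h h0.
    by move=> t /dq [].
  have xh'' : 0 <= y' <= h by rewrite !ltW.
  have [|x' /andP[y0 yh'] e2'] := @mvt_line (pd 1 g) (pt 0 y') (ebasis 0) h h0.
    by move=> t th; rewrite mv0 add0r; have [] := ddg 0 1 _ (inU _ _ th xh'').
  exists x', y'; split; [by apply/andP; split; exact: ltW | exact: xh'' | ].
  have [_ dqE] := dq y' xh''; rewrite dqE in e1.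
  move: e2'; rewrite !mv0 !add0r => e2'.
  rewrite /pd -e2' -/(pd 1 g) -e1 /q !mv1 !mv0 !add0r /Del; ring.
have E : pd 1 (pd 0 g) (pt x y) = pd 0 (pd 1 g) (pt x' y').
  have hn : h != 0 by rewrite gt_eqF.
  by move: E1; rewrite E2 => /(mulfI hn)/(mulfI hn) ->.
have [[_ B1] _] := hd _ (inb _ _ xh yh).
have [[A1 _] _] := hd _ (inb _ _ xh' yh').
rewrite -/b /= in B1; rewrite -/a /= in A1.
rewrite [e]splitr; apply: (le_trans (ler_distD (pd 0 (pd 1 g) (pt x' y')) _ _)).
by apply: lerD; [exact: ltW A1 | rewrite -E distrC; exact: ltW B1].
Qed.

Lemma pd_sym_row m (f : R * R -> 'rV[R]_m) U u i j : open U -> Ck_on 2 U f ->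
  U u -> pd i (pd j f) u = pd j (pd i f) u.
Proof.
move=> oU hf Uu.
suff main : pd 0 (pd 1 f) u = pd 1 (pd 0 f) u.
  case: (ord2P i) => ->; case: (ord2P j) => ->;
    [reflexivity | exact: main | symmetry; exact: main | reflexivity].
apply/rowP => k.
have row j1 i1 : pd i1 (pd j1 f) u 0 k = pd i1 (pd j1 (fun v => f v 0 k)) u.
  rewrite pd_row; last by have [] := Ck_on_derivable i1 (Ck_on_pd j1 hf) Uu.
  apply: eq_pd oU _ Uu => v Uv; rewrite pd_row //.
  by have [] := Ck_on_derivable j1 hf Uv.
apply: (etrans (row 1 0)); apply: (etrans _ (esym (row 0 1))).
apply: (pd_sym (g := fun v => f v 0 k) oU _ Uu).
by have /(Ck_on_rowP _ _ oU) := hf; apply.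
Qed.
End Schwarz.

(** * Smooth maps *)

Section SmoothOn.
Context {R : realType}.
Variable U : set (R * R).
Hypothesis oU : open U.

Section Gen.
Context {W : normedModType R}.
Implicit Types f g : R * R -> W.

Lemma smooth_on_pd i f : smooth_on U f -> smooth_on U (pd i f).
Proof. by move=> h k; exact: Ck_on_pd (h k.+1). Qed.

Lemma smooth_on_cst (c : W) : smooth_on U (fun=> c).
Proof. by move=> k; exact: Ck_on_cst. Qed.

Lemma smooth_onD f g : smooth_on U f -> smooth_on U g ->
  smooth_on U (fun u => f u + g u).
Proof. by move=> hf hg k; exact: Ck_onD. Qed.

Lemma smooth_onN f : smooth_on U f -> smooth_on U (fun u => - f u).
Proof. by move=> hf k; exact: Ck_onN. Qed.

Lemma eq_smooth_on f g : (forall u, U u -> f u = g u) ->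
  smooth_on U f -> smooth_on U g.
Proof. by move=> fg h k; exact: eq_Ck_on fg (h k). Qed.

Lemma smooth_on_derive f u i : smooth_on U f -> U u ->
  is_derive u (ebasis i) f (pd i f u).
Proof. by move=> h; exact: Ck_on_derivable (h 1). Qed.

End Gen.

Lemma smooth_onM (s t : R * R -> R) : smooth_on U s -> smooth_on U t ->
  smooth_on U (fun u => s u * t u).
Proof. by move=> hf hg k; exact: Ck_onM. Qed.

Lemma smooth_onV (s : R * R -> R) : (forall u, U u -> s u != 0) ->
  smooth_on U s -> smooth_on U (fun u => (s u)^-1).
Proof. by move=> s0 hf k; exact: Ck_onV. Qed.

Lemma smooth_on_sqrt (s : R * R -> R) : (forall u, U u -> 0 < s u) ->
  smooth_on U s -> smooth_on U (fun u => Num.sqrt (s u)).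
Proof. by move=> s0 hf k; exact: Ck_on_sqrt. Qed.

Lemma smooth_on_dot m (f g : R * R -> 'rV[R]_m) : smooth_on U f ->
  smooth_on U g -> smooth_on U (fun u => dot (f u) (g u)).
Proof. by move=> hf hg k; exact: Ck_on_dot. Qed.

Lemma smooth_on_scale m (s : R * R -> R) (f : R * R -> 'rV[R]_m) :
  smooth_on U s -> smooth_on U f -> smooth_on U (fun u => s u *: f u).
Proof. by move=> hf hg k; exact: Ck_on_scale. Qed.

End SmoothOn.

Ltac smooth := repeat first
  [ assumption | apply: smooth_onD | apply: smooth_onN
  | apply: smooth_on_scale | apply: smooth_on_dot
  | apply: smooth_on_pd
  | apply: smooth_onV | apply: smooth_onM | apply: smooth_on_cst ].

(** * Planes spanned by two vectors, and tensors in the Gram-Schmidt frame *)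

Section Dot.
Context {R : realType} {m : nat}.
Implicit Types (v w x : 'rV[R]_m) (a : R).

Lemma dotC v w : dot v w = dot w v.
Proof. by apply: eq_bigr => i _; rewrite mulrC. Qed.

Lemma dotDl v w x : dot (v + w) x = dot v x + dot w x.
Proof. by rewrite /dot -big_split; apply: eq_bigr => i _; rewrite mxE mulrDl. Qed.

Lemma dotZl a v w : dot (a *: v) w = a * dot v w.
Proof. by rewrite /dot mulr_sumr; apply: eq_bigr => i _; rewrite mxE mulrA. Qed.

Lemma dotNl v w : dot (- v) w = - dot v w.
Proof. by rewrite -scaleN1r dotZl mulN1r. Qed.

Lemma dotDr v w x : dot x (v + w) = dot x v + dot x w.
Proof. by rewrite !(dotC x) dotDl. Qed.

Lemma dotZr a v w : dot w (a *: v) = a * dot w v.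
Proof. by rewrite !(dotC w) dotZl. Qed.

Lemma dotNr v w : dot w (- v) = - dot w v.
Proof. by rewrite !(dotC w) dotNl. Qed.

Lemma dot0l v : dot 0 v = 0.
Proof. by rewrite -(scale0r v) dotZl mul0r. Qed.

Lemma dot0r v : dot v 0 = 0.
Proof. by rewrite dotC dot0l. Qed.

Definition dotE := (dotDl, dotDr, dotZl, dotZr, dotNl, dotNr, dot0l, dot0r).

Lemma dot_ge0 v : 0 <= dot v v.
Proof. by apply: sumr_ge0 => i _; rewrite -expr2 sqr_ge0. Qed.

Lemma dot_eq0 v : dot v v = 0 -> v = 0.
Proof.
rewrite /dot => h; apply/rowP => i; rewrite mxE; apply/eqP; rewrite -sqrf_eq0 expr2.
apply/eqP; apply: (psumr_eq0P _ h) => // j _.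
by rewrite -expr2 sqr_ge0.
Qed.

End Dot.

Lemma sum2 (V : zmodType) (F : 'I_2 -> V) : \sum_i F i = F 0 + F 1.
Proof.
rewrite !big_ord_recl big_ord0 addr0; congr (_ + F _); exact: val_inj.
Qed.

(** Turns scalar products into independent variables, which leaves an identity
    between rational functions; genpd does the same with derivatives. *)
Ltac gendot := repeat match goal with
  | |- context[@dot ?R ?m ?x ?y] =>
    let d := fresh "d" in set (d := @dot R m x y) in *; clearbody d end.

Ltac genpd := repeat match goal with
  | |- context[@pd ?R ?V ?i ?f ?u] => generalize (@pd R V i f u); intro end.

Section Plane.
Context {R : realType} {m : nat}.
Implicit Types (a b v w : 'rV[R]_m) (x y : R).

Definition gram a b : R := dot a a * dot b b - dot a b ^+ 2.

(** The combination of a and b whose products with a and b are x and y; the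
    fractions are the entries of the inverse Gram matrix. *)
Definition dual_comb a b x y : 'rV[R]_m :=
  ((dot b b * x - dot a b * y) / gram a b) *: a
  + ((dot a a * y - dot a b * x) / gram a b) *: b.

(** The orthogonal projection to the complement of the plane spanned by a, b. *)
Definition perp a b v : 'rV[R]_m := v - dual_comb a b (dot v a) (dot v b).

(** By the equality case of Cauchy-Schwarz: dot a a * gram a b is the squared
    norm of the non-zero vector (a . a) b - (a . b) a. *)
Lemma gram_gt0_free a b :
  (forall x y, x *: a + y *: b = 0 -> x = 0 /\ y = 0) -> 0 < gram a b.
Proof.
move=> free.
have a0 : 0 < dot a a.
  rewrite lt_neqAle dot_ge0 andbT eq_sym; apply/eqP => /dot_eq0 a0.
  have [] := free 1 0; first by rewrite a0 scaler0 scale0r addr0.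
  by move=> /eqP; rewrite oner_eq0.
pose w := dot a a *: b - dot a b *: a.
have ww : dot w w = dot a a * gram a b.
  by rewrite /w /gram !dotE (dotC b a); gendot; ring.
rewrite -(pmulr_rgt0 _ a0) -ww lt_neqAle dot_ge0 andbT eq_sym.
apply/eqP => /dot_eq0; rewrite /w addrC -scaleNr => /free[_] h.
by rewrite h ltxx in a0.
Qed.

Section Nondegenerate.
Variables a b : 'rV[R]_m.
Hypothesis D0 : 0 < gram a b.

Lemma gram_neq0 : gram a b != 0. Proof. by rewrite gt_eqF. Qed.

Lemma sqrt_gram_neq0 : Num.sqrt (gram a b) != 0.
Proof. by rewrite gt_eqF // sqrtr_gt0. Qed.

Lemma sqr_sqrt_gram : Num.sqrt (gram a b) ^+ 2 = gram a b.
Proof. by rewrite sqr_sqrtr // ltW. Qed.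

Lemma dot_gt0_gram : 0 < dot a a.
Proof.
rewrite lt_neqAle dot_ge0 andbT eq_sym; apply/eqP => h; move: D0.
by rewrite /gram h mul0r sub0r oppr_gt0 ltNge sqr_ge0.
Qed.

Lemma dual_comb_dotl x y : dot (dual_comb a b x y) a = x.
Proof.
have := gram_neq0; rewrite /dual_comb !dotE (dotC b a) /gram; gendot => h.
by field.
Qed.

Lemma dual_comb_dotr x y : dot (dual_comb a b x y) b = y.
Proof.
have := gram_neq0; rewrite /dual_comb !dotE /gram; gendot => h.
by field.
Qed.

Lemma dual_comb_normal x y w : dot w a = 0 -> dot w b = 0 ->
  dot (dual_comb a b x y) w = 0.
Proof. by move=> wa wb; rewrite /dual_comb !dotE !(dotC _ w) wa wb !mulr0 addr0. Qed.

Lemma perp_dotl v : dot (perp a b v) a = 0.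
Proof. by rewrite /perp dotDl dotNl dual_comb_dotl subrr. Qed.

Lemma perp_dotr v : dot (perp a b v) b = 0.
Proof. by rewrite /perp dotDl dotNl dual_comb_dotr subrr. Qed.

Lemma perp_normal v w : dot w a = 0 -> dot w b = 0 -> dot (perp a b v) w = dot v w.
Proof. by move=> wa wb; rewrite /perp dotDl dotNl dual_comb_normal // subr0. Qed.

Lemma dual_comb0 : dual_comb a b 0 0 = 0.
Proof. by rewrite /dual_comb !mulr0 !subrr !mul0r !scale0r addr0. Qed.

Lemma dual_combB x1 y1 x2 y2 :
  dual_comb a b (x1 - x2) (y1 - y2) = dual_comb a b x1 y1 - dual_comb a b x2 y2.
Proof.
apply/rowP => i; have := gram_neq0; rewrite !mxE; gendot => h; by field.
Qed.

Lemma perpD v w : perp a b (v + w) = perp a b v + perp a b w.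
Proof.
by apply/rowP => i; have := gram_neq0; rewrite !mxE !dotE; gendot => h; field.
Qed.

Lemma perpZ x v : perp a b (x *: v) = x *: perp a b v.
Proof.
by apply/rowP => i; have := gram_neq0; rewrite !mxE !dotE; gendot => h; field.
Qed.

Lemma perpN v : perp a b (- v) = - perp a b v.
Proof. by rewrite -scaleN1r perpZ scaleN1r. Qed.

(** A vector with no tangential component is itself normal, so it may be
    tested against itself. *)
Lemma plane_eq0 v : dot v a = 0 -> dot v b = 0 ->
  (forall w, dot w a = 0 -> dot w b = 0 -> dot v w = 0) -> v = 0.
Proof. by move=> va vb vn; apply: dot_eq0; exact: vn. Qed.

End Nondegenerate.
End Plane.

Section Pointwise.
Context {R : realType} {m : nat}.
Implicit Types (v : 'rV[R]_m).

Lemma lift01 : lift (0 : 'I_2) (0 : 'I_1) = 1 :> 'I_2.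
Proof. exact: val_inj. Qed.
Lemma lift10 : lift (1 : 'I_2) (0 : 'I_1) = 0 :> 'I_2.
Proof. exact: val_inj. Qed.

Lemma immersion_gram_gt0 (f : R * R -> 'rV[R]_m) u :
  immersion_at f u -> 0 < gram (pd 0 f u) (pd 1 f u).
Proof.
rewrite /immersion_at => hM; apply: gram_gt0_free => x y h.
pose r : 'rV[R]_2 := \row_i (if i == 0 then x else y).
have rM : r *m (\matrix_(i < 2) pd i f u) = 0.
  by rewrite mulmx_sum_row sum2 !rowK !mxE.
have /eqP := rM; rewrite mulmx_free_eq0 // => /eqP /rowP r0.
by split; [have := r0 0 | have := r0 1]; rewrite !mxE.
Qed.

Variables (f : R * R -> 'rV[R]_m) (u : R * R) (a b : 'rV[R]_m).
Hypothesis fa : pd 0 f u = a.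
Hypothesis fb : pd 1 f u = b.

Lemma metricE : metric f u = \matrix_(i, j)
  dot (if i == 0 then a else b) (if j == 0 then a else b).
Proof.
by apply/matrixP => i j; rewrite !mxE; case: (ord2P i) => ->; case: (ord2P j) => ->;
  rewrite ?fa ?fb.
Qed.

Lemma det_metric : \det (metric f u) = gram a b.
Proof.
rewrite metricE (expand_det_row _ 0) sum2 /cofactor !det_mx11 !mxE /= /gram.
rewrite (dotC b a); gendot; ring.
Qed.

Hypothesis D0 : 0 < gram a b.

Lemma vol_densityE : vol_density f u = Num.sqrt (gram a b).
Proof. by rewrite /vol_density det_metric. Qed.

Let q := Num.sqrt (dot a a).
Let s := Num.sqrt (gram a b).
Let q0 : q != 0. Proof. by rewrite gt_eqF // sqrtr_gt0 (dot_gt0_gram D0). Qed.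
Let s0 : s != 0. Proof. exact: sqrt_gram_neq0. Qed.
Let qE : dot a a = q ^+ 2.
Proof. by rewrite sqr_sqrtr // ltW // (dot_gt0_gram D0). Qed.
Let DE : gram a b = s ^+ 2. Proof. by rewrite sqr_sqrt_gram. Qed.
Let GE : dot b b = (s ^+ 2 + dot a b ^+ 2) / q ^+ 2.
Proof. by rewrite -DE /gram qE; move: q0; gendot => h; field. Qed.

Lemma tframe0E : tframe f u 0 = q^-1 *: a.
Proof. by rewrite /tframe /on_frame1 sum2 /onframe metricE !mxE /= fa fb scale0r addr0. Qed.

Lemma tframe1E : tframe f u 1 = (q * s)^-1 *: (dot a a *: b - dot a b *: a).
Proof.
rewrite /tframe /on_frame1 sum2 /onframe vol_densityE metricE !mxE /= fa fb -/q -/s.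
by rewrite addrC scalerBr !scalerA -scaleNr mulNr !(mulrC _ (q * s)^-1).
Qed.

(** The following formulas eliminate the Gram-Schmidt frame; the square roots
    of a . a cancel, and only the one of the Gram determinant survives, in the
    Hodge operator. *)
Lemma nprojE v : nproj f u v = perp a b v.
Proof.
rewrite /nproj sum2 tframe0E tframe1E !dotE /perp /dual_comb.
apply/rowP => i; rewrite !mxE GE DE qE; move: q0 s0; gendot => h1 h2.
by field; rewrite h1 h2.
Qed.

Lemma trace_frame (T : 'I_2 -> 'I_2 -> 'rV[R]_m) :
  \sum_c on_frame2 f u T c c =
  (gram a b)^-1 *: (dot b b *: T 0 0 - dot a b *: (T 0 1 + T 1 0) + dot a a *: T 1 1).
Proof.
rewrite sum2 /on_frame2 !sum2 /onframe vol_densityE metricE !mxE /= -/q -/s.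
move: (T 0 0) (T 0 1) (T 1 0) (T 1 1) => T00 T01 T10 T11.
apply/rowP => i; rewrite !mxE GE DE qE; move: q0 s0; gendot => h1 h2.
by field; rewrite h1 h2.
Qed.

(** The invariant g^ik g^jl (T_ij . v) (T_kl . w) of a symmetric tensor, which
    for the second fundamental form and v = H gives A~(H) . w. *)
Lemma trace2_frame (T : 'I_2 -> 'I_2 -> 'rV[R]_m) v w : T 1 0 = T 0 1 ->
  \sum_c \sum_d dot (on_frame2 f u T c d) v * dot (on_frame2 f u T c d) w =
  (dot (T 0 0) v * (dot b b ^+ 2 * dot (T 0 0) w
     - 2 * dot b b * dot a b * dot (T 0 1) w + dot a b ^+ 2 * dot (T 1 1) w)
   + 2 * dot (T 0 1) v * (- dot b b * dot a b * dot (T 0 0) w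
     + (dot b b * dot a a + dot a b ^+ 2) * dot (T 0 1) w
     - dot a b * dot a a * dot (T 1 1) w)
   + dot (T 1 1) v * (dot a b ^+ 2 * dot (T 0 0) w
     - 2 * dot a b * dot a a * dot (T 0 1) w + dot a a ^+ 2 * dot (T 1 1) w))
  / gram a b ^+ 2.
Proof.
rewrite !sum2 /on_frame2 !sum2 /onframe vol_densityE metricE !mxE /= -/q -/s => ->.
move: (T 0 0) (T 0 1) (T 1 1) => T00 T01 T11.
rewrite !dotE GE DE qE; move: q0 s0; gendot => h1 h2; by field; rewrite h1 h2.
Qed.

Lemma hodgeE (w : R * R -> 'I_2 -> 'rV[R]_m) (j : 'I_2) : hodge f w u j =
  s^-1 *: (if j == 0 then dot a b *: w u 0 - dot a a *: w u 1
           else dot b b *: w u 0 - dot a b *: w u 1).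
Proof.
rewrite /hodge tframe0E tframe1E /on_frame1 !sum2 /onframe vol_densityE metricE !mxE /= -/q -/s.
move: (w u 0) (w u 1) => w0 w1.
by case: (ord2P j) => -> /=; rewrite ?fa ?fb !dotE ?(dotC b a);
  apply/rowP => i; rewrite !mxE ?GE ?qE; move: q0 s0; gendot => h1 h2; by field; rewrite h1 h2.
Qed.

End Pointwise.

(** * The flux of the Willmore functional *)

Section Fields.
Context {R : realType} {m : nat}.
Implicit Types (f : R * R -> 'rV[R]_m) (u : R * R) (v w : 'rV[R]_m).

(** The component of the second fundamental form along the mean curvature. *)
Definition hcoef f (i j : 'I_2) u : R := dot (mean_curv f u) (pd i (pd j f) u).

(** Minus the tangential part of the j-th derivative of the mean curvature
    vector, see pd_mean_curvE. *)
Definition tpart f (j : 'I_2) u : 'rV[R]_m :=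
  dual_comb (pd 0 f u) (pd 1 f u) (hcoef f 0 j u) (hcoef f 1 j u).

(** The 1-form V of the introduction. Its divergence is the Willmore operator
    (extd_hodge_flux_willmore) and it is the boundary term of the first variation
    (first_variationE). *)
Definition flux f u (j : 'I_2) : 'rV[R]_m :=
  perp (pd 0 f u) (pd 1 f u) (pd j (mean_curv f) u) + tpart f j u
  - dot (mean_curv f u) (mean_curv f u) *: pd j f u.

Section At.
Variables (f : R * R -> 'rV[R]_m) (u : R * R) (a b : 'rV[R]_m).
Hypothesis fa : pd 0 f u = a.
Hypothesis fb : pd 1 f u = b.
Hypothesis D0 : 0 < gram a b.

Lemma mean_curvE : mean_curv f u = (2 * gram a b)^-1 *: perp a b
  (dot b b *: pd 0 (pd 0 f) u
   - dot a b *: (pd 0 (pd 1 f) u + pd 1 (pd 0 f) u)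
   + dot a a *: pd 1 (pd 1 f) u).
Proof.
rewrite /mean_curv.
rewrite (trace_frame fa fb D0 (second_ff f u)).
rewrite /second_ff.
genpd.
rewrite !(nprojE fa fb D0).
by rewrite !perpD // perpN // !perpZ // perpD // scalerA -invfM.
Qed.

Lemma dot_mean_curv0 : dot (mean_curv f u) a = 0.
Proof. by rewrite mean_curvE dotZl perp_dotl // mulr0. Qed.

Lemma dot_mean_curv1 : dot (mean_curv f u) b = 0.
Proof. by rewrite mean_curvE dotZl perp_dotr // mulr0. Qed.

End At.

Section On.
Variables (U : set (R * R)) (f : R * R -> 'rV[R]_m).
Hypothesis oU : open U.
Hypothesis sf : smooth_on U f.
Hypothesis D0 : forall u, U u -> 0 < gram (pd 0 f u) (pd 1 f u).
Let Dn0 u : U u -> gram (pd 0 f u) (pd 1 f u) != 0.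
Proof. by move=> /D0 h; rewrite gt_eqF. Qed.

Lemma smooth_gram : smooth_on U (fun u => gram (pd 0 f u) (pd 1 f u)).
Proof.
rewrite /gram; under eq_fun do rewrite expr2.
by smooth.
Qed.

Lemma smooth_dual_comb (x y : R * R -> R) : smooth_on U x -> smooth_on U y ->
  smooth_on U (fun u => dual_comb (pd 0 f u) (pd 1 f u) (x u) (y u)).
Proof. by move=> hx hy; have hD := smooth_gram; rewrite /dual_comb; smooth. Qed.

Lemma smooth_perp (w : R * R -> 'rV[R]_m) : smooth_on U w ->
  smooth_on U (fun u => perp (pd 0 f u) (pd 1 f u) (w u)).
Proof.
move=> hw; rewrite /perp; apply: smooth_onD => //; apply: smooth_onN => //.
by apply: smooth_dual_comb; smooth.
Qed.

Lemma smooth_mean_curv : smooth_on U (mean_curv f).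
Proof.
have hD := smooth_gram.
apply: (eq_smooth_on oU (fun u Uu => esym (mean_curvE erefl erefl (D0 Uu)))).
apply: smooth_on_scale => //.
  apply: smooth_onV => //; last by smooth.
  by move=> u Uu; rewrite mulf_neq0 // Dn0.
by apply: smooth_perp; smooth.
Qed.

Lemma smooth_hcoef i j : smooth_on U (hcoef f i j).
Proof. by have h := smooth_mean_curv; rewrite /hcoef; smooth. Qed.

Lemma smooth_tpart j : smooth_on U (tpart f j).
Proof. by apply: smooth_dual_comb; exact: smooth_hcoef. Qed.

Lemma smooth_flux j : smooth_on U (fun u => flux f u j).
Proof.
have h := smooth_mean_curv; have hT := smooth_tpart j; rewrite /flux.
have hN : smooth_on U
    (fun u => perp (pd 0 f u) (pd 1 f u) (pd j (mean_curv f) u)).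
  by apply: smooth_perp; smooth.
by smooth.
Qed.

Lemma smooth_hodge (w : R * R -> 'I_2 -> 'rV[R]_m) j :
  (forall i, smooth_on U (fun u => w u i)) -> smooth_on U (fun u => hodge f w u j).
Proof.
move=> hw; have hD := smooth_gram; have h0 := hw 0; have h1 := hw 1.
apply: (eq_smooth_on oU (fun u Uu => esym (hodgeE erefl erefl (D0 Uu) w j))).
have hs : smooth_on U (fun u => (Num.sqrt (gram (pd 0 f u) (pd 1 f u)))^-1).
  apply: smooth_onV => //; last exact: smooth_on_sqrt.
  by move=> u Uu; apply: sqrt_gram_neq0; exact: D0.
by case: (j == 0); smooth.
Qed.

Lemma hcoefC i j u : U u -> hcoef f i j u = hcoef f j i u.
Proof. by move=> Uu; rewrite /hcoef (pd_sym_row i j oU (sf 2) Uu). Qed.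

Lemma dot_mean_curv k u : U u -> dot (mean_curv f u) (pd k f u) = 0.
Proof.
move=> Uu; case: (ord2P k) => ->.
  exact: dot_mean_curv0 erefl erefl (D0 Uu).
exact: dot_mean_curv1 erefl erefl (D0 Uu).
Qed.

(** The derivative of H . f_k = 0. *)
Lemma dot_pd_mean_curv u i k : U u ->
  dot (pd i (mean_curv f) u) (pd k f u) = - hcoef f i k u.
Proof.
move=> Uu; have hH := smooth_mean_curv.
have d1 := smooth_on_derive i hH Uu.
have d2 := smooth_on_derive i (smooth_on_pd k sf) Uu.
have [_ e2] := is_derive_dot d1 d2.
have [_ e1] : is_derive u (ebasis i) (fun x => dot (mean_curv f x) (pd k f x)) 0.
  apply: (eq_is_derive (f := fun=> 0) oU); [|exact: Uu].
  by move=> v Uv; rewrite dot_mean_curv.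
apply/eqP; rewrite -addr_eq0 /hcoef; apply/eqP.
by move: e2; rewrite e1 => <-.
Qed.

Lemma pd_mean_curvE u j : U u -> pd j (mean_curv f) u =
  perp (pd 0 f u) (pd 1 f u) (pd j (mean_curv f) u) - tpart f j u.
Proof.
move=> Uu.
have h0 := dot_pd_mean_curv j 0 Uu; have h1 := dot_pd_mean_curv j 1 Uu.
have g0 := hcoefC j 0 Uu; have g1 := hcoefC j 1 Uu.
have D := D0 Uu; move: h0 h1 D; rewrite /perp /tpart g0 g1.
move: (hcoef f 0 j u) (hcoef f 1 j u) => x y.
genpd.
move=> h0 h1 D.
rewrite h0 h1.
rewrite -[- x]sub0r -[- y]sub0r.
rewrite (dual_combB D 0 0 x y) dual_comb0.
by rewrite sub0r opprK addrK.
Qed.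

End On.
End Fields.

(** * Derivatives of the metric and of the second fundamental form *)

Lemma is_derive_unique (R : realType) (V W : normedModType R) (f : V -> W) u v d1 d2 :
  is_derive u v f d1 -> is_derive u v f d2 -> d1 = d2.
Proof. by move=> [_ <-] [_ <-]. Qed.

Section Jets.
Context {R : realType} {m : nat}.
Variables (U : set (R * R)) (f : R * R -> 'rV[R]_m).
Hypothesis oU : open U.
Hypothesis sf : smooth_on U f.
Hypothesis D0 : forall u, U u -> 0 < gram (pd 0 f u) (pd 1 f u).
Local Notation H := (mean_curv f).
Definition gij i j u := dot (pd i f u) (pd j f u).
Definition dgij k i j u := dot (pd k (pd i f) u) (pd j f u) + dot (pd i f u) (pd k (pd j f) u).
Definition gramf u := gram (pd 0 f u) (pd 1 f u).
Definition dgramf k u := dgij k 0 0 u * gij 1 1 u + gij 0 0 u * dgij k 1 1 u - 2 * gij 0 1 u * dgij k 0 1 u.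
Definition dhcoef i j k u := dot (pd i H u) (pd j (pd k f) u) + dot (H u) (pd i (pd j (pd k f)) u).

Lemma derive_metric k i j u : U u -> is_derive u (ebasis k) (gij i j) (dgij k i j u).
Proof.
move=> Uu; apply: is_derive_dot.
  exact: smooth_on_derive (smooth_on_pd i sf) Uu.
exact: smooth_on_derive (smooth_on_pd j sf) Uu.
Qed.

Lemma derive_gram k u : U u -> is_derive u (ebasis k) gramf (dgramf k u).
Proof.
move=> Uu.
have dE := derive_metric k 0 0 Uu; have dF := derive_metric k 0 1 Uu.
have dG := derive_metric k 1 1 Uu.
have h := is_derive_funB (is_derive_funM dE dG) (is_derive_funM dF dF).
apply: is_derive_eq h _; rewrite /dgramf.
by move: (gij 0 0 u) (gij 0 1 u) (gij 1 1 u) (dgij k 0 0 u) (dgij k 0 1 u) (dgij k 1 1 u) => *; ring.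
Qed.

Lemma derive_hcoef i j k u : U u -> is_derive u (ebasis i) (hcoef f j k) (dhcoef i j k u).
Proof.
move=> Uu; apply: is_derive_dot.
  exact: smooth_on_derive (smooth_mean_curv oU sf D0) Uu.
exact: smooth_on_derive (smooth_on_pd j (smooth_on_pd k sf)) Uu.
Qed.

Lemma derive_dotH k u : U u -> is_derive u (ebasis k) (fun x => dot (H x) (H x))
  (2 * dot (H u) (pd k H u)).
Proof.
move=> Uu; have d := smooth_on_derive k (smooth_mean_curv oU sf D0) Uu.
apply: is_derive_eq (is_derive_dot d d) _.
by rewrite (dotC (pd k _ u)) mulr_natl mulr2n.
Qed.

Lemma mean_curv_comb u : U u ->
  let X := gij 1 1 u *: pd 0 (pd 0 f) u - (2 * gij 0 1 u) *: pd 0 (pd 1 f) u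
    + gij 0 0 u *: pd 1 (pd 1 f) u in
  (2 * gramf u) *: H u = X - dual_comb (pd 0 f u) (pd 1 f u) (dot X (pd 0 f u)) (dot X (pd 1 f u)).
Proof.
move=> Uu X; have e1 := mean_curvE erefl erefl (D0 Uu).
have e2 := pd_sym_row 1 0 oU (sf 2) Uu; have h := gram_neq0 (D0 Uu).
move: e1 e2 h; rewrite /X /gramf /gij; move: (mean_curv f u) => H'; genpd.
move=> -> -> h; rewrite scalerA mulfV ?mulf_neq0 // scale1r.
by rewrite scalerDr -scalerDl -mulr2n -[_ *+ 2]mulr_natl.
Qed.

(** Paired with a normal vector, twice the mean curvature is the trace of the
    second derivatives of f. *)
Lemma mean_curv_trace u w : U u ->
  dot w (pd 0 f u) = 0 -> dot w (pd 1 f u) = 0 ->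
  2 * gramf u * dot (H u) w = gij 1 1 u * dot (pd 0 (pd 0 f) u) w
   - 2 * gij 0 1 u * dot (pd 0 (pd 1 f) u) w + gij 0 0 u * dot (pd 1 (pd 1 f) u) w.
Proof.
move=> Uu w0 w1; have := mean_curv_comb Uu; have := D0 Uu; move: w0 w1.
rewrite /gramf /gij; move: (mean_curv f u) => H'; genpd.
move=> /= w0 w1 D1 e; rewrite -dotZl e dotDl dotNl (dual_comb_normal _ _ w0 w1) subr0.
by rewrite dotDl dotDl dotNl !dotZl.
Qed.

Lemma trace_hcoef u : U u -> 2 * gramf u * dot (H u) (H u) =
  gij 1 1 u * hcoef f 0 0 u - 2 * gij 0 1 u * hcoef f 0 1 u + gij 0 0 u * hcoef f 1 1 u.
Proof.
move=> Uu.
have e := mean_curv_trace Uu (dot_mean_curv D0 0 Uu) (dot_mean_curv D0 1 Uu).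
by apply: (etrans e); rewrite /hcoef; move: (H u) (gij 1 1 u) (gij 0 1 u) (gij 0 0 u);
  genpd => x *; rewrite ![dot x _]dotC.
Qed.

(** The derivative of the trace identity trace_hcoef. It is the only source
    of relations between third derivatives of f and derivatives of H, and plays
    the role of the Codazzi equations. *)
Lemma derive_trace_hcoef k u : U u ->
  2 * dgramf k u * dot (H u) (H u) + 4 * gramf u * dot (H u) (pd k H u) =
  dgij k 1 1 u * hcoef f 0 0 u + gij 1 1 u * dhcoef k 0 0 u
  - 2 * (dgij k 0 1 u * hcoef f 0 1 u + gij 0 1 u * dhcoef k 0 1 u)
  + (dgij k 0 0 u * hcoef f 1 1 u + gij 0 0 u * dhcoef k 1 1 u).
Proof.
move=> Uu.
have dE := derive_metric k 0 0 Uu; have dF := derive_metric k 0 1 Uu.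
have dG := derive_metric k 1 1 Uu.
have h00 := derive_hcoef k 0 0 Uu. have h01 := derive_hcoef k 0 1 Uu.
have h11 := derive_hcoef k 1 1 Uu.
have c2 := is_derive_funcst (2 : R) u (ebasis k).
have lhs := is_derive_funM (is_derive_funM c2 (derive_gram k Uu)) (derive_dotH k Uu).
have rhs := is_derive_funD (is_derive_funB (is_derive_funM dG h00)
   (is_derive_funM (is_derive_funM c2 dF) h01)) (is_derive_funM dE h11).
have := is_derive_unique (eq_is_derive oU (fun v Uv => trace_hcoef Uv) Uu lhs) rhs.
rewrite !mul0r !add0r => e; apply: etrans; first apply: etrans e.
  move: (dgramf k u) (gramf u) (dot _ _) (dot _ _) => *; ring.
move: (dgij k 0 0 u) (dgij k 0 1 u) (dgij k 1 1 u) (dhcoef k 0 0 u) (dhcoef k 0 1 u) (dhcoef k 1 1 u) => *.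
move: (gij 0 0 u) (gij 0 1 u) (gij 1 1 u) (hcoef f 0 0 u) (hcoef f 0 1 u) (hcoef f 1 1 u) => *.
by ring.
Qed.

Lemma dot_flux v w j : U v -> dot (flux f v j) w =
  dot (pd j H v) w + 2 * dot (tpart f j v) w - dot (H v) (H v) * dot (pd j f v) w.
Proof.
move=> Uv; have := pd_mean_curvE oU sf D0 j Uv; rewrite /flux.
move: (perp _ _ _) (tpart f j v) (H v) => P T h; genpd => e.
by rewrite e !dotE; gendot; ring.
Qed.

Lemma dot_flux_tangent v j k : U v -> dot (flux f v j) (pd k f v) =
  hcoef f j k v - dot (H v) (H v) * gij j k v.
Proof.
move=> Uv; rewrite dot_flux // (dot_pd_mean_curv oU sf D0) // -/(gij j k v).
have -> : dot (tpart f j v) (pd k f v) = hcoef f j k v; last first.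
  by move: (hcoef _ _ _ _) (_ * gij _ _ _) => *; ring.
rewrite (hcoefC oU sf j k Uv).
case: (ord2P k) => ->; [apply: dual_comb_dotl | apply: dual_comb_dotr]; exact: D0.
Qed.

Lemma derive_flux_tangent u i j k : U u ->
  dot (pd i (fun v => flux f v j) u) (pd k f u) =
  dhcoef i j k u - 2 * dot (H u) (pd i H u) * gij j k u - dot (H u) (H u) * dgij i j k u
  - dot (flux f u j) (pd i (pd k f) u).
Proof.
move=> Uu.
have dV := smooth_on_derive i (smooth_flux oU sf D0 j) Uu.
have df := smooth_on_derive i (smooth_on_pd k sf) Uu.
have lhs := is_derive_dot dV df.
have rhs := is_derive_funB (derive_hcoef i j k Uu)
   (is_derive_funM (derive_dotH i Uu) (derive_metric i j k Uu)).
have := is_derive_unique (eq_is_derive oU (fun v Uv => dot_flux_tangent j k Uv) Uu lhs) rhs.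
move=> /eqP; rewrite -subr_eq0 => /eqP e; apply/eqP; rewrite -subr_eq0 -[X in _ == X]e.
apply/eqP.
move: (dhcoef i j k u) (gij j k u) (dgij i j k u); gendot => *; ring.
Qed.

End Jets.

Section Divergence.
Context {R : realType} {m : nat}.
Variables (U : set (R * R)) (f : R * R -> 'rV[R]_m).
Hypothesis oU : open U.
Hypothesis sf : smooth_on U f.
Hypothesis D0 : forall u, U u -> 0 < gram (pd 0 f u) (pd 1 f u).
Local Notation H := (mean_curv f).

Definition area_density u := Num.sqrt (gramf f u).
(** The derivative of the inverse of the area density, which is the factor
    of the Hodge operator in coordinates. *)
Definition dinv_area_density k u := - (area_density u)^-2 * (dgramf f k u / (2 * area_density u)).

Lemma derive_inv_area_density k u : U u ->
  is_derive u (ebasis k) (fun v => (area_density v)^-1) (dinv_area_density k u).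
Proof.
move=> Uu; apply: is_derive_funV; first exact: sqrt_gram_neq0 (D0 Uu).
have := derive_gram sf k Uu; apply: is_derive_sqrt; exact: D0.
Qed.

Lemma extd_hodge w u : U u -> (forall j, smooth_on U (fun v => w v j)) ->
  extd (hodge f w) u =
  dinv_area_density 0 u *: (gij f 1 1 u *: w u 0 - gij f 0 1 u *: w u 1)
  + (area_density u)^-1 *: (dgij f 0 1 1 u *: w u 0 + gij f 1 1 u *: pd 0 (fun v => w v 0) u
      - (dgij f 0 0 1 u *: w u 1 + gij f 0 1 u *: pd 0 (fun v => w v 1) u))
  - (dinv_area_density 1 u *: (gij f 0 1 u *: w u 0 - gij f 0 0 u *: w u 1)
     + (area_density u)^-1 *: (dgij f 1 0 1 u *: w u 0 + gij f 0 1 u *: pd 1 (fun v => w v 0) u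
      - (dgij f 1 0 0 u *: w u 1 + gij f 0 0 u *: pd 1 (fun v => w v 1) u))).
Proof.
move=> Uu sw; rewrite /extd.
have dw k j := smooth_on_derive k (sw j) Uu.
have dg k i j := derive_metric sf k i j Uu.
have h1 := is_derive_scale (derive_inv_area_density 0 Uu) (is_derive_funB
    (is_derive_scale (dg 0 1 1) (dw 0 0)) (is_derive_scale (dg 0 0 1) (dw 0 1))).
have h0 := is_derive_scale (derive_inv_area_density 1 Uu) (is_derive_funB
    (is_derive_scale (dg 1 0 1) (dw 1 0)) (is_derive_scale (dg 1 0 0) (dw 1 1))).
have [_ e1] :=
  eq_is_derive oU (fun v Uv => esym (hodgeE erefl erefl (D0 Uv) w 1)) Uu h1.
have [_ e0] :=
  eq_is_derive oU (fun v Uv => esym (hodgeE erefl erefl (D0 Uv) w 0)) Uu h0.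
exact: (congr2 (fun x y => x - y) e1 e0).
Qed.

Lemma dot_tpart j w u : dot (tpart f j u) w =
  ((gij f 1 1 u * hcoef f 0 j u - gij f 0 1 u * hcoef f 1 j u) * dot (pd 0 f u) w
  + (gij f 0 0 u * hcoef f 1 j u - gij f 0 1 u * hcoef f 0 j u) * dot (pd 1 f u) w)
  / gramf f u.
Proof.
rewrite /tpart /dual_comb /gij /gramf.
generalize (hcoef f 0 j u) (hcoef f 1 j u); genpd => x y.
generalize (gram s s0)^-1 => z.
by rewrite !dotE; gendot; ring.
Qed.

Lemma dot_fluxE v w j : U v -> dot (flux f v j) w = dot (pd j H v) w
  + 2 * (((gij f 1 1 v * hcoef f 0 j v - gij f 0 1 v * hcoef f 1 j v) * dot (pd 0 f v) w
  + (gij f 0 0 v * hcoef f 1 j v - gij f 0 1 v * hcoef f 0 j v) * dot (pd 1 f v) w)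
  / gramf f v) - dot (H v) (H v) * dot (pd j f v) w.
Proof. by move=> Uv; rewrite (dot_flux oU sf D0 _ _ Uv) dot_tpart. Qed.

End Divergence.

(** * The divergence of the flux is normal to the surface *)

(** The variables are the values at one point of A_ij = f_ij . f_0,
    B_ij = f_ij . f_1, h_ij = H . f_ij, k_ijl = H . f_ijl, p_kij = H_k . f_ij,
    N = |H| ^ 2 and n_k = H . H_k, where H_k is a derivative of H; moreover E, F, G
    are the coefficients of the metric and s is the area density. *)
Section Scalar.
Variable R : realType.
Variables E F G s A00 A01 A11 B00 B01 B11 h00 h01 h11 : R.
Variables k000 k001 k011 k111 p000 p001 p011 p100 p101 p111 N n0 n1 : R.
Hypothesis E0 : E != 0.
Hypothesis s0 : s != 0.
Hypothesis GE : G = (s ^+ 2 + F ^+ 2) / E.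
Let D := s ^+ 2.

Hypothesis hN : 2 * D * N = G * h00 - 2 * F * h01 + E * h11.
Let NE : N = (G * h00 - 2 * F * h01 + E * h11) / (2 * D).
Proof. by rewrite -hN; rewrite /D; field; rewrite s0. Qed.

Let dE0 := 2 * A00. Let dE1 := 2 * A01.
Let dF0 := B00 + A01. Let dF1 := B01 + A11.
Let dG0 := 2 * B01. Let dG1 := 2 * B11.
Let dD0 := dE0 * G + E * dG0 - 2 * F * dF0.
Let dD1 := dE1 * G + E * dG1 - 2 * F * dF1.
Let x := G * A00 - 2 * F * A01 + E * A11.
Let y := G * B00 - 2 * F * B01 + E * B11.
Let al := (G * x - F * y) / D.
Let be := (E * y - F * x) / D.

Hypothesis hA0 : 4 * D * n0 + 2 * N * dD0 = dG0 * h00 + G * (p000 + k000)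
  - 2 * dF0 * h01 - 2 * F * (p001 + k001) + dE0 * h11 + E * (p011 + k011).
Hypothesis hB0 : G * p000 - 2 * F * p001 + E * p011 = 2 * D * n0 - al * h00 - be * h01.
Hypothesis hA1 : 4 * D * n1 + 2 * N * dD1 = dG1 * h00 + G * (p100 + k001)
  - 2 * dF1 * h01 - 2 * F * (p101 + k011) + dE1 * h11 + E * (p111 + k111).
Hypothesis hB1 : G * p100 - 2 * F * p101 + E * p111 = 2 * D * n1 - al * h01 - be * h11.

Let n0E : n0 = (- 2 * N * dD0 + dG0 * h00 + G * k000 - 2 * dF0 * h01 - 2 * F * k001
   + dE0 * h11 + E * k011 - al * h00 - be * h01) / (2 * D).
Proof.
have D2 : 2 * D != 0 by rewrite mulf_neq0 // expf_neq0.
apply: (mulIf D2); rewrite divfK //.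
have -> : n0 * (2 * D) = (4 * D * n0 + 2 * N * dD0) - 2 * N * dD0 - 2 * D * n0 by ring.
rewrite hA0.
have -> : 2 * D * n0 = G * p000 - 2 * F * p001 + E * p011 + al * h00 + be * h01.
  by rewrite hB0; ring.
by ring.
Qed.
Let n1E : n1 = (- 2 * N * dD1 + dG1 * h00 + G * k001 - 2 * dF1 * h01 - 2 * F * k011
   + dE1 * h11 + E * k111 - al * h01 - be * h11) / (2 * D).
Proof.
have D2 : 2 * D != 0 by rewrite mulf_neq0 // expf_neq0.
apply: (mulIf D2); rewrite divfK //.
have -> : n1 * (2 * D) = (4 * D * n1 + 2 * N * dD1) - 2 * N * dD1 - 2 * D * n1 by ring.
rewrite hA1.
have -> : 2 * D * n1 = G * p100 - 2 * F * p101 + E * p111 + al * h01 + be * h11.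
  by rewrite hB1; ring.
by ring.
Qed.

(* The pairings of the flux V_j with f_k. *)
Let v00 := h00 - N * E. Let v01 := h01 - N * F. Let v11 := h11 - N * G.
(* The pairings of T_j with a vector whose pairings with f_0, f_1 are Aa, Bb. *)
Let T0 Aa Bb := ((G * h00 - F * h01) * Aa + (E * h01 - F * h00) * Bb) / D.
Let T1 Aa Bb := ((G * h01 - F * h11) * Aa + (E * h11 - F * h01) * Bb) / D.
(* The pairings of V_j with f_kl. *)
Let V0_00 := p000 + 2 * T0 A00 B00 - N * A00.
Let V0_01 := p001 + 2 * T0 A01 B01 - N * A01.
Let V0_11 := p011 + 2 * T0 A11 B11 - N * A11.
Let V1_00 := p100 + 2 * T1 A00 B00 - N * B00.
Let V1_01 := p101 + 2 * T1 A01 B01 - N * B01.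
Let V1_11 := p111 + 2 * T1 A11 B11 - N * B11.
(* The pairings of the i-th derivative of V_j with f_k, by the product rule. *)
Let d00_0 := p000 + k000 - 2 * n0 * E - N * dE0 - V0_00.
Let d01_0 := p001 + k001 - 2 * n0 * F - N * dF0 - V1_00.
Let d10_0 := p100 + k001 - 2 * n1 * E - N * dE1 - V0_01.
Let d11_0 := p101 + k011 - 2 * n1 * F - N * dF1 - V1_01.
Let d00_1 := p001 + k001 - 2 * n0 * F - N * dF0 - V0_01.
Let d01_1 := p011 + k011 - 2 * n0 * G - N * dG0 - V1_01.
Let d10_1 := p101 + k011 - 2 * n1 * F - N * dF1 - V0_11.
Let d11_1 := p111 + k111 - 2 * n1 * G - N * dG1 - V1_11.
Let ds0 := - s^-2 * (dD0 / (2 * s)).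
Let ds1 := - s^-2 * (dD1 / (2 * s)).

(** The two components of the exterior derivative of the Hodge dual of the
    flux along f_0 and f_1. The hypotheses hA come from the trace identity
    differentiated and hB from the trace of f_ij paired with the derivatives of H,
    whose tangential parts contribute al and be. They determine n0 and n1, after
    which the third derivatives k and the products p cancel. *)
Lemma tangential_identities :
  ds0 * (G * v00 - F * v01) + s^-1 * (dG0 * v00 + G * d00_0 - (dF0 * v01 + F * d01_0))
  - (ds1 * (F * v00 - E * v01) + s^-1 * (dF1 * v00 + F * d10_0 - (dE1 * v01 + E * d11_0)))
  = 0 /\
  ds0 * (G * v01 - F * v11) + s^-1 * (dG0 * v01 + G * d00_1 - (dF0 * v11 + F * d01_1))
  - (ds1 * (F * v01 - E * v11) + s^-1 * (dF1 * v01 + F * d10_1 - (dE1 * v11 + E * d11_1)))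
  = 0.
Proof.
split.
  rewrite /d00_0 /d01_0 /d10_0 /d11_0 n0E n1E /v00 /v01.
  rewrite /V0_00 /V1_00 /V0_01 /V1_01 /T0 /T1 NE /ds0 /ds1 /al /be /x /y.
  rewrite /dD0 /dD1 /dE0 /dE1 /dF0 /dF1 /dG0 /dG1 /D GE.
  by field; rewrite E0 s0.
rewrite /d00_1 /d01_1 /d10_1 /d11_1 n0E n1E /v11 /v01.
rewrite /V0_11 /V1_11 /V0_01 /V1_01 /T0 /T1 NE /ds0 /ds1 /al /be /x /y.
rewrite /dD0 /dD1 /dE0 /dE1 /dF0 /dF1 /dG0 /dG1 /D GE.
by field; rewrite E0 s0.
Qed.

End Scalar.

(** As before; moreover w is a normal vector, b_ij = f_ij . w, o_k = H_k . w,
    eta = H . w, and w_ij is the pairing of w with the i-th derivative of the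
    normal part of H_j. *)
Section ScalarNormal.
Variable R : realType.
Variables E F G s A00 A01 A11 B00 B01 B11 h00 h01 h11 : R.
Variables b00 b01 b11 w00 w01 w10 w11 o0 o1 N eta : R.
Hypothesis E0 : E != 0.
Hypothesis s0 : s != 0.
Hypothesis GE : G = (s ^+ 2 + F ^+ 2) / E.
Let D := s ^+ 2.
Hypothesis heta : 2 * D * eta = G * b00 - 2 * F * b01 + E * b11.
Let etaE : eta = (G * b00 - 2 * F * b01 + E * b11) / (2 * D).
Proof. by rewrite -heta; rewrite /D; field; rewrite s0. Qed.
Let dE0 := 2 * A00. Let dE1 := 2 * A01.
Let dF0 := B00 + A01. Let dF1 := B01 + A11.
Let dG0 := 2 * B01. Let dG1 := 2 * B11.
Let dD0 := dE0 * G + E * dG0 - 2 * F * dF0.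
Let dD1 := dE1 * G + E * dG1 - 2 * F * dF1.
Let T0 Aa Bb := ((G * h00 - F * h01) * Aa + (E * h01 - F * h00) * Bb) / D.
Let T1 Aa Bb := ((G * h01 - F * h11) * Aa + (E * h11 - F * h01) * Bb) / D.
Let e00 := w00 + T0 b00 b01 - N * b00.
Let e10 := w10 + T0 b01 b11 - N * b01.
Let e01 := w01 + T1 b00 b01 - N * b01.
Let e11 := w11 + T1 b01 b11 - N * b11.
Let ds0 := - s^-2 * (dD0 / (2 * s)).
Let ds1 := - s^-2 * (dD1 / (2 * s)).
Let c0 Aa Bb := (G * Aa - F * Bb) / D.
Let c1 Aa Bb := (E * Bb - F * Aa) / D.
Let L00 := w00 - (c0 A00 B00 * o0 + c1 A00 B00 * o1).
Let L01 := w01 - (c0 A01 B01 * o0 + c1 A01 B01 * o1).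
Let L10 := w10 - (c0 A01 B01 * o0 + c1 A01 B01 * o1).
Let L11 := w11 - (c0 A11 B11 * o0 + c1 A11 B11 * o1).

(** The component along a normal vector w. On the left the product rule for
    the Hodge dual of the flux; on the right the Willmore operator in coordinates,
    with the Christoffel symbols c0, c1. *)
Lemma normal_identity :
  ds0 * (G * o0 - F * o1) + s^-1 * (dG0 * o0 + G * e00 - (dF0 * o1 + F * e01))
  - (ds1 * (F * o0 - E * o1) + s^-1 * (dF1 * o0 + F * e10 - (dE1 * o1 + E * e11)))
  = s * (D^-1 * (G * L00 - F * (L01 + L10) + E * L11) - 2 * N * eta
    + (h00 * (G ^+ 2 * b00 - 2 * G * F * b01 + F ^+ 2 * b11)
       + 2 * h01 * (- G * F * b00 + (G * E + F ^+ 2) * b01 - F * E * b11)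
       + h11 * (F ^+ 2 * b00 - 2 * F * E * b01 + E ^+ 2 * b11)) / D ^+ 2).
Proof.
rewrite /L00 /L01 /L10 /L11 /c0 /c1 /e00 /e10 /e01 /e11 etaE /T0 /T1 /ds0 /ds1.
rewrite /dD0 /dD1 /dE0 /dE1 /dF0 /dF1 /dG0 /dG1 /D GE.
by field; rewrite E0 s0.
Qed.

End ScalarNormal.

(** The identities to be proved are algebraic in the values at u of the
    derivatives of f, of the mean curvature and of the flux. *)
Ltac abstract_jet f u :=
  rewrite /dinv_area_density /area_density /dgramf /dhcoef /dgij /hcoef /gij /gramf;
  generalize (pd 0 (pd 0 (pd 0 f)) u) as t000;
  generalize (pd 0 (pd 0 (pd 1 f)) u) as t001;
  generalize (pd 0 (pd 1 (pd 0 f)) u) as t010;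
  generalize (pd 0 (pd 1 (pd 1 f)) u) as t011;
  generalize (pd 1 (pd 0 (pd 0 f)) u) as t100;
  generalize (pd 1 (pd 0 (pd 1 f)) u) as t101;
  generalize (pd 1 (pd 1 (pd 0 f)) u) as t110;
  generalize (pd 1 (pd 1 (pd 1 f)) u) as t111;
  generalize (pd 0 (pd 0 f) u) as f00;
  generalize (pd 0 (pd 1 f) u) as f01;
  generalize (pd 1 (pd 0 f) u) as f10;
  generalize (pd 1 (pd 1 f) u) as f11;
  generalize (pd 0 f u) as a;
  generalize (pd 1 f u) as b;
  generalize (pd 0 (mean_curv f) u) as h0;
  generalize (pd 1 (mean_curv f) u) as h1;
  generalize (mean_curv f u) as h;
  generalize (pd 0 (fun v => flux f v 0) u) as d00;
  generalize (pd 0 (fun v => flux f v 1) u) as d01;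
  generalize (pd 1 (fun v => flux f v 0) u) as d10;
  generalize (pd 1 (fun v => flux f v 1) u) as d11;
  generalize (flux f u 0) as V0;
  generalize (flux f u 1) as V1;
  intros V1 V0 d11 d10 d01 d00 h h1 h0 b a f11 f10 f01 f00 t111 t110 t101 t100 t011 t010 t001 t000.

(** Transfers an equation to another one that differs from it by an algebraic
    identity. *)
Lemma eq_from_sub (R : zmodType) (a b c d : R) : c = d -> a - b = c - d -> a = b.
Proof. by move=> -> /eqP; rewrite subrr subr_eq0 => /eqP. Qed.

Section Divergence.
Context {R : realType} {m : nat}.
Variables (U : set (R * R)) (f : R * R -> 'rV[R]_m).
Hypothesis oU : open U.
Hypothesis sf : smooth_on U f.
Hypothesis D0 : forall u, U u -> 0 < gram (pd 0 f u) (pd 1 f u).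
Local Notation H := (mean_curv f).

(** After both sides have been expressed by the derivatives of f up to order
    three and those of H, only symmetric second derivatives, the trace identity and
    its derivative, and the pairings of the flux with f_k and f_kl are used. *)
Lemma flux_tangential k u : U u -> dot (extd (hodge f (flux f)) u) (pd k f u) = 0.
Proof.
move=> Uu.
rewrite (extd_hodge oU sf D0 Uu (smooth_flux oU sf D0)).
have S := pd_sym_row 1 0 oU (sf 2) Uu.
have S001 := pd_sym_row 1 0 oU (smooth_on_pd 0 sf 2) Uu.
have S011 := pd_sym_row 1 0 oU (smooth_on_pd 1 sf 2) Uu.
have S' i := eq_pd i oU (fun v Uv => pd_sym_row 1 0 oU (sf 2) Uv) Uu.
have S0 := S' 0; have S1 := S' 1.
have L1 := trace_hcoef oU sf D0 Uu.
have L20 := derive_trace_hcoef oU sf D0 0 Uu.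
have L21 := derive_trace_hcoef oU sf D0 1 Uu.
have L30 := congr1 (dot (pd 0 H u)) (mean_curv_comb oU sf D0 Uu).
have L31 := congr1 (dot (pd 1 H u)) (mean_curv_comb oU sf D0 Uu).
have N00 := dot_pd_mean_curv oU sf D0 0 0 Uu.
have N01 := dot_pd_mean_curv oU sf D0 0 1 Uu.
have N10 := dot_pd_mean_curv oU sf D0 1 0 Uu.
have N11 := dot_pd_mean_curv oU sf D0 1 1 Uu.
have T0 := dot_flux_tangent oU sf D0 0 k Uu.
have T1 := dot_flux_tangent oU sf D0 1 k Uu.
have W00 := dot_fluxE oU sf D0 (pd 0 (pd k f) u) 0 Uu.
have W10 := dot_fluxE oU sf D0 (pd 0 (pd k f) u) 1 Uu.
have W01 := dot_fluxE oU sf D0 (pd 1 (pd k f) u) 0 Uu.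
have W11 := dot_fluxE oU sf D0 (pd 1 (pd k f) u) 1 Uu.
have X00 := derive_flux_tangent oU sf D0 0 0 k Uu.
have X01 := derive_flux_tangent oU sf D0 0 1 k Uu.
have X10 := derive_flux_tangent oU sf D0 1 0 k Uu.
have X11 := derive_flux_tangent oU sf D0 1 1 k Uu.
have Epos := dot_gt0_gram (D0 Uu).
have sE := sqr_sqrt_gram (D0 Uu).
have s0 := sqrt_gram_neq0 (D0 Uu).
move: S S001 S011 S0 S1 L1 L20 L21 L30 L31 N00 N01 N10 N11 T0 T1 W00 W10 W01 W11.
move: X00 X01 X10 X11 Epos sE s0.
case: (ord2P k) => ->.
all: abstract_jet f u.
all: move=> X00 X01 X10 X11 Epos sE s0 S S001 S011 S0 S1 L1 L20 L21 L30 L31.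
all: move=> N00 N01 N10 N11 T0 T1 W00 W10 W01 W11.
(* Mixed derivatives are symmetric, so each is replaced by one representative. *)
all: subst f10 t100 t101 t010 t110; clear U oU sf D0 Uu S'.
all: have E0 : dot a a != 0 by [rewrite gt_eqF].
(* The area density s becomes a variable, in terms of which b . b is expressed:
   this leaves a rational identity with denominators a . a and s only. *)
all: have GE : dot b b = (Num.sqrt (gram a b) ^+ 2 + dot a b ^+ 2) / dot a a
  by [rewrite sE /gram; move: E0; gendot => E0; field].
all: move: (Num.sqrt (gram a b)) sE s0 GE => s sE s0 GE.
all: rewrite /dual_comb !dotE N00 N01 in L30.
all: rewrite /dual_comb !dotE N10 N11 in L31.
all: rewrite -sE in L1 L20 L21 L30 L31 W00 W01 W10 W11.
all: try rewrite -> (dotC a f00) in *; try rewrite -> (dotC a f01) in *.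
all: try rewrite -> (dotC a f11) in *; try rewrite -> (dotC b f00) in *.
all: try rewrite -> (dotC b f01) in *; try rewrite -> (dotC b f11) in *.
all: try rewrite -> (dotC b a) in *.
all: have [||||id0 id1] := @tangential_identities R (dot a a) (dot a b) (dot b b) s
  (dot f00 a) (dot f01 a) (dot f11 a) (dot f00 b) (dot f01 b) (dot f11 b)
  (dot h f00) (dot h f01) (dot h f11)
  (dot h t000) (dot h t001) (dot h t011) (dot h t111)
  (dot h0 f00) (dot h0 f01) (dot h0 f11) (dot h1 f00) (dot h1 f01) (dot h1 f11)
  (dot h h) (dot h h0) (dot h h1) E0 s0 GE L1.
1,6: by apply: eq_from_sub L20 _; clear; gendot; ring.
1,5: by apply: eq_from_sub (esym L30) _; rewrite (dotC h0 h); move: s0; clear; gendot => s0; field.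
1,4: by apply: eq_from_sub L21 _; clear; gendot; ring.
1,3: by apply: eq_from_sub (esym L31) _; rewrite (dotC h1 h); move: s0; clear; gendot => s0; field.
1: apply: etrans id0. 2: apply: etrans id1.
all: rewrite !dotE T0 T1 X00 X01 X10 X11 W00 W01 W10 W11.
all: by move: s0; clear; gendot => s0; field.
Qed.

End Divergence.

(** * The divergence of the flux is the Willmore operator *)

Section WillmoreOperator.
Context {R : realType} {m : nat}.
Variables (U : set (R * R)) (f : R * R -> 'rV[R]_m).
Hypothesis oU : open U.
Hypothesis sf : smooth_on U f.
Hypothesis D0 : forall u, U u -> 0 < gram (pd 0 f u) (pd 1 f u).
Local Notation H := (mean_curv f).

Lemma koszul i j l u : U u -> dgij f i j l u + dgij f j i l u - dgij f l i j u =
  2 * dot (pd i (pd j f) u) (pd l f u).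
Proof.
move=> Uu; have S1 := pd_sym_row j i oU (sf 2) Uu.
have S2 := pd_sym_row l i oU (sf 2) Uu; have S3 := pd_sym_row l j oU (sf 2) Uu.
rewrite /dgij; move: S1 S2 S3.
generalize (pd j (pd i f) u) as fji; generalize (pd l (pd i f) u) as fli.
generalize (pd l (pd j f) u) as flj; generalize (pd i (pd j f) u) as fij.
generalize (pd i (pd l f) u) as fil; generalize (pd j (pd l f) u) as fjl.
generalize (pd i f u) as ai; generalize (pd j f u) as aj; generalize (pd l f u) as al.
move=> al aj ai fjl fil fij flj fli fji -> -> ->.
by rewrite (dotC aj) (dotC ai fjl); gendot; ring.
Qed.

Lemma invmx_metric u : U u -> invmx (metric f u) = (gramf f u)^-1 *:
  \matrix_(i, j) (if i == 0 then if j == 0 then gij f 1 1 u else - gij f 0 1 u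
                  else if j == 0 then - gij f 0 1 u else gij f 0 0 u).
Proof.
move=> Uu; set N := RHS.
have detE : \det (metric f u) = gramf f u by exact: det_metric.
have M1 : metric f u *m N = 1%:M.
  have := gram_neq0 (D0 Uu); rewrite /N /gramf (metricE erefl erefl) /gij; genpd => D1.
  apply/matrixP => i j; rewrite !mxE sum2 !mxE.
  move: D1; case: (ord2P i) => ->; case: (ord2P j) => -> /=;
    rewrite ?(dotC s0 s) /gram; gendot => D1; by field.
have un : metric f u \in unitmx by rewrite unitmxE detE unitfE (gram_neq0 (D0 Uu)).
by rewrite -[N]mul1mx -(mulVmx un) -mulmxA M1 mulmx1.
Qed.

(** For an induced metric the Christoffel symbols are the coordinates of the
    tangential part of the second derivatives of f. *)
Lemma christoffelE k i j u : U u -> christoffel f u k i j =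
  (if k == 0 then gij f 1 1 u * dot (pd i (pd j f) u) (pd 0 f u)
                  - gij f 0 1 u * dot (pd i (pd j f) u) (pd 1 f u)
   else gij f 0 0 u * dot (pd i (pd j f) u) (pd 1 f u)
        - gij f 0 1 u * dot (pd i (pd j f) u) (pd 0 f u)) / gramf f u.
Proof.
move=> Uu.
have pm k' i' j' : pd k' (fun v => metric f v i' j') u = dgij f k' i' j' u.
  have -> : (fun v => metric f v i' j') = gij f i' j'.
    by apply/funext => v; rewrite mxE.
  by have [] := derive_metric sf k' i' j' Uu.
have E l : pd i (fun v => metric f v j l) u + pd j (fun v => metric f v i l) u
     - pd l (fun v => metric f v i j) u = 2 * dot (pd i (pd j f) u) (pd l f u).
  rewrite -(koszul i j l Uu).
  move: (pm i j l) (pm j i l) (pm l i j).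
  generalize (dgij f i j l u) (dgij f j i l u) (dgij f l i j u); genpd.
  by move=> ? ? ? -> -> ->.
have -> : christoffel f u k i j = 2^-1 * \sum_l invmx (metric f u) k l *
    (2 * dot (pd i (pd j f) u) (pd l f u)).
  by congr (_ * _); apply: eq_bigr => l _; congr (_ * _); exact: E.
rewrite (invmx_metric Uu) sum2 !mxE.
have := gram_neq0 (D0 Uu); rewrite /gramf /gij.
case: (ord2P k) => -> /=; generalize (pd i (pd j f) u) as x;
generalize (pd 0 f u) as a; generalize (pd 1 f u) as b => b a x;
generalize (gram a b); gendot => y y0; by field.
Qed.

End WillmoreOperator.

Lemma dot_suml (R : realType) m (I : finType) (F : I -> 'rV[R]_m) w :
  dot (\sum_i F i) w = \sum_i dot (F i) w.
Proof.
apply: (big_morph (fun v => dot v w)); [move=> x y; exact: dotDl | exact: dot0l].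
Qed.

Section WillmoreOperator.
Context {R : realType} {m : nat}.
Variables (U : set (R * R)) (f : R * R -> 'rV[R]_m).
Hypothesis oU : open U.
Hypothesis sf : smooth_on U f.
Hypothesis D0 : forall u, U u -> 0 < gram (pd 0 f u) (pd 1 f u).
Local Notation H := (mean_curv f).

Definition willmore_op u : 'rV[R]_m :=
  laplacian_perp f H u - (2 * dot (H u) (H u)) *: H u + Atilde f u (H u).

Lemma smooth_ncov j : smooth_on U (ncov f j H).
Proof.
have h : smooth_on U (fun v => perp (pd 0 f v) (pd 1 f v) (pd j H v)).
  by apply: smooth_perp => //; apply: smooth_on_pd; exact: smooth_mean_curv.
by apply: (eq_smooth_on oU _ h) => v Uv; rewrite /ncov (nprojE erefl erefl (D0 Uv)).
Qed.

(** The coefficients tcoef0 and tcoef1 are the coordinates of tpart in the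
    basis f_0, f_1. *)
Definition tcoef0 j v := (gij f 1 1 v * hcoef f 0 j v - gij f 0 1 v * hcoef f 1 j v) / gramf f v.
Definition tcoef1 j v := (gij f 0 0 v * hcoef f 1 j v - gij f 0 1 v * hcoef f 0 j v) / gramf f v.

(** The normal part of the derivative of V_j: derivatives of tangential
    coefficients multiply tangent vectors and drop out. *)
Lemma derive_flux_normal i j u w : U u ->
  dot w (pd 0 f u) = 0 -> dot w (pd 1 f u) = 0 ->
  dot (pd i (fun v => flux f v j) u) w = dot (pd i (ncov f j H) u) w
  + (tcoef0 j u * dot (pd i (pd 0 f) u) w + tcoef1 j u * dot (pd i (pd 1 f) u) w)
  - dot (H u) (H u) * dot (pd i (pd j f) u) w.
Proof.
move=> Uu w0 w1.
have hD : smooth_on U (gramf f) := smooth_gram oU sf.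
have hDV : smooth_on U (fun v => (gramf f v)^-1).
  by apply: smooth_onV => // v Uv; exact: gram_neq0 (D0 Uv).
have sg i' j' : smooth_on U (gij f i' j') by apply: smooth_on_dot => //; exact: smooth_on_pd.
have sh i' j' := smooth_hcoef oU sf D0 i' j'.
have sc0 : smooth_on U (tcoef0 j) := smooth_onM oU (smooth_onD oU
  (smooth_onM oU (sg 1 1) (sh 0 j)) (smooth_onN oU (smooth_onM oU (sg 0 1) (sh 1 j)))) hDV.
have sc1 : smooth_on U (tcoef1 j) := smooth_onM oU (smooth_onD oU
  (smooth_onM oU (sg 0 0) (sh 1 j)) (smooth_onN oU (smooth_onM oU (sg 0 1) (sh 0 j)))) hDV.
have d0 := smooth_on_derive i (smooth_on_pd 0 sf) Uu.
have d1 := smooth_on_derive i (smooth_on_pd 1 sf) Uu.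
have dj := smooth_on_derive i (smooth_on_pd j sf) Uu.
have dq := smooth_on_derive i (smooth_ncov j) Uu.
have dt := is_derive_funD (is_derive_scale (smooth_on_derive i sc0 Uu) d0)
  (is_derive_scale (smooth_on_derive i sc1 Uu) d1).
have dn := is_derive_scale (derive_dotH oU sf D0 i Uu) dj.
have d := is_derive_funB (is_derive_funD dq dt) dn.
have eqf v : U v -> ncov f j H v + (tcoef0 j v *: pd 0 f v + tcoef1 j v *: pd 1 f v)
    - dot (H v) (H v) *: pd j f v = flux f v j.
  by move=> Uv; rewrite /flux /ncov (nprojE erefl erefl (D0 Uv)).
have [_ e] := eq_is_derive oU eqf Uu d.
have {}e := congr1 (dot^~ w) e; rewrite /= -/(pd i (fun v => flux f v j) u) in e.
apply: (etrans e).
have w0' := etrans (dotC _ _) w0; have w1' := etrans (dotC _ _) w1.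
have wj : dot (pd j f u) w = 0 by case: (ord2P j) => ->.
move: w0' w1' wj.
generalize (tcoef0 j u) (tcoef1 j u) (pd i (tcoef0 j) u) (pd i (tcoef1 j) u).
generalize (pd i (ncov f j H) u) (H u); genpd => x1 x2 x3 x4 x5 x6 w0' w1' wj.
by rewrite !dotE w0' w1' wj !mulr0 !add0r.
Qed.

Lemma dot_nproj_normal u v w : U u ->
  dot w (pd 0 f u) = 0 -> dot w (pd 1 f u) = 0 -> dot (nproj f u v) w = dot v w.
Proof. by move=> Uu w0 w1; rewrite (nprojE erefl erefl (D0 Uu)) perp_normal. Qed.

Lemma dot_nproj_tangent u v k : U u -> dot (nproj f u v) (pd k f u) = 0.
Proof.
move=> Uu; rewrite (nprojE erefl erefl (D0 Uu)).
case: (ord2P k) => ->; [exact: perp_dotl (D0 Uu) _|exact: perp_dotr (D0 Uu) _].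
Qed.

Lemma willmore_op_tangent u k : U u -> dot (willmore_op u) (pd k f u) = 0.
Proof.
move=> Uu; have P v := dot_nproj_tangent v k Uu.
have L i j : dot (ncov2 f H u i j) (pd k f u) = 0.
  rewrite /ncov2 dotDl dotNl dot_suml P big1 ?subr0 // => l _.
  by rewrite dotZl P mulr0.
have A (T : 'I_2 -> 'I_2 -> 'rV[R]_m) i j :
    (forall c d, dot (T c d) (pd k f u) = 0) ->
    dot (on_frame2 f u T i j) (pd k f u) = 0.
  move=> h; rewrite /on_frame2 dot_suml big1 // => c _.
  by rewrite dot_suml big1 // => d _; rewrite dotZl h mulr0.
rewrite /willmore_op !dotDl dotNl dotZl (dot_mean_curv D0 k Uu) mulr0 subr0.
rewrite /laplacian_perp /Atilde !dot_suml !big1 ?addr0 // => i _.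
  rewrite dot_suml big1 // => j _; rewrite dotZl A ?mulr0 // => c d; exact: P.
by rewrite A.
Qed.

Lemma dot_laplacian_perp u w : U u ->
  dot w (pd 0 f u) = 0 -> dot w (pd 1 f u) = 0 ->
  let L i j := dot (pd i (ncov f j H) u) w
    - (christoffel f u 0 i j * dot (pd 0 H u) w + christoffel f u 1 i j * dot (pd 1 H u) w) in
  dot (laplacian_perp f H u) w = (gramf f u)^-1 *
    (gij f 1 1 u * L 0 0 - gij f 0 1 u * (L 0 1 + L 1 0) + gij f 0 0 u * L 1 1).
Proof.
move=> Uu w0 w1 L; rewrite /laplacian_perp (trace_frame erefl erefl (D0 Uu)).
have LE i j : dot (ncov2 f H u i j) w = L i j.
  rewrite /ncov2 dotDl dotNl dot_suml sum2.
  have e v := dot_nproj_normal v Uu w0 w1.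
  have e1 : dot (ncov f i (ncov f j H) u) w = dot (pd i (ncov f j H) u) w := e _.
  have e2 : dot (ncov f 0 H u) w = dot (pd 0 H u) w := e _.
  have e3 : dot (ncov f 1 H u) w = dot (pd 1 H u) w := e _.
  rewrite /L; move: e1 e2 e3.
  generalize (christoffel f u 0 i j) (christoffel f u 1 i j) (ncov f 0 H u).
  generalize (ncov f 1 H u) (ncov f i (ncov f j H) u); genpd.
  by move=> ? ? ? ? ? <- <- <-; rewrite !dotZl.
move: (LE 0 0) (LE 0 1) (LE 1 0) (LE 1 1).
generalize (ncov2 f H u 0 0) (ncov2 f H u 0 1) (ncov2 f H u 1 0) (ncov2 f H u 1 1).
by move=> x00 x01 x10 x11 <- <- <- <-; rewrite !dotE.
Qed.

Lemma dot_Atilde u w : U u ->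
  dot w (pd 0 f u) = 0 -> dot w (pd 1 f u) = 0 ->
  let b i j := dot (pd i (pd j f) u) w in
  let E := gij f 0 0 u in let F := gij f 0 1 u in let G := gij f 1 1 u in
  dot (Atilde f u (H u)) w =
    (hcoef f 0 0 u * (G ^+ 2 * b 0 0 - 2 * G * F * b 0 1 + F ^+ 2 * b 1 1)
       + 2 * hcoef f 0 1 u * (- G * F * b 0 0 + (G * E + F ^+ 2) * b 0 1 - F * E * b 1 1)
       + hcoef f 1 1 u * (F ^+ 2 * b 0 0 - 2 * F * E * b 0 1 + E ^+ 2 * b 1 1))
    / gramf f u ^+ 2.
Proof.
move=> Uu w0 w1 b E F G; rewrite /Atilde.
have n0 := dot_mean_curv D0 0 Uu; have n1 := dot_mean_curv D0 1 Uu.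
have sym : second_ff f u 1 0 = second_ff f u 0 1.
  by rewrite /second_ff (pd_sym_row 1 0 oU (sf 2) Uu).
have BH i j : dot (second_ff f u i j) (H u) = hcoef f i j u.
  by rewrite (dot_nproj_normal _ Uu n0 n1) dotC.
have Bw i j : dot (second_ff f u i j) w = b i j by rewrite (dot_nproj_normal _ Uu w0 w1).
have e := trace2_frame erefl erefl (D0 Uu) (H u) w sym.
rewrite dot_suml -[LHS]/(\sum_i _); transitivity (\sum_i \sum_j
  dot (on_frame2 f u (second_ff f u) i j) (H u) * dot (on_frame2 f u (second_ff f u) i j) w).
  apply: eq_bigr => i _; rewrite dot_suml; apply: eq_bigr => j _; exact: dotZl.
apply: (etrans e); rewrite /E /F /G /gij /gramf.
move: (BH 0 0) (BH 0 1) (BH 1 1) (Bw 0 0) (Bw 0 1) (Bw 1 1).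
generalize (second_ff f u 0 0) (second_ff f u 0 1) (second_ff f u 1 1).
generalize (hcoef f 0 0 u) (hcoef f 0 1 u) (hcoef f 1 1 u) (b 0 0) (b 0 1) (b 1 1).
by genpd => ? ? ? ? ? ? ? ? ? -> -> -> -> -> ->.
Qed.

Lemma flux_normal u w : U u ->
  dot w (pd 0 f u) = 0 -> dot w (pd 1 f u) = 0 ->
  dot (extd (hodge f (flux f)) u) w = area_density f u * dot (willmore_op u) w.
Proof.
move=> Uu w0 w1.
rewrite (extd_hodge oU sf D0 Uu (smooth_flux oU sf D0)).
have S := pd_sym_row 1 0 oU (sf 2) Uu.
have LP := dot_laplacian_perp Uu w0 w1; have AT := dot_Atilde Uu w0 w1.
have HT := mean_curv_trace oU sf D0 Uu w0 w1.
have F0 := dot_fluxE oU sf D0 w 0 Uu; have F1 := dot_fluxE oU sf D0 w 1 Uu.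
have X00 := derive_flux_normal 0 0 Uu w0 w1. have X01 := derive_flux_normal 0 1 Uu w0 w1.
have X10 := derive_flux_normal 1 0 Uu w0 w1. have X11 := derive_flux_normal 1 1 Uu w0 w1.
have h10 := hcoefC oU sf 1 0 Uu.
have c i j k := christoffelE oU sf D0 k i j Uu.
rewrite /willmore_op !dotDl dotNl dotZl LP AT !c /= {LP AT c}.
have Epos := dot_gt0_gram (D0 Uu).
have sE := sqr_sqrt_gram (D0 Uu).
have s0 := sqrt_gram_neq0 (D0 Uu).
move: h10 S w0 w1 HT F0 F1 X00 X01 X10 X11 Epos sE s0.
rewrite /tcoef0 /tcoef1.
move: (hcoef f 0 0 u) (hcoef f 0 1 u) (hcoef f 1 0 u) (hcoef f 1 1 u) => h00 h01 h10 h11.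
abstract_jet f u.
generalize (pd 0 (ncov f 0 H) u) as q00; generalize (pd 0 (ncov f 1 H) u) as q01.
generalize (pd 1 (ncov f 0 H) u) as q10; generalize (pd 1 (ncov f 1 H) u) as q11.
move=> q11 q10 q01 q00 e10 S w0 w1 HT F0 F1 X00 X01 X10 X11 Epos sE s0.
subst f10 h10; clear U oU sf D0 Uu.
have E0 : dot a a != 0 by rewrite gt_eqF.
have GE : dot b b = (Num.sqrt (gram a b) ^+ 2 + dot a b ^+ 2) / dot a a.
  by rewrite sE /gram; move: E0; gendot => E0; field.
move: (Num.sqrt (gram a b)) sE s0 GE => s sE s0 GE.
rewrite -sE in HT F0 F1 X00 X01 X10 X11 *; clear sE.
rewrite (dotC a w) (dotC b w) w0 w1 !mulr0 addr0 mul0r mulr0 addr0 subr0 in F0.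
rewrite (dotC a w) (dotC b w) w0 w1 !mulr0 addr0 mul0r mulr0 addr0 subr0 in F1.
have id := normal_identity (dot f00 a) (dot f01 a) (dot f11 a) (dot f00 b)
  (dot f01 b) (dot f11 b) h00 h01 h11 (dot q00 w) (dot q01 w) (dot q10 w)
  (dot q11 w) (dot h0 w) (dot h1 w) (dot h h) E0 s0 GE HT.
apply: eq_from_sub id _; rewrite !dotE F0 F1 X00 X01 X10 X11.
rewrite (dotC a f00) (dotC a f01) (dotC a f11) (dotC b f01) (dotC b f11).
by move: s0; clear; gendot => s0; field.
Qed.

(** Both sides have the same pairings with f_0 and f_1, namely 0, and with
    every normal vector. *)
Theorem extd_hodge_flux_willmore u : U u ->
  extd (hodge f (flux f)) u = area_density f u *: willmore_op u.
Proof.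
move=> Uu; apply/eqP; rewrite -subr_eq0; apply/eqP.
have T k : dot (extd (hodge f (flux f)) u) (pd k f u) = 0.
  exact: (flux_tangential oU sf D0 k Uu).
have W k := willmore_op_tangent k Uu.
have T' k : dot (extd (hodge f (flux f)) u - area_density f u *: willmore_op u) (pd k f u) = 0.
  move: (T k) (W k); generalize (extd (hodge f (flux f)) u) (willmore_op u).
  by genpd => x y hx hy; rewrite !dotE hx hy mulr0 subr0.
apply: (plane_eq0 (T' 0) (T' 1)) => w w0 w1.
have := flux_normal Uu w0 w1.
generalize (extd (hodge f (flux f)) u) (willmore_op u) => x y e.
by rewrite !dotE e subrr.
Qed.

End WillmoreOperator.

(** * Exterior products of an orthonormal frame *)

Section Wedge.
Context {R : realType} {m : nat}.
Implicit Types (v : 'rV[R]_m) (x : multivector R m) (U : {set 'I_m}).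
Local Open Scope nat_scope.

Lemma inversions1 (i : 'I_m) U : i \in U ->
  inversions [set i]%SET (U :\ i)%SET = #|[set l in U | l < i]%SET|.
Proof.
move=> iU; rewrite /inversions.
rewrite -(card_imset (f := pair i)) => [|l l' [] //].
apply: eq_card => -[k l]; apply/idP/imsetP.
  move=> /set_mem /=; rewrite !inE => /and3P[/eqP -> /andP[li lU] lti].
  by exists l => //; rewrite inE lU.
move=> [l']; rewrite inE => /andP[l'U lti] [-> ->]; apply/mem_set.
rewrite /= !inE eqxx l'U lti !andbT /=; apply: contraTneq lti => ->.
by rewrite ltnn.
Qed.

(** Only singletons contribute to a product with a vector; the sign counts the
    elements that the new index has to pass. *)
Lemma wedge_mv_of v x U :
  (wedge (mv_of v) x U = \sum_(i in U)
    (-1) ^+ #|[set l in U | (l < i)%N]%SET| * v 0 i * x (U :\ i)%SET)%R.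
Proof.
rewrite ffunE /mv_of.
transitivity (\sum_(S : {set 'I_m} | S \subset U) \sum_(i in U)
   (if S == [set i]%SET then (-1) ^+ inversions S (U :\: S)%SET * v 0 i * x (U :\: S)%SET
    else 0))%R.
  apply: eq_bigr => S SU; rewrite ffunE.
  rewrite mulr_sumr mulr_suml (bigID (mem U)) /= [X in (_ + X)%R]big1 ?addr0.
    apply: eq_bigr => i iU; case: eqP => _; by rewrite ?mulr1 ?mulr0 ?mul0r.
  move=> i iU; case: eqP => [E|_]; last by rewrite !mulr0 mul0r.
  by move: SU; rewrite E finset.sub1set (negbTE iU).
rewrite exchange_big /=; apply: eq_bigr => i iU.
rewrite (bigD1 [set i]%SET) ?finset.sub1set //= eqxx big1 ?addr0 ?inversions1 //.
by move=> S /andP[_ /negbTE ->].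
Qed.

(** The products of k vectors, with the vectors indexed by nat so that the
    induction on k may shift the family. *)
Fixpoint nested_wedge (k : nat) (A : nat -> 'rV[R]_m) : multivector R m :=
  if k is k'.+1 then wedge (mv_of (A 0)) (nested_wedge k' (A \o S)) else mv1.

Lemma sorted_enum U : sorted ltn (map val (enum U)).
Proof.
rewrite -[enum _](eq_filter (mem_enum _)).
rewrite -(eq_filter (mem_map val_inj _)) -filter_map.
by rewrite (sorted_filter ltn_trans) // unlock val_ord_enum iota_ltn_sorted.
Qed.

Lemma card_lt_nth_enum (x0 : 'I_m) U (j : nat) : j < #|U| ->
  #|[set l in U | l < nth x0 (enum U) j]%SET| = j.
Proof.
move=> jU; have szU : size (enum U) = #|U| by rewrite -cardE.
have := @count_lt_nth _ _ (val x0) (map val (enum U)) j.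
rewrite size_map szU => /(_ (sorted_enum U) jU) e; rewrite -[RHS]e.
rewrite (nth_map x0) ?szU // count_map cardE -size_filter; congr size.
rewrite /enum_mem -filter_predI; apply: eq_filter => l; rewrite !inE /= andbC.
by rewrite ltEnat.
Qed.

Lemma enumD1 (x0 : 'I_m) U (j : nat) : j < #|U| ->
  enum (U :\ nth x0 (enum U) j)%SET = take j (enum U) ++ drop j.+1 (enum U).
Proof.
move=> jU; have szU : size (enum U) = #|U| by rewrite -cardE.
set i := nth _ _ _.
have -> : enum (U :\ i)%SET = rem i (enum U).
  rewrite rem_filter ?enum_uniq // /enum_mem -filter_predI.
  by apply: eq_filter => l; rewrite !inE.
by rewrite remE index_uniq ?szU // enum_uniq.
Qed.

(** The coefficient of a product of k vectors at a set of k indices is a minor.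
    The recursion that defines the product is the Laplace expansion along the first
    row: the sign of wedge_mv_of is the rank of the index in the set. *)
Lemma nested_wedge_det (x0 : 'I_m) k A U : #|U| = k ->
  (nested_wedge k A U = \det (\matrix_(i < k, j < k) A i 0 (nth x0 (enum U) j)))%R.
Proof.
elim: k A U => [|k IH] A U cU.
  rewrite det_mx00 /mv1 ffunE; move/eqP: cU; rewrite cards_eq0 => /eqP ->.
  by rewrite eqxx.
rewrite /= wedge_mv_of (expand_det_row _ ord0).
have szU : size (enum U) = k.+1 by rewrite -cardE.
rewrite -big_enum /= (big_nth x0) szU big_mkord; apply: eq_bigr => j _.
have jU : j < #|U| by rewrite cU.
rewrite card_lt_nth_enum // IH; last first.
  have iU : nth x0 (enum U) j \in U by rewrite -mem_enum mem_nth // szU.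
  by move: cU; rewrite (cardsD1 (nth x0 (enum U) j)) iU => -[].
rewrite !mxE /cofactor add0n [RHS]mulrA [X in (_ = X * _)%R]mulrC; congr (_ * \det _)%R.
apply/matrixP => r l; rewrite !mxE enumD1 //=; congr (A _ 0 _)%R.
rewrite nth_cat size_take szU ltn_ord /= /bump.
case: ltnP => lj; rewrite ?add0n ?add1n ?nth_take ?nth_drop //.
by rewrite addSn subnKC.
Qed.

Lemma nested_wedge_top (M : 'M[R]_m) (A : nat -> 'rV[R]_m) : 0 < m ->
  (forall i : 'I_m, A i = row i M) ->
  (nested_wedge m A [set: 'I_m]%SET = \det M)%R.
Proof.
move=> m0 AM.
rewrite (nested_wedge_det (Ordinal m0)) ?cardsT ?card_ord //.
congr (\det _)%R; apply/matrixP => i j; rewrite !mxE AM mxE; congr (M i _).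
by rewrite enum_setT -enumT nth_ord_enum.
Qed.

Lemma nested_wedge_big k (A : nat -> 'rV[R]_m) :
  \big[wedge/mv1]_(0 <= i < k) mv_of (A i) = nested_wedge k A.
Proof.
elim: k A => [|k IH] A; first by rewrite big_geq.
rewrite big_ltn // big_add1 /=; congr wedge; exact: IH.
Qed.

End Wedge.

Section Tail.
Context {R : realType} {m : nat}.
Lemma big_nested_wedge_tail (P : 'M[R]_m.+2) :
  \big[wedge/mv1]_(i < m.+2 | (2 <= i)%N) mv_of (row i P) =
  nested_wedge m (fun i => row (inord i.+2) P).
Proof.
rewrite -nested_wedge_big.
rewrite (eq_bigr (fun i : 'I_m.+2 => mv_of (row (inord i) P))); last first.
  by move=> i _; rewrite inord_val.
rewrite -(big_mkord (fun i => 2 <= i)%N (fun i => mv_of (row (inord i) P))).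
rewrite /index_iota !subn0 /= !big_cons /= big_seq_cond.
rewrite (eq_bigl (fun i => i \in iota 2 m)); last first.
  by move=> i; rewrite mem_iota; case: (2 <= i)%N => //=; rewrite andbT.
by rewrite -big_seq (iotaDl 2 0) big_map.
Qed.
End Tail.

Section TopCoefficient.
Context {R : realType} {m : nat}.
Variable P : 'M[R]_m.+2.
Hypothesis PP : P *m P^T = 1%:M.
Hypothesis Ppos : 0 < \det P.
Let eta := \big[wedge/mv1]_(i < m.+2 | (2 <= i)%N) mv_of (row i P).

Lemma det_orthonormal : \det P = 1.
Proof.
have : \det P ^+ 2 = 1 by rewrite expr2 -{2}det_tr -det_mulmx PP det1.
by move=> /eqP; rewrite sqrp_eq1 ?ltW // => /eqP.
Qed.

Let A (a b : 'rV[R]_m.+2) (i : nat) : 'rV[R]_m.+2 :=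
  if i is i'.+1 then if i' is i''.+1 then row (inord i) P else b else a.

Lemma wedge_wedge_nested a b :
  wedge (mv_of a) (wedge (mv_of b) eta) = nested_wedge m.+2 (A a b).
Proof.
by rewrite /eta big_nested_wedge_tail.
Qed.

(** Let M have rows a, b and the last rows of P. The right-hand side is the
    determinant of the matrix of products of the rows of M and P: multiplying M by
    the transpose of P, whose determinant is 1, gives a block triangular matrix
    with an identity block. *)
Lemma wedge_wedge_top a b :
  wedge (mv_of a) (wedge (mv_of b) eta) [set: 'I_m.+2]%SET =
  dot a (row 0 P) * dot b (row 1 P) - dot a (row 1 P) * dot b (row 0 P).
Proof.
pose M := \matrix_(i < m.+2) A a b i.
rewrite wedge_wedge_nested (nested_wedge_top (M := M)) //; last first.
  by move=> i; rewrite rowK.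
have -> : \det M = \det (M *m P^T) by rewrite det_mulmx det_tr det_orthonormal mulr1.
have row_dot i j : (M *m P^T) i j = dot (A a b i) (row j P).
  by rewrite !mxE; apply: eq_bigr => k _; rewrite !mxE.
(* Orthonormality makes the lower rows of the product of M with the transpose of
   P those of the identity. *)
have PPE i j : dot (row i P) (row j P) = (i == j)%:R.
  have := congr1 (fun N : 'M[R]_(m.+2) => N i j) PP; rewrite !mxE => <-.
  by apply: eq_bigr => k _; rewrite !mxE.
move: (M *m P^T) row_dot => N rdN.
have [K KN] : exists K : 'M[R]_(2 + m), K = N by exists N.
have KE : K = block_mx (ulsubmx K) (ursubmx K) 0 1%:M.
  rewrite -[LHS]submxK; congr block_mx; apply/matrixP => i j; rewrite !mxE.
    rewrite KN rdN /= PPE; case: eqP => // /(congr1 val) /=.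
    rewrite inordK; first by case: j => -[|[|]].
    by case: i.
  rewrite KN rdN /= PPE -!val_eqE /= inordK; last by case: i.
  by [].
have dK : \det K = \det (ulsubmx K).
  by rewrite [X in \det X = _]KE det_ublock det1 mulr1.
have -> : \det N = \det (ulsubmx K) by rewrite -KN; exact: dK.
rewrite (expand_det_row _ 0) sum2 /cofactor !det_mx11 !mxE /=.
have e (i j : 'I_2) (p q : 'I_m.+2) : p = i :> nat -> q = j :> nat ->
    K (lshift m i) (lshift m j) = dot (A a b i) (row q P).
  by move=> pi qj; rewrite KN rdN; congr (dot _ (row _ P)); exact: val_inj.
rewrite !lift01 !lift10 (e 0 0 0 0) // (e 1 1 1 1) // (e 0 1 0 1) // (e 1 0 1 0) //=.
by rewrite expr0 expr1; gendot; ring.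
Qed.

End TopCoefficient.

(** * Differential of the Gauss map *)

Section GaussMap.
Context {R : realType} {m : nat}.
Implicit Types (f : R * R -> 'rV[R]_m.+2) (u : R * R).

Lemma nested_wedge_degree k (A : nat -> 'rV[R]_m.+2) (S : {set 'I_m.+2}) :
  #|S| != k -> nested_wedge k A S = 0.
Proof.
elim: k A S => [|k IH] A S cS.
  by rewrite /= /mv1 ffunE; move: cS; rewrite finset.cards_eq0 => /negbTE ->.
rewrite /= wedge_mv_of big1 // => i iS; rewrite IH ?mulr0 //.
by move: cS; rewrite (finset.cardsD1 i) iS add1n eqSS.
Qed.

Lemma wedge_delta (p : 'I_m.+2) (S : {set 'I_m.+2}) : p \in S ->
  exists c : nat, forall x : multivector R m.+2,
    wedge (mv_of (delta_mx 0 p)) x S = (-1) ^+ c * x (S :\ p)%SET.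
Proof.
move=> pS; exists #|[set l in S | (l < p)%N]%SET| => x.
rewrite wedge_mv_of (bigD1 p) //= big1 ?addr0; first by rewrite mxE !eqxx mulr1.
by move=> i /andP[_ /negbTE ip]; rewrite mxE ip andbF mulr0 mul0r.
Qed.

(** The only property of the Gauss map that is used: its products with two
    vectors are explicit functions of the tangent plane. *)
Lemma gauss_wedge f u eta v w : 0 < gram (pd 0 f u) (pd 1 f u) ->
  gauss_at f u eta ->
  wedge (mv_of v) (wedge (mv_of w) eta) [set: 'I_m.+2]%SET =
  (dot v (pd 0 f u) * dot w (pd 1 f u) - dot v (pd 1 f u) * dot w (pd 0 f u))
  / Num.sqrt (gram (pd 0 f u) (pd 1 f u)).
Proof.
move=> D0 [P [PP Ppos Prow ->]].
rewrite (wedge_wedge_top PP Ppos) (Prow 0 0) // (Prow 1 1) //.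
rewrite (tframe0E erefl erefl) (tframe1E erefl erefl).
have q0 : Num.sqrt (dot (pd 0 f u) (pd 0 f u)) != 0.
  by rewrite gt_eqF // sqrtr_gt0 (dot_gt0_gram D0).
have qE := sqr_sqrtr (ltW (dot_gt0_gram D0)).
have s0 := sqrt_gram_neq0 D0.
move: qE q0 s0; generalize (pd 0 f u) as a; generalize (pd 1 f u) as b => b a qE q0 x0.
rewrite !dotE.
move: (Num.sqrt (gram a b)) (Num.sqrt (dot a a)) qE q0 x0 => x q <-.
by gendot => q0 x0; field; rewrite q0 x0.
Qed.

Section On.
Variables (U : set (R * R)) (f : R * R -> 'rV[R]_m.+2).
Variable (n : R * R -> multivector R m.+2).
Hypothesis oU : open U.
Hypothesis sf : smooth_on U f.
Hypothesis D0 : forall u, U u -> 0 < gram (pd 0 f u) (pd 1 f u).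
Hypothesis gn : forall u, U u -> gauss_at f u (n u).

(** A coefficient at a set that does not have m elements vanishes identically.
    Otherwise two indices p, r are missing, and multiplication by the corresponding
    basis vectors turns the coefficient, up to sign, into a top coefficient, which
    gauss_wedge gives in terms of f_0 and f_1. *)
Lemma gauss_map_smooth (S : {set 'I_m.+2}) : smooth_on U (fun v => n v S).
Proof.
have [cS|cS] := boolP (#|S| == m); last first.
  apply: (eq_smooth_on oU (f := fun=> 0)); last exact: smooth_on_cst.
  move=> v Uv; have [P [_ _ _ ->]] := gn Uv.
  rewrite big_nested_wedge_tail nested_wedge_degree //.
have [p pS] : exists p, p \notin S.
  apply/existsP; rewrite -negb_forall; apply/negP => /forallP h.
  have : #|S| = m.+2.
    rewrite -[RHS]card_ord; apply: eq_card => i; exact: h.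
  by rewrite (eqP cS); lia.
have [r [rp rS]] : exists r, r != p /\ r \notin S.
  have : #|~: (p |: S)%SET|%SET = 1%N.
    by rewrite finset.cardsCs finset.setCK finset.cardsU1 pS (eqP cS) card_ord; lia.
  move=> /eqP /finset.cards1P [r E]; exists r.
  by have := finset.in_set1 r r; rewrite -E !inE eqxx negb_or => /andP.
pose x v := (dot (delta_mx 0 p) (pd 0 f v) * dot (delta_mx 0 r) (pd 1 f v)
  - dot (delta_mx 0 p) (pd 1 f v) * dot (delta_mx 0 r) (pd 0 f v))
  / Num.sqrt (gram (pd 0 f v) (pd 1 f v)).
have sx : smooth_on U x.
  have c (k : 'I_m.+2) : smooth_on U (fun=> delta_mx 0 k : 'rV[R]_m.+2) by exact: smooth_on_cst.
  have s0 := smooth_on_pd 0 sf; have s1 := smooth_on_pd 1 sf.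
  have sV : smooth_on U (fun v => (Num.sqrt (gram (pd 0 f v) (pd 1 f v)))^-1).
    apply: smooth_onV => //; first by move=> v Uv; exact: sqrt_gram_neq0 (D0 Uv).
    by apply: smooth_on_sqrt => //; exact: smooth_gram.
  have sA := smooth_onM oU (smooth_on_dot oU (c p) s0) (smooth_on_dot oU (c r) s1).
  have sB := smooth_onM oU (smooth_on_dot oU (c p) s1) (smooth_on_dot oU (c r) s0).
  have sAB := smooth_onM oU (smooth_onD oU sA (smooth_onN oU sB)) sV.
  exact sAB.
have SE : ([set: 'I_m.+2] :\ p :\ r)%SET = S.
  apply/eqP; rewrite eq_sym finset.eqEcard; apply/andP; split.
    apply/fintype.subsetP => i iS; rewrite !inE !andbT.
    by apply/andP; split; apply/eqP => ir; move: iS; rewrite ir ?(negbTE pS) ?(negbTE rS).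
  rewrite (eqP cS).
  have := finset.cardsD1 r ([set: 'I_m.+2] :\ p)%SET; rewrite !inE rp /=.
  have := finset.cardsD1 p [set: 'I_m.+2]%SET; rewrite !inE finset.cardsT card_ord /=.
  by lia.
have rin : r \in ([set: 'I_m.+2] :\ p)%SET by rewrite !inE rp.
have pin : p \in [set: 'I_m.+2]%SET by rewrite inE.
have [c1 E1] : exists c1 : nat, forall y : multivector R m.+2,
    wedge (mv_of (delta_mx 0 p)) y [set: 'I_m.+2]%SET = (-1) ^+ c1 * y ([set: 'I_m.+2] :\ p)%SET.
  exact: wedge_delta.
have [c2 E2] : exists c2 : nat, forall y : multivector R m.+2,
    wedge (mv_of (delta_mx 0 r)) y ([set: 'I_m.+2] :\ p)%SET = (-1) ^+ c2 * y S.
  by rewrite -SE; exact: wedge_delta.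
apply: (eq_smooth_on oU (f := fun v => ((-1) ^+ c1 * (-1) ^+ c2) * x v)); last first.
  by apply: smooth_onM => //; exact: smooth_on_cst.
move=> v Uv; rewrite /x -(gauss_wedge _ _ (D0 Uv) (gn Uv)) E1 E2.
by rewrite mulrACA -expr2 sqrr_sign mul1r mulrA -expr2 sqrr_sign mul1r.
Qed.

Lemma derive_wedge (x : multivector R m.+2) (y : R * R -> multivector R m.+2)
   (dy : multivector R m.+2) u e (W : {set 'I_m.+2}) :
  (forall S, is_derive u e (fun v => y v S) (dy S)) ->
  is_derive u e (fun v => wedge x (y v) W) (wedge x dy W).
Proof.
move=> h; rewrite ffunE.
rewrite (_ : (fun v => _) = fun v => \sum_(S : {set 'I_m.+2})
  (if S \subset W then (-1) ^+ inversions S (W :\: S) * x S else 0) * y v (W :\: S)%SET).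
  rewrite big_mkcond /=; apply: is_derive_funsum => S.
  have d := is_derive_funM (is_derive_funcst
    (if S \subset W then (-1) ^+ inversions S (W :\: S)%SET * x S else 0) u e)
    (h (W :\: S)%SET).
  by apply: is_derive_eq d _; rewrite mul0r add0r; case: ifP => // _; rewrite mul0r.
apply/funext => v; rewrite ffunE big_mkcond; apply: eq_bigr => S _.
by case: ifP => // _; rewrite mul0r.
Qed.

(** The derivative of gauss_wedge with both vectors constant: where s u is
    normal, the terms in which a first derivative of f is paired with s u vanish,
    among them the one with the derivative of the area density. *)
Lemma wedge_dnE (s : R * R -> 'rV[R]_m.+2) u j : U u ->
  dot (s u) (pd 0 f u) = 0 -> dot (s u) (pd 1 f u) = 0 ->
  wedge_dn s n u j = (Num.sqrt (gram (pd 0 f u) (pd 1 f u)))^-1 *: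
    (dot (s u) (pd j (pd 1 f) u) *: pd 0 f u - dot (s u) (pd j (pd 0 f) u) *: pd 1 f u).
Proof.
move=> Uu s0 s1; apply/rowP => i; rewrite mxE.
have dn S : is_derive u (ebasis j) (fun v => n v S) (mv_pd j n u S).
  by rewrite ffunE; exact: smooth_on_derive (gauss_map_smooth S) Uu.
have [_ <-] := derive_wedge (mv_of (delta_mx 0 i)) [set: 'I_m.+2]%SET
   (fun S => derive_wedge (mv_of (s u)) S dn).
have d0 := smooth_on_derive j (smooth_on_pd 0 sf) Uu.
have d1 := smooth_on_derive j (smooth_on_pd 1 sf) Uu.
have cE := is_derive_funcst (delta_mx 0 i : 'rV[R]_m.+2) u (ebasis j).
have cs := is_derive_funcst (s u) u (ebasis j).
have sD : smooth_on U (fun v => (Num.sqrt (gram (pd 0 f v) (pd 1 f v)))^-1).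
  apply: smooth_onV => //; first by move=> v Uv; exact: sqrt_gram_neq0 (D0 Uv).
  by apply: smooth_on_sqrt => //; exact: smooth_gram.
have d := is_derive_funM (is_derive_funB
  (is_derive_funM (is_derive_dot cE d0) (is_derive_dot cs d1))
  (is_derive_funM (is_derive_dot cE d1) (is_derive_dot cs d0)))
  (smooth_on_derive j sD Uu).
have [_ ->] := eq_is_derive oU
  (fun v Uv => esym (gauss_wedge (delta_mx 0 i) (s u) (D0 Uv) (gn Uv))) Uu d.
have dd (v : 'rV[R]_m.+2) : dot (delta_mx 0 i) v = v 0 i.
  rewrite /dot (bigD1 i) //= big1 ?addr0 ?mxE ?eqxx ?mul1r //.
  by move=> k /negbTE ki; rewrite mxE ki andbF mul0r.
move: s0 s1; generalize (s u) as h.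
generalize (pd j (fun v => (Num.sqrt (gram (pd 0 f v) (pd 1 f v)))^-1) u) as x.
generalize (Num.sqrt (gram (pd 0 f u) (pd 1 f u)))^-1 as y.
generalize (pd j (pd 0 f) u) as f0; generalize (pd j (pd 1 f) u) as f1.
generalize (pd 0 f u) as a; generalize (pd 1 f u) as b => b a f1 f0 y x h s0 s1.
by rewrite !mxE !dd s0 s1 !dot0l; gendot; ring.
Qed.

End On.
End GaussMap.

(** * The conservation law *)

Section FirstPart.
Context {R : realType} {m : nat}.
Variables (U : set (R * R)) (f : R * R -> 'rV[R]_m.+2).
Variable (n : R * R -> multivector R m.+2).
Hypothesis oU : open U.
Hypothesis sf : smooth_on U f.
Hypothesis D0 : forall u, U u -> 0 < gram (pd 0 f u) (pd 1 f u).
Hypothesis gn : forall u, U u -> gauss_at f u (n u).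
Local Notation H := (mean_curv f).

Lemma wedge_dn_mean_curv u j : U u ->
  wedge_dn H n u j = (area_density f u)^-1 *:
    (hcoef f j 1 u *: pd 0 f u - hcoef f j 0 u *: pd 1 f u).
Proof.
move=> Uu; apply: (wedge_dnE oU sf D0 gn j Uu).
  exact: dot_mean_curv D0 0 u Uu.
exact: dot_mean_curv D0 1 u Uu.
Qed.

Lemma smooth_wedge_dn j : smooth_on U (fun u => wedge_dn H n u j).
Proof.
apply: (eq_smooth_on oU (fun u Uu => esym (wedge_dn_mean_curv j Uu))).
have sD : smooth_on U (fun v => (area_density f v)^-1).
  apply: smooth_onV => //; first by move=> v Uv; exact: sqrt_gram_neq0 (D0 Uv).
  by apply: smooth_on_sqrt => //; exact: smooth_gram.
have sh k := smooth_hcoef oU sf D0 j k.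
have sw := smooth_on_scale oU sD (smooth_onD oU
  (smooth_on_scale oU (sh 1) (smooth_on_pd 0 sf))
  (smooth_onN oU (smooth_on_scale oU (sh 0) (smooth_on_pd 1 sf)))).
exact sw.
Qed.

(** A pointwise identity. In terms of the coordinates of the tangential parts it
    is linear in the h_ij, with |H|^2 eliminated by the trace identity. *)
Lemma conservation_form u j : U u ->
  hodge f (grad H) u j - 3 *: hodge f (nproj_form f (grad H)) u j
  + wedge_dn H n u j = - 2 *: hodge f (flux f) u j.
Proof.
move=> Uu; rewrite (wedge_dn_mean_curv j Uu).
have e0 := pd_mean_curvE oU sf D0 0 Uu; have e1 := pd_mean_curvE oU sf D0 1 Uu.
rewrite !(hodgeE erefl erefl (D0 Uu)) /nproj_form /grad.
have L1 := trace_hcoef oU sf D0 Uu.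
have h10 := hcoefC oU sf 1 0 Uu.
have q0 : nproj f u (pd 0 H u) = perp (pd 0 f u) (pd 1 f u) (pd 0 H u).
  exact: (nprojE erefl erefl (D0 Uu)).
have q1 : nproj f u (pd 1 H u) = perp (pd 0 f u) (pd 1 f u) (pd 1 H u).
  exact: (nprojE erefl erefl (D0 Uu)).
have y0 := gram_neq0 (D0 Uu); have s0 := sqrt_gram_neq0 (D0 Uu).
move: e0 e1 L1 h10 q0 q1 y0 s0; rewrite /flux /tpart /area_density /gramf /gij.
generalize (perp (pd 0 f u) (pd 1 f u) (pd 0 H u)) as Q0.
generalize (perp (pd 0 f u) (pd 1 f u) (pd 1 H u)) as Q1.
generalize (nproj f u (pd 0 H u)) as Q0'; generalize (nproj f u (pd 1 H u)) as Q1'.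
have -> : hcoef f j 0 u = if j == 0 then hcoef f 0 0 u else hcoef f 1 0 u.
  by case: (ord2P j) => ->.
have -> : hcoef f j 1 u = if j == 0 then hcoef f 0 1 u else hcoef f 1 1 u.
  by case: (ord2P j) => ->.
generalize (hcoef f 0 0 u) as h00; generalize (hcoef f 1 1 u) as h11.
generalize (hcoef f 0 1 u) as h01; generalize (hcoef f 1 0 u) as h10.
generalize (dot (H u) (H u)) as N.
generalize (pd 0 H u) as dh0; generalize (pd 1 H u) as dh1.
generalize (pd 0 f u) as a; generalize (pd 1 f u) as b.
move=> b a dh1 dh0 N h10 h01 h11 h00 Q1' Q0' Q1 Q0 -> -> L1 -> -> -> y0 s0.
have NE : N = (dot b b * h00 - 2 * dot a b * h01 + dot a a * h11) / (2 * gram a b).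
  by rewrite -L1; field.
rewrite NE /dual_comb; apply/rowP => i; rewrite !mxE.
clear NE L1; move: s0 y0; generalize (Num.sqrt (gram a b)) as s; rewrite /gram.
move=> s s0 y0.
case: (j == 0); rewrite !mxE; move: y0 s0; gendot => y0 s0; field; by rewrite s0 y0.
Qed.

(** The identity conservation_form may be differentiated since all its terms are
    smooth. *)
Theorem conservation_law u : U u ->
  extd (fun v j => hodge f (grad H) v j - 3 *: hodge f (nproj_form f (grad H)) v j) u
  + extd (wedge_dn H n) u = (- 2 * area_density f u) *: willmore_op f u.
Proof.
move=> Uu; rewrite -scalerA -(extd_hodge_flux_willmore oU sf D0 Uu).
have sdH i : smooth_on U (fun v => grad H v i).
  exact: smooth_on_pd (smooth_mean_curv oU sf D0).
have spH i : smooth_on U (fun v => nproj_form f (grad H) v i).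
  exact: (smooth_ncov oU sf D0 i).
have sh1 j := smooth_hodge oU sf D0 j sdH.
have sh2 j := smooth_hodge oU sf D0 j spH.
have sA j := smooth_onD oU (sh1 j) (smooth_onN oU
  (smooth_on_scale oU (smooth_on_cst U (3 : R)) (sh2 j))).
have sC j := smooth_hodge oU sf D0 j (smooth_flux oU sf D0).
pose A j v := hodge f (grad H) v j - 3 *: hodge f (nproj_form f (grad H)) v j.
have key i j : pd i (A j) u + pd i (fun v => wedge_dn H n v j) u =
    - 2 *: pd i (fun v => hodge f (flux f) v j) u.
  have d1 := is_derive_funD (smooth_on_derive i (sA j) Uu)
    (smooth_on_derive i (smooth_wedge_dn j) Uu).
  have d2 := is_derive_scale (is_derive_funcst (- 2 : R) u (ebasis i))
    (smooth_on_derive i (sC j) Uu).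
  rewrite scale0r add0r in d2.
  exact: is_derive_unique (eq_is_derive oU (fun v Uv => conservation_form j Uv) Uu d1) d2.
rewrite /extd; move: (key 0 1) (key 1 0); rewrite /A; genpd => k1 k2.
by rewrite scalerBr -k1 -k2 opprD addrACA.
Qed.

End FirstPart.

(** * Integration over compact sets of the plane *)

Lemma bounded_pointwise {R : realType} {T : topologicalType} (K : set T) (g : T -> R) : compact K ->
  (forall u, K u -> {for u, continuous g}) -> exists C, forall u, K u -> `|g u| <= C.
Proof.
move=> cK cg.
have cw : {within K, continuous g}.
  apply/subspace_continuousP => u Ku.
  by apply: cvg_within_filter; apply: cg.
have [M [_ MK]] := compact_bounded (continuous_compact cw cK).
exists (`|M| + 1) => u Ku; apply: (MK (`|M| + 1)); last by exists u.
by rewrite (le_lt_trans (ler_norm _)) // ltrDl.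
Qed.

Section PlaneMeasure.
Context {R : realType}.
Let mu := (@lebesgue_measure R \x @lebesgue_measure R)%E.
Implicit Types (A K : set (R * R)).

(** Open sets of the plane are countable unions of rational boxes. This is
    needed because the sigma-algebra of the plane is the product one. *)
Lemma open_measurable2 A : open A ->
  measurable (A : set (measurableTypeR R * measurableTypeR R)).
Proof.
move=> oA.
pose box (q : (rat * rat) * (rat * rat)) : set (R * R) :=
  (`]ratr q.1.1, ratr q.1.2[ `*` `]ratr q.2.1, ratr q.2.2[)%classic.
have -> : A = \bigcup_q (if `[< box q `<=` A >] then box q else set0).
  apply/seteqP; split=> [u Au|u [q _]]; last by case: asboolP => // qA /qA.
  have /(nbhs_ballP _ _)[e /= e0 eA] : nbhs u A by exact: open_nbhs_nbhs.
  have itv (x : R) : exists p q : rat, [/\ x - e < ratr p, ratr p < x, x < ratr q & ratr q < x + e].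
    have [|p] := @rat_in_itvoo R (x - e) x; first by rewrite ltrBlDr ltrDl.
    rewrite in_itv /= => /andP[p1 p2].
    have [|q] := @rat_in_itvoo R x (x + e); first by rewrite ltrDl.
    by rewrite in_itv /= => /andP[q1 q2]; exists p, q.
  have [p1 [q1 [a1 a2 a3 a4]]] := itv u.1.
  have [p2 [q2 [b1 b2 b3 b4]]] := itv u.2.
  exists ((p1, q1), (p2, q2)) => //.
  case: asboolP => [_|[]].
    by split; rewrite /= in_itv /=; apply/andP.
  move=> [x y] [/=]; rewrite !in_itv /= => /andP[x1 x2] /andP[y1 y2]; apply: eA.
  split; rewrite /ball /= ltr_distlC.
    by rewrite (lt_trans a1 x1) (lt_trans x2 a4).
  by rewrite (lt_trans b1 y1) (lt_trans y2 b4).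
apply: countable_bigcupT_measurable => // q; case: ifP => _; last exact: measurable0.
by apply: measurableX; exact: measurable_itv.
Qed.

Lemma compact_measurable2 K : compact K ->
  measurable (K : set (measurableTypeR R * measurableTypeR R)).
Proof.
move=> cK; rewrite -(setCK K); apply: measurableC; apply: open_measurable2.
by apply: closed_openC; apply: compact_closed => //; exact: norm_hausdorff.
Qed.

Lemma compact_sub_square K : compact K ->
  exists2 M : R, 0 < M & K `<=` (`]- M, M[ `*` `]- M, M[)%classic.
Proof.
move=> /compact_bounded[M [_ MK]]; exists (`|M| + 2); first by rewrite ltr_pwDr.
have MM : M < `|M| + 1 by rewrite (le_lt_trans (ler_norm _)) // ltrDl.
move=> [x y] /(MK _ MM) /=; rewrite prod_normE /= ge_max => /andP[xM yM].
split; rewrite /= in_itv /= -ltr_norml; [apply: (le_lt_trans xM)|apply: (le_lt_trans yM)];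
  by rewrite ltrD2l ltr1n.
Qed.

Lemma compact_fin_measure K : compact K -> (mu K < +oo)%E.
Proof.
move=> cK; have [M M0 KM] := compact_sub_square cK.
apply: (@le_lt_trans _ _ (mu (`]- M, M[ `*` `]- M, M[)%classic)).
  apply: le_measure => //; rewrite inE; first exact: compact_measurable2.
  by apply: measurableX; exact: measurable_itv.
pose J : set R := `]- M, M[%classic.
have fin : ((@lebesgue_measure R) J < +oo)%E.
  by rewrite /J lebesgue_measure_itv /=; case: ifP => _; rewrite ?ltry // -EFinB ltry.
rewrite /mu product_measure1E; [|exact: measurable_itv|exact: measurable_itv].
by apply: lte_mul_pinfty => //; rewrite ge0_fin_numE.
Qed.

(** Because g is continuous at the points of K as a map on the plane, the
    preimage of an open set may be replaced by its interior. *)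
Lemma measurable_fun_pointwise K (g : R * R -> R) : compact K ->
  (forall u, K u -> {for u, continuous g}) ->
  measurable_fun (K : set (measurableTypeR R * measurableTypeR R)) g.
Proof.
move=> cK cg; apply: (measurability _ (measurable_realfun.RGenOpens.measurableE R)).
move=> _ [_ [a [b ->] <-]].
have -> : K `&` g @^-1` `]a, b[%classic = K `&` (g @^-1` `]a, b[%classic)^°.
  apply/seteqP; split=> u [Ku gu]; split=> //; last exact: interior_subset gu.
  apply: (cg u Ku); apply: open_nbhs_nbhs; split => //; exact: interval_open.
apply: measurableI; first exact: compact_measurable2.
by apply: open_measurable2; exact: open_interior.
Qed.

Lemma integrable_pointwise K (g : R * R -> R) : compact K ->
  (forall u, K u -> {for u, continuous g}) -> mu.-integrable K (EFin \o g).
Proof.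
move=> cK cg; apply: measurable_bounded_integrable.
- exact: compact_measurable2.
- exact: compact_fin_measure.
- exact: measurable_fun_pointwise.
- have [C hC] := bounded_pointwise cK cg.
  exists C; split; first by rewrite num_real.
  by move=> x Cx u Ku /=; rewrite (le_trans (hC u Ku)) // ltW.
Qed.

Lemma continuous_pairl (x y : R) : {for x, continuous (fun t : R => (t, y))}.
Proof.
exact: (@cvg_pair _ _ _ (nbhs x) (nbhs x) (nbhs y) _ _ _ id (cst y) cvg_id (cvg_cst y)).
Qed.

Lemma continuous_pairr (x y : R) : {for y, continuous (fun t : R => (x, t))}.
Proof.
exact: (@cvg_pair _ _ _ (nbhs y) (nbhs x) (nbhs y) _ _ _ (cst x) id (cvg_cst x) cvg_id).
Qed.

Lemma integral_line_eq0 (F dF : R -> R) (M : R) : 0 < M ->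
  (forall x, is_derive x (1 : R) F (dF x)) -> continuous dF ->
  (forall x, ~ (`]- M, M[%classic x) -> F x = 0) ->
  (forall x, ~ (`]- M, M[%classic x) -> dF x = 0) ->
  (\int[@lebesgue_measure R]_x (dF x)%:E = 0)%E.
Proof.
move=> M0 dFx cdF F0 dF0.
have MM : - M < M by rewrite gtrN.
have nM : ~ (`]- M, M[%classic M) by rewrite /= in_itv /= ltxx andbF.
have nM' : ~ (`]- M, M[%classic (- M)) by rewrite /= in_itv /= ltxx.
pose J : set R := `[- M, M]%classic.
have -> : (fun x => (dF x)%:E) = ((fun x => (dF x)%:E) \_ J).
  apply/funext => x; rewrite patchE; case: ifPn => // /negP xJ; rewrite dF0 // => xI.
  by apply: xJ; rewrite inE /J /=; exact: subset_itv_oo_cc.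
rewrite -integral_mkcond /J (@continuous_FTC2 _ dF F) ?F0 ?subee //.
- exact: continuous_subspaceT.
- have cF : continuous F.
    by move=> x; apply: differentiable_continuous; apply/derivable1_diffP; case: (dFx x).
  split; first by move=> x _; case: (dFx x).
  + apply: cvg_at_right_filter; exact: cF.
  + apply: cvg_at_left_filter; exact: cF.
- by move=> x _; rewrite derive1E; case: (dFx x).
Qed.

(** Fubini reduces the integral to lines parallel to the i-th axis, on which it
    is the increment of a compactly supported function. *)
Lemma integral_pd_eq0 K (psi : R * R -> R) i : compact K ->
  (forall u, is_derive u (ebasis i) psi (pd i psi u)) -> continuous (pd i psi) ->
  (forall u, ~ K u -> psi u = 0) ->
  (\int[mu]_(u in K) pd i psi u)%R = 0.
Proof.
move=> cK dpsi cpsi psi0.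
have pd0 u : ~ K u -> pd i psi u = 0.
  move=> nK; have oK : open (~` K).
    by apply: closed_openC; apply: compact_closed => //; exact: norm_hausdorff.
  rewrite (eq_pd (g := fun=> 0) i oK _ nK); last by move=> v; exact: psi0.
  exact: derive_cst.
have [M M0 KM] := compact_sub_square cK.
have mK := compact_measurable2 cK.
have ipsi : mu.-integrable K (EFin \o pd i psi).
  by apply: integrable_pointwise => // u _; exact: cpsi.
have restr : (EFin \o pd i psi) \_ K = EFin \o pd i psi.
  apply/funext => u; rewrite patchE; case: ifPn => // /negP uK /=.
  by rewrite pd0 // => Ku; apply: uK; rewrite inE.
rewrite /Rintegral integral_mkcond restr.
have ipsiT : mu.-integrable setT (EFin \o pd i psi).
  (* Since psi and its derivative vanish off K, the integral is one over the plane. *)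
  have iT := (integrable_mkcond _ mK).1 ipsi.
  by rewrite restr in iT.
case: (ord2P i) => i0; rewrite i0 in dpsi cpsi pd0 ipsiT *.
- rewrite -(integral21_prod_meas1 ipsiT) /fubini_G integral0_eq // => y _.
  have lineE (x : R) : (0, y) + x *: ebasis 0 = (x, y) :> R * R.
    by rewrite /ebasis /=; congr pair; rewrite /= /GRing.scale /= ?mulr1 ?mulr0 ?addr0 ?add0r.
  apply: (@integral_line_eq0 (fun x => psi (x, y)) (fun x => pd 0 psi (x, y)) M) => //.
  + move=> x; have := dpsi ((0, y) + x *: ebasis 0) => /is_derive_line.
    by rewrite lineE; under eq_fun do rewrite lineE.
  + move=> x; apply: (continuous_comp (f := fun x => (x, y))); last exact: cpsi.
    exact: continuous_pairl.
  + by move=> x xM; apply: psi0 => /KM [].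
  + by move=> x xM; apply: pd0 => /KM [].
- rewrite -(integral12_prod_meas1 ipsiT) /fubini_F integral0_eq // => x _.
  have lineE (y : R) : (x, 0) + y *: ebasis 1 = (x, y) :> R * R.
    by rewrite /ebasis /=; congr pair; rewrite /= /GRing.scale /= ?mulr1 ?mulr0 ?addr0 ?add0r.
  apply: (@integral_line_eq0 (fun y => psi (x, y)) (fun y => pd 1 psi (x, y)) M) => //.
  + move=> y; have := dpsi ((x, 0) + y *: ebasis 1) => /is_derive_line.
    by rewrite lineE; under eq_fun do rewrite lineE.
  + move=> y; apply: (continuous_comp (f := fun y => (x, y))); last exact: cpsi.
    exact: continuous_pairr.
  + by move=> y yM; apply: psi0 => /KM [].
  + by move=> y yM; apply: pd0 => /KM [].
Qed.

End PlaneMeasure.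

(** * Bump functions and the fundamental lemma of the calculus of variations *)

Section Flat.
Context {R : realType}.
Implicit Types (n : nat) (s : R).

(** The functions x ^ - n * exp (- 1 / x), extended by 0. The family in n is
    stable under differentiation (is_derive_flat), so that smoothness follows
    by one induction that never mentions derivatives of order greater than one. *)
Definition flat n s : R := if 0 < s then s^-1 ^+ n * expR (- s^-1) else 0.

Lemma flat_ge0 n s : 0 <= flat n s.
Proof.
rewrite /flat; case: ifP => // s0.
by rewrite mulr_ge0 ?expR_ge0 // exprn_ge0 // invr_ge0 ltW.
Qed.

(** Since 1 + y ^ (n + 2) / (n + 2)! <= exp y for y = 1 / s. A bound quadratic
    in s makes the derivative at 0 vanish. *)
Lemma flat_le n s : flat n s <= (n.+2)`!%:R * s ^+ 2.
Proof.
rewrite /flat; case: ifP => s0; last by rewrite mulr_ge0 ?sqr_ge0 ?ler0n.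
set x := s^-1; have x0 : 0 < x by rewrite invr_gt0.
have F0 : 0 < (n.+2)`!%:R :> R by rewrite ltr0n fact_gt0.
have -> : s ^+ 2 = x ^- 2 by rewrite /x exprVn invrK.
rewrite expRN ler_pdivrMr ?expR_gt0 // mulrAC ler_pdivlMr ?exprn_gt0 // -exprD addn2.
rewrite -ler_pdivrMl // mulrC; apply: le_trans (expR_ge1Dxn n.+1 (ltW x0)).
by rewrite lerDr.
Qed.

Lemma is_derive_flat n s : is_derive s (1 : R) (flat n) (flat n.+2 s - n%:R * flat n.+1 s).
Proof.
have [s0|s0|s0] := ltgtP 0 s.
- apply: (@near_eq_is_derive _ _ _ (fun s => s^-1 ^+ n * expR (- s^-1))).
    near=> t; rewrite /flat ifT //; near: t; exact: lt_nbhsr.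
  rewrite /flat s0.
  have sn0 : s != 0 by rewrite gt_eqF.
  have d1 : is_derive s (1 : R) (fun s : R => s^-1) (- s^-2).
    apply: is_derive_eq; first exact: (is_derive_funV sn0 (is_derive_id _ _)).
    by rewrite mulr1.
  have dn : is_derive s (1 : R) (fun s : R => s^-1 ^+ n) (n%:R * s^-1 ^+ n.-1 * (- s^-2)).
    elim: n => [|n IH]; first by rewrite !mul0r; exact: is_derive_funcst.
    have h := is_derive_funM d1 IH.
    have -> : (fun s : R => s^-1 ^+ n.+1) = (fun s => s^-1 * s^-1 ^+ n).
      by apply/funext => t; rewrite exprS.
    apply: is_derive_eq h _; case: n {IH} => [|n] /=; first by ring.
    by rewrite [in RHS]mulrS !exprS; ring.
  have de : is_derive s (1 : R) (fun s : R => expR (- s^-1)) (expR (- s^-1) * (- (- s^-2))).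
    apply: (is_derive_comp1 (h := expR)) => //; exact: is_derive_funN.
  have dd := is_derive_funM dn de; apply: is_derive_eq dd _.
  case: n {dn} => [|n] /=.
    by rewrite !mul0r mul1r subr0 add0r opprK exprVn mulrC.
  by rewrite opprK -exprVn; move: (s^-1) (expR _) => x y; rewrite !exprS; ring.
- apply: (@near_eq_is_derive _ _ _ (fun=> 0)).
    near=> t; rewrite /flat ifF //; apply/negbTE; rewrite -leNgt.
    by apply: ltW; near: t; exact: lt_nbhsl.
  rewrite /flat !ifF; try by apply/negbTE; rewrite -leNgt ltW.
  by rewrite mulr0 subr0; exact: is_derive_cst.
- rewrite -s0 /flat ltxx mulr0 subr0 {s s0}.
  have lim0 : (fun h => h^-1 *: ((flat n \o shift 0) (h *: 1) - flat n 0)) @ 0^' --> (0 : R).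
    apply/cvgrPdist_le => e e0; near=> h.
    have hn0 : h != 0 by near: h; exact: nbhs_dnbhs_neq.
    have F0 : 0 < (n.+2)`!%:R :> R by rewrite ltr0n fact_gt0.
    rewrite /= sub0r normrN addr0 [_%:A]mulr1 [flat n 0]/flat ltxx subr0 /GRing.scale /= normrM.
    rewrite (ger0_norm (flat_ge0 _ _)) normfV ler_pdivrMl ?normr_gt0 //.
    apply: (le_trans (flat_le n h)).
    rewrite -[h ^+ 2](real_normK (num_real h)) expr2 mulrCA ler_pM2l ?normr_gt0 //.
    rewrite -ler_pdivlMl // mulrC; near: h; apply: dnbhs0_le; exact: divr_gt0.
  apply: DeriveDef; first by apply/cvg_ex; exists 0.
  exact: cvg_lim.
Unshelve. all: by end_near. Qed.

Lemma Ck_on_flat k n (U : set (R * R)) (p : R * R -> R) : open U ->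
  Ck_on k U p -> Ck_on k U (fun u => flat n (p u)).
Proof.
move=> oU; elim: k n => [|k IH] n hp.
  split=> // u Uu; apply: (continuous_comp (g := flat n)).
    exact: Ck_on_continuous hp Uu.
  apply: differentiable_continuous; apply/derivable1_diffP.
  by case: (is_derive_flat n (p u)).
apply: (Ck_on_step (df := fun i u =>
  (flat n.+2 (p u) - n%:R * flat n.+1 (p u)) * pd i p u)) => //.
- move=> u Uu; apply: (continuous_comp (g := flat n)).
    exact: Ck_on_continuous hp Uu.
  apply: differentiable_continuous; apply/derivable1_diffP.
  by case: (is_derive_flat n (p u)).
- move=> i u Uu; apply: (is_derive_comp1 (h := flat n)); first exact: is_derive_flat.
  exact: Ck_on_derivable hp Uu.
- move=> i; have h := IH _ (Ck_onW hp).
  apply: Ck_onM => //; last exact: Ck_on_pd.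
  apply: Ck_onB => //; apply: Ck_onM => //; exact: Ck_on_cst.
Qed.

End Flat.

Section Coordinates.
Context {R : realType}.
Variable U : set (R * R).
Hypothesis oU : open U.

Lemma is_derive_fst i (u : R * R) : is_derive u (ebasis i) fst (ebasis i).1.
Proof.
have E : (fun h : R => h^-1 *: ((fst \o shift u) (h *: ebasis i) - u.1)) @ 0^' --> (@ebasis R i).1.
  apply: cvg_near_cst; near=> h.
  have hn0 : h != 0 by near: h; exact: nbhs_dnbhs_neq.
  by rewrite /= addrK scalerA mulVf // scale1r.
by apply: DeriveDef; [apply/cvg_ex; eexists; exact: E | exact: cvg_lim E].
Unshelve. all: by end_near. Qed.

Lemma is_derive_snd i (u : R * R) : is_derive u (ebasis i) snd (ebasis i).2.
Proof.
have E : (fun h : R => h^-1 *: ((snd \o shift u) (h *: ebasis i) - u.2)) @ 0^' --> (@ebasis R i).2.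
  apply: cvg_near_cst; near=> h.
  have hn0 : h != 0 by near: h; exact: nbhs_dnbhs_neq.
  by rewrite /= addrK scalerA mulVf // scale1r.
by apply: DeriveDef; [apply/cvg_ex; eexists; exact: E | exact: cvg_lim E].
Unshelve. all: by end_near. Qed.

Lemma smooth_on_fst : smooth_on U (@fst R R).
Proof.
case=> [|k]; first by split; [move=> u _; exact: cvg_fst | exact: I].
apply: (Ck_on_step (df := fun i _ => (ebasis i).1) oU).
- by move=> u _; exact: cvg_fst.
- by move=> i u _; exact: is_derive_fst.
- by move=> i; exact: Ck_on_cst.
Qed.

Lemma smooth_on_snd : smooth_on U (@snd R R).
Proof.
case=> [|k]; first by split; [move=> u _; exact: cvg_snd | exact: I].
apply: (Ck_on_step (df := fun i _ => (ebasis i).2) oU).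
- by move=> u _; exact: cvg_snd.
- by move=> i u _; exact: is_derive_snd.
- by move=> i; exact: Ck_on_cst.
Qed.

(** Positive at u0 and supported in a square rather than in a disc, so that
    product measures and one-variable estimates suffice. *)
Definition bump (u0 : R * R) (r : R) (u : R * R) : R :=
  flat 0 (r ^+ 2 - (u.1 - u0.1) * (u.1 - u0.1)) * flat 0 (r ^+ 2 - (u.2 - u0.2) * (u.2 - u0.2)).

Lemma smooth_bump u0 r : smooth_on U (bump u0 r).
Proof.
have c (x : R) : smooth_on U (fun=> x) by exact: smooth_on_cst.
have d1 := smooth_onD oU smooth_on_fst (smooth_onN oU (c u0.1)).
have d2 := smooth_onD oU smooth_on_snd (smooth_onN oU (c u0.2)).
have e1 := smooth_onD oU (c (r ^+ 2)) (smooth_onN oU (smooth_onM oU d1 d1)).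
have e2 := smooth_onD oU (c (r ^+ 2)) (smooth_onN oU (smooth_onM oU d2 d2)).
move=> k; have := Ck_onM oU (Ck_on_flat 0 oU (e1 k)) (Ck_on_flat 0 oU (e2 k)).
exact.
Qed.

Lemma bump_ge0 u0 r u : 0 <= bump u0 r u.
Proof. by rewrite mulr_ge0 ?flat_ge0. Qed.

Lemma bump_center_gt0 u0 r : 0 < r -> 0 < bump u0 r u0.
Proof.
by move=> r0; rewrite /bump !subrr !mulr0 !subr0 /flat exprn_gt0 // expr0 mul1r mulr_gt0 // expR_gt0.
Qed.

Lemma bump_eq0 (u0 : R * R) r u : 0 < r ->
  ~ (`[u0.1 - r, u0.1 + r] `*` `[u0.2 - r, u0.2 + r])%classic u -> bump u0 r u = 0.
Proof.
move=> r0 nu.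
have out (x x0 : R) : ~ (`[x0 - r, x0 + r]%classic x) -> flat 0 (r ^+ 2 - (x - x0) * (x - x0)) = 0.
  rewrite /= in_itv /= => /negP; rewrite -ler_distlC -ltNge distrC => h.
  rewrite /flat ifF //; apply/negbTE; rewrite -leNgt subr_le0 -expr2.
  rewrite -[leRHS](real_normK (num_real _)) lerXn2r ?nnegrE ?normr_ge0 ?ltW //.
have [h1|h1] := pselect (`[u0.1 - r, u0.1 + r]%classic u.1); last by rewrite /bump out // mul0r.
have [h2|h2] := pselect (`[u0.2 - r, u0.2 + r]%classic u.2); last by rewrite /bump (out u.2) // mulr0.
by case: nu; split.
Qed.

End Coordinates.

Section FundamentalLemma.
Context {R : realType} {m : nat}.
Let mu := (@lebesgue_measure R \x @lebesgue_measure R)%E.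
Definition square (u0 : R * R) (r : R) : set (R * R) :=
  (`[u0.1 - r, u0.1 + r] `*` `[u0.2 - r, u0.2 + r])%classic.

Lemma compact_square u0 r : compact (square u0 r).
Proof. by apply: compact_setX; exact: segment_compact. Qed.

Lemma square_gt0 u0 r : 0 < r -> (0 < mu (square u0 r))%E.
Proof.
move=> r0.
pose J (x : R) : set R := `[x - r, x + r]%classic.
have len (x : R) : @lebesgue_measure R (J x) = (2 * r)%:E.
  rewrite /J lebesgue_measure_itv /= lte_fin ifT; last by rewrite ltrBlDr -addrA ltrDl addr_gt0.
  by rewrite -EFinB; congr (_%:E); ring.
have mJ x : measurable (J x : set (measurableTypeR R)) by exact: measurable_itv.
have -> : square u0 r = J u0.1 `*` J u0.2 by [].
apply: (@lt_le_trans _ _ ((2 * r)%:E * (2 * r)%:E)%E); first by rewrite -EFinM lte_fin !mulr_gt0.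
by rewrite /mu product_measure1E // -{1}(len u0.1) -(len u0.2).
Qed.

Lemma square_sub_ball u0 r e : 0 < r -> r < e -> square u0 r `<=` ball u0 e.
Proof.
move=> r0 re u [/=]; rewrite !in_itv /= -!ler_distlC => h1 h2.
by split; rewrite /ball /=; apply: le_lt_trans re.
Qed.

(** If g were positive at u0, it would be bounded below by a positive constant
    on a small square around u0, and the integral would be positive. *)
Lemma integral_ge0_eq0 K (g : R * R -> R) u0 e : compact K -> 0 < e ->
  square u0 e `<=` K -> (forall u, K u -> {for u, continuous g}) ->
  (forall u, K u -> 0 <= g u) -> (\int[mu]_(u in K) g u)%R = 0 -> g u0 = 0.
Proof.
move=> cK e0 sqK cg g0 int0.
have Ku0 : K u0 by apply: sqK; split; rewrite /= in_itv /= lerBlDr !lerDl (ltW e0).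
apply/eqP; rewrite eq_le g0 // andbT leNgt; apply/negP => gpos.
pose c := g u0 / 2; have c0 : 0 < c by rewrite divr_gt0.
have cc : c < g u0 by rewrite /c ltr_pdivrMr // ltr_pMr // ltr1n.
have [d /= d0 hd] := (nbhs_ballP _ _).1 (cvgr_gt _ (cg u0 Ku0) c cc).
pose r := Num.min e d / 2.
have med0 : 0 < Num.min e d by rewrite lt_min e0 d0.
have r0 : 0 < r by rewrite divr_gt0.
have rmin : r < Num.min e d by rewrite /r ltr_pdivrMr // ltr_pMr // ltr1n.
have re : r < e by rewrite (lt_le_trans rmin) // ge_min lexx.
have rd : r < d by rewrite (lt_le_trans rmin) // ge_min lexx orbT.
have QK : square u0 r `<=` K.
  move=> u [/=]; rewrite !in_itv /= => /andP[a1 a2] /andP[b1 b2]; apply: sqK.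
  have H1 (x y : R) : x - r <= y -> x - e <= y by apply: le_trans; rewrite lerD2l lerN2 ltW.
  have H2 (x y : R) : y <= x + r -> y <= x + e by move=> /le_trans; apply; rewrite lerD2l ltW.
  by split; rewrite /= in_itv /= ?(H1 _ _ a1) ?(H2 _ _ a2) ?(H1 _ _ b1) ?(H2 _ _ b2).
have cQ : compact (square u0 r) by exact: compact_square.
have mK := compact_measurable2 cK; have mQ := compact_measurable2 cQ.
have ig := integrable_pointwise cK cg.
have intE : (\int[mu]_(u in K) (g u)%:E = 0)%E.
  apply: (etrans (esym (fineK (integrable_fin_num mK ig)))).
  exact: (congr1 EFin int0).
have mg := measurable_fun_pointwise cK cg.
have : (c%:E * mu (square u0 r) <= \int[mu]_(u in K) (g u)%:E)%E.
  apply: (@le_trans _ _ (\int[mu]_(u in square u0 r) (g u)%:E)%E); last first.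
    apply: ge0_subset_integral => //; first exact/measurable_realfun.measurable_EFinP.
  rewrite -integral_cst //; apply: ge0_le_integral => //.
  - by move=> u _; rewrite lee_fin ltW.
  - by apply/measurable_realfun.measurable_EFinP; apply: measurable_funS mg.
  - move=> u Qu; rewrite lee_fin ltW //; apply: hd; exact: square_sub_ball rd _ Qu.
rewrite intE; apply/negP; rewrite -ltNge mule_gt0 ?lte_fin //.
exact: square_gt0.
Qed.

(** Tested with the product of w and a bump function, the hypothesis says that
    the integral of bump * |w| ^ 2 vanishes. *)
Lemma fundamental_lemma (U : set (R * R)) (w : R * R -> 'rV[R]_m) :
  open U -> smooth_on U w ->
  (forall (K : set (R * R)) (phi : R * R -> 'rV[R]_m), compact K -> K `<=` U ->
     smooth_on U phi -> (forall u, ~ K u -> phi u = 0) ->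
     (\int[mu]_(u in K) dot (w u) (phi u))%R = 0) ->
  forall u, U u -> w u = 0.
Proof.
move=> oU sw H u0 Uu0.
have [e /= e0 eU] : nbhs_ball u0 U by apply/nbhs_ballP; exact: open_nbhs_nbhs.
pose r := e / 2; have r0 : 0 < r by rewrite divr_gt0.
have re : r < e by rewrite /r ltr_pdivrMr // ltr_pMr // ltr1n.
have KU : square u0 r `<=` U := subset_trans (square_sub_ball r0 re) eU.
have sb := smooth_bump oU u0 r.
have cK : compact (square u0 r) by exact: compact_square.
have sphi := smooth_on_scale oU sb sw.
have int0 := H _ _ cK KU sphi.
have /int0 {}int0 : forall u, ~ square u0 r u -> bump u0 r u *: w u = 0.
  by move=> u nu; rewrite bump_eq0 // scale0r.
have sg := smooth_on_dot oU sw sphi.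
have := integral_ge0_eq0 cK r0 (@subset_refl _ _) _ _ int0.
rewrite dotZr => g0; apply: dot_eq0; apply/eqP.
have : bump u0 r u0 * dot (w u0) (w u0) = 0.
  apply: g0 => [u Ku|u Ku]; first exact: Ck_on_continuous (sg 0) (KU _ Ku).
  by rewrite dotZr mulr_ge0 ?bump_ge0 ?dot_ge0.
by move/eqP; rewrite mulf_eq0 gt_eqF ?bump_center_gt0.
Qed.

End FundamentalLemma.

(** * The Willmore energy density as a function of the 2-jet *)

Section EnergyDensity.
Context {R : realType} {m : nat}.
Implicit Types a b c s d X : 'rV[R]_m.

(** In this part a, b stand for f_0, f_1, and c, s, d for f_00, f_01 + f_10,
    f_11, on which alone the energy density depends. This vector is det g times
    the trace g^ij f_ij, whose normal part is 2 H. *)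
Definition hess_comb a b c s d : 'rV[R]_m := dot b b *: c - dot a b *: s + dot a a *: d.

(** The squared norm of the normal part of X, times gram a b. *)
Definition normal_sq a b X : R := dot X X * gram a b
  - (dot b b * (dot X a * dot X a) - 2 * dot a b * (dot X a * dot X b)
     + dot a a * (dot X b * dot X b)).

(** The density |H| ^ 2 sqrt (det g) in terms of the jet, written without
    projections so that it is visibly differentiable. *)
Definition jet_energy a b c s d : R :=
  normal_sq a b (hess_comb a b c s d) / (4 * (gram a b * gram a b * gram a b))
  * Num.sqrt (gram a b).

Lemma dot_perp_sq a b X : 0 < gram a b ->
  dot (perp a b X) (perp a b X) = normal_sq a b X / gram a b.
Proof.
move=> D0; have Dn := gram_neq0 D0.
rewrite (perp_normal X (perp_dotl D0 X) (perp_dotr D0 X)) /perp dotDr dotNr.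
rewrite /dual_comb !dotE /normal_sq; move: Dn.
by generalize (gram a b) => y; gendot => Dn; field.
Qed.

Lemma energy_density f u : 0 < gram (pd 0 f u) (pd 1 f u) ->
  dot (mean_curv f u) (mean_curv f u) * vol_density f u =
  jet_energy (pd 0 f u) (pd 1 f u) (pd 0 (pd 0 f) u)
    (pd 0 (pd 1 f) u + pd 1 (pd 0 f) u) (pd 1 (pd 1 f) u).
Proof.
move=> D0; rewrite (mean_curvE erefl erefl D0) (vol_densityE erefl erefl).
have Dn := gram_neq0 D0; have := sqr_sqrtr (ltW D0); have := sqrt_gram_neq0 D0.
rewrite -/(hess_comb (pd 0 f u) (pd 1 f u) (pd 0 (pd 0 f) u)
    (pd 0 (pd 1 f) u + pd 1 (pd 0 f) u) (pd 1 (pd 1 f) u)) /jet_energy.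
move: D0 Dn; generalize (hess_comb (pd 0 f u) (pd 1 f u) (pd 0 (pd 0 f) u)
    (pd 0 (pd 1 f) u + pd 1 (pd 0 f) u) (pd 1 (pd 1 f) u)) as X.
generalize (pd 0 f u) as a; generalize (pd 1 f u) as b => b a X D0 Dn s0 _.
rewrite dotZl dotZr (dot_perp_sq _ D0); move: Dn s0.
generalize (normal_sq a b X) (Num.sqrt (gram a b)) (gram a b) => x y z *.
by field.
Qed.

Variables a' b' c' s' d' : 'rV[R]_m.

Section Derivative.
Variables a b c s d : 'rV[R]_m.
Let E := dot a a. Let F := dot a b. Let G := dot b b. Let D := gram a b.
(** From here on primes denote the velocities of the entries of the jet, and
    dE, ..., dN the resulting velocities of the quantities that make up jet_energy. *)
Definition dE := dot a' a + dot a a'.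
Definition dF := dot a' b + dot a b'.
Definition dG := dot b' b + dot b b'.
Definition dD := dE * G + E * dG - (dF * F + F * dF).
Let X := hess_comb a b c s d.
Definition dX := dG *: c + G *: c' - (dF *: s + F *: s') + (dE *: d + E *: d').
Let x := dot X a.
Definition dx := dot dX a + dot X a'.
Let y := dot X b.
Definition dy := dot dX b + dot X b'.
Let N := normal_sq a b X.
Definition dN := (dot dX X + dot X dX) * D + dot X X * dD
  - (dG * (x * x) + G * (dx * x + x * dx)
     - (2 * dF * (x * y) + 2 * F * (dx * y + x * dy))
     + (dE * (y * y) + E * (dy * y + y * dy))).
(** The power - 5 / 2 of gram a b in jet_energy accounts for the second term. *)
Definition djet_energy := (dN - 5 / 2 * N * dD / D) / (4 * (D * D * D)) * Num.sqrt D.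
End Derivative.

Lemma is_derive_jet_energy (V : normedModType R) (av bv cv sv dv : V -> 'rV[R]_m) z e :
  is_derive z e av a' -> is_derive z e bv b' -> is_derive z e cv c' ->
  is_derive z e sv s' -> is_derive z e dv d' -> 0 < gram (av z) (bv z) ->
  is_derive z e (fun z => jet_energy (av z) (bv z) (cv z) (sv z) (dv z))
    (djet_energy (av z) (bv z) (cv z) (sv z) (dv z)).
Proof.
move=> ha hb hc hs hd D0.
pose Ev z := dot (av z) (av z); pose Fv z := dot (av z) (bv z).
pose Gv z := dot (bv z) (bv z); pose Dv z := gram (av z) (bv z).
pose Xv z := hess_comb (av z) (bv z) (cv z) (sv z) (dv z).
pose Nv z := normal_sq (av z) (bv z) (Xv z).
have hE : is_derive z e Ev (dE (av z)) := is_derive_dot ha ha.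
have hF : is_derive z e Fv (dF (av z) (bv z)) := is_derive_dot ha hb.
have hG : is_derive z e Gv (dG (bv z)) := is_derive_dot hb hb.
have hD : is_derive z e Dv (dD (av z) (bv z)) :=
  is_derive_funB (is_derive_funM hE hG) (is_derive_funM hF hF).
have hX : is_derive z e Xv (dX (av z) (bv z) (cv z) (sv z) (dv z)) :=
  is_derive_funD (is_derive_funB (is_derive_scale hG hc) (is_derive_scale hF hs))
  (is_derive_scale hE hd).
have hx := is_derive_dot hX ha; have hy := is_derive_dot hX hb.
have h2F := is_derive_funM (is_derive_funcst (2 : R) z e) hF.
rewrite mul0r add0r in h2F.
have hN : is_derive z e Nv (dN (av z) (bv z) (cv z) (sv z) (dv z)) :=
  is_derive_funB (is_derive_funM (is_derive_dot hX hX) hD)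
  (is_derive_funD (is_derive_funB (is_derive_funM hG (is_derive_funM hx hx))
     (is_derive_funM h2F (is_derive_funM hx hy)))
     (is_derive_funM hE (is_derive_funM hy hy))).
have hD3 := is_derive_funM (is_derive_funcst (4 : R) z e)
  (is_derive_funM (is_derive_funM hD hD) hD).
have Dn : Dv z != 0 := gram_neq0 D0.
have D3n : 4 * (Dv z * Dv z * Dv z) != 0 by rewrite !mulf_neq0.
have hV := is_derive_funV (s := fun z => 4 * (Dv z * Dv z * Dv z)) D3n hD3.
have hS := is_derive_sqrt (s := Dv) D0 hD.
have h := is_derive_funM (is_derive_funM hN hV) hS.
apply: is_derive_eq h _; rewrite /djet_energy -/(Xv z) -/(Nv z) -/(Dv z).
have := sqr_sqrtr (ltW D0); rewrite -/(Dv z).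
have : Num.sqrt (Dv z) != 0 by rewrite gt_eqF // sqrtr_gt0.
generalize (Num.sqrt (Dv z)) (dN (av z) (bv z) (cv z) (sv z) (dv z)) (Nv z).
generalize (dD (av z) (bv z)) => dDz S dNz Nz S0 SE; rewrite -SE.
by field.
Qed.

Section Limits.
Context {T : Type} (Fl : set_system T) {FF : Filter Fl}.

Lemma cvg_dot (v w : T -> 'rV[R]_m) v0 w0 : v @ Fl --> v0 -> w @ Fl --> w0 ->
  (fun z => dot (v z) (w z)) @ Fl --> dot v0 w0.
Proof.
move=> hv hw; rewrite /dot; elim: (index_enum _) => [|i r IH].
  by rewrite !big_nil; under eq_fun do rewrite big_nil; exact: cvg_cst.
rewrite !big_cons; under eq_fun do rewrite big_cons; apply: cvgD IH; apply: cvgM.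
  exact: (@continuous_cvg _ _ _ Fl FF v (fun M => M 0 i) v0
    (@coord_continuous R 1 m 0 i v0) hv).
exact: (@continuous_cvg _ _ _ Fl FF w (fun M => M 0 i) w0
  (@coord_continuous R 1 m 0 i w0) hw).
Qed.

Variables (av bv cv sv dv av' bv' cv' sv' dv' : T -> 'rV[R]_m).
Variables (a b c s d : 'rV[R]_m).
Hypothesis ha : av @ Fl --> a. Hypothesis hb : bv @ Fl --> b.
Hypothesis hc : cv @ Fl --> c. Hypothesis hs : sv @ Fl --> s.
Hypothesis hd : dv @ Fl --> d.

Lemma cvg_gram : (fun z => gram (av z) (bv z)) @ Fl --> gram a b.
Proof.
have h1 := cvg_dot ha ha; have h2 := cvg_dot ha hb; have h3 := cvg_dot hb hb.
exact: cvgB (cvgM h1 h3) (cvgM h2 h2).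
Qed.

Lemma cvg_hess_comb : (fun z => hess_comb (av z) (bv z) (cv z) (sv z) (dv z)) @ Fl --> hess_comb a b c s d.
Proof.
have h1 := cvg_dot ha ha; have h2 := cvg_dot ha hb; have h3 := cvg_dot hb hb.
exact: cvgD (cvgB (cvgZ h3 hc) (cvgZ h2 hs)) (cvgZ h1 hd).
Qed.

Lemma cvg_normal_sq : (fun z => normal_sq (av z) (bv z)
   (hess_comb (av z) (bv z) (cv z) (sv z) (dv z))) @ Fl --> normal_sq a b (hess_comb a b c s d).
Proof.
have h1 := cvg_dot ha ha; have h2 := cvg_dot ha hb; have h3 := cvg_dot hb hb.
have hX := cvg_hess_comb; have hx := cvg_dot hX ha; have hy := cvg_dot hX hb.
have c2 : cst (2 : R) @ Fl --> (2 : R) by exact: cvg_cst.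
exact: cvgB (cvgM (cvg_dot hX hX) cvg_gram) (cvgD (cvgB (cvgM h3 (cvgM hx hx))
  (cvgM (cvgM c2 h2) (cvgM hx hy))) (cvgM h1 (cvgM hy hy))).
Qed.

Hypothesis D0 : 0 < gram a b.

Lemma cvg_weight : (fun z => (4 * (gram (av z) (bv z) * gram (av z) (bv z) * gram (av z) (bv z)))^-1)
  @ Fl --> (4 * (gram a b * gram a b * gram a b))^-1.
Proof.
have c4 : cst (4 : R) @ Fl --> (4 : R) by exact: cvg_cst.
have h := cvg_gram; apply: cvgV; last exact: cvgM c4 (cvgM (cvgM h h) h).
by rewrite !mulf_neq0 ?gram_neq0.
Qed.

Lemma cvg_sqrt_gram : (fun z => Num.sqrt (gram (av z) (bv z))) @ Fl --> Num.sqrt (gram a b).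
Proof.
exact: (@continuous_cvg _ _ _ Fl FF _ Num.sqrt _ (@sqrt_continuous R _) cvg_gram).
Qed.

Lemma cvg_jet_energy : (fun z => jet_energy (av z) (bv z) (cv z) (sv z) (dv z)) @ Fl --> jet_energy a b c s d.
Proof. exact: cvgM (cvgM cvg_normal_sq cvg_weight) cvg_sqrt_gram. Qed.

End Limits.
End EnergyDensity.

Section DerivativeLimit.
Context {R : realType} {m : nat} {T : Type} (Fl : set_system T) {FF : Filter Fl}.
Variables (av bv cv sv dv av' bv' cv' sv' dv' : T -> 'rV[R]_m).
Variables (a b c s d a' b' c' s' d' : 'rV[R]_m).
Hypothesis ha : av @ Fl --> a. Hypothesis hb : bv @ Fl --> b.
Hypothesis hc : cv @ Fl --> c. Hypothesis hs : sv @ Fl --> s.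
Hypothesis hd : dv @ Fl --> d.
Hypothesis ha' : av' @ Fl --> a'. Hypothesis hb' : bv' @ Fl --> b'.
Hypothesis hc' : cv' @ Fl --> c'. Hypothesis hs' : sv' @ Fl --> s'.
Hypothesis hd' : dv' @ Fl --> d'.
Hypothesis D0 : 0 < gram a b.

Lemma cvg_djet_energy : (fun z => djet_energy (av' z) (bv' z) (cv' z) (sv' z) (dv' z)
    (av z) (bv z) (cv z) (sv z) (dv z)) @ Fl --> djet_energy a' b' c' s' d' a b c s d.
Proof.
have hE : (fun z => dot (av z) (av z)) @ Fl --> dot a a by exact: cvg_dot.
have hF : (fun z => dot (av z) (bv z)) @ Fl --> dot a b by exact: cvg_dot.
have hG : (fun z => dot (bv z) (bv z)) @ Fl --> dot b b by exact: cvg_dot.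
have kE : (fun z => dE (av' z) (av z)) @ Fl --> dE a' a.
  by apply: cvgD; exact: cvg_dot.
have kF : (fun z => dF (av' z) (bv' z) (av z) (bv z)) @ Fl --> dF a' b' a b.
  by apply: cvgD; exact: cvg_dot.
have kG : (fun z => dG (bv' z) (bv z)) @ Fl --> dG b' b.
  by apply: cvgD; exact: cvg_dot.
have kD : (fun z => dD (av' z) (bv' z) (av z) (bv z)) @ Fl --> dD a' b' a b.
  by exact: (cvgB (cvgD (cvgM kE hG) (cvgM hE kG)) (cvgD (cvgM kF hF) (cvgM hF kF))).
pose Xv z := hess_comb (av z) (bv z) (cv z) (sv z) (dv z).
have hX : Xv @ Fl --> hess_comb a b c s d by exact: cvg_hess_comb.
have kX : (fun z => dX (av' z) (bv' z) (cv' z) (sv' z) (dv' z)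
    (av z) (bv z) (cv z) (sv z) (dv z)) @ Fl --> dX a' b' c' s' d' a b c s d.
  by exact: (cvgD (cvgB (cvgD (cvgZ kG hc) (cvgZ hG hc')) (cvgD (cvgZ kF hs) (cvgZ hF hs')))
    (cvgD (cvgZ kE hd) (cvgZ hE hd'))).
have hx : (fun z => dot (Xv z) (av z)) @ Fl --> dot (hess_comb a b c s d) a by exact: cvg_dot.
have hy : (fun z => dot (Xv z) (bv z)) @ Fl --> dot (hess_comb a b c s d) b by exact: cvg_dot.
have kx : (fun z => dx (av' z) (bv' z) (cv' z) (sv' z) (dv' z)
    (av z) (bv z) (cv z) (sv z) (dv z)) @ Fl --> dx a' b' c' s' d' a b c s d.
  by apply: cvgD; exact: cvg_dot.
have ky : (fun z => dy (av' z) (bv' z) (cv' z) (sv' z) (dv' z)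
    (av z) (bv z) (cv z) (sv z) (dv z)) @ Fl --> dy a' b' c' s' d' a b c s d.
  by apply: cvgD; exact: cvg_dot.
have c2 : cst (2 : R) @ Fl --> (2 : R) by exact: cvg_cst.
have hD : (fun z => gram (av z) (bv z)) @ Fl --> gram a b by exact: cvg_gram.
have hXX : (fun z => dot (Xv z) (Xv z)) @ Fl --> dot (hess_comb a b c s d) (hess_comb a b c s d).
  by exact: cvg_dot.
have kXX : (fun z => dot (dX (av' z) (bv' z) (cv' z) (sv' z) (dv' z)
    (av z) (bv z) (cv z) (sv z) (dv z)) (Xv z) + dot (Xv z) (dX (av' z) (bv' z)
    (cv' z) (sv' z) (dv' z) (av z) (bv z) (cv z) (sv z) (dv z))) @ Fl -->
    dot (dX a' b' c' s' d' a b c s d) (hess_comb a b c s d)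
    + dot (hess_comb a b c s d) (dX a' b' c' s' d' a b c s d).
  by apply: cvgD; exact: cvg_dot.
have kN : (fun z => dN (av' z) (bv' z) (cv' z) (sv' z) (dv' z)
    (av z) (bv z) (cv z) (sv z) (dv z)) @ Fl --> dN a' b' c' s' d' a b c s d.
  by exact: (cvgB (cvgD (cvgM kXX hD) (cvgM hXX kD))
   (cvgD (cvgB (cvgD (cvgM kG (cvgM hx hx)) (cvgM hG (cvgD (cvgM kx hx) (cvgM hx kx))))
     (cvgD (cvgM (cvgM c2 kF) (cvgM hx hy)) (cvgM (cvgM c2 hF) (cvgD (cvgM kx hy) (cvgM hx ky)))))
     (cvgD (cvgM kE (cvgM hy hy)) (cvgM hE (cvgD (cvgM ky hy) (cvgM hy ky)))))).
have hN : (fun z => normal_sq (av z) (bv z) (Xv z)) @ Fl -->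
    normal_sq a b (hess_comb a b c s d) by exact: cvg_normal_sq.
have c52 : cst (5 / 2 : R) @ Fl --> (5 / 2 : R) by exact: cvg_cst.
have iD : (fun z => (gram (av z) (bv z))^-1) @ Fl --> (gram a b)^-1.
  by apply: cvgV => //; exact: gram_neq0.
have hW : (fun z => (4 * (gram (av z) (bv z) * gram (av z) (bv z) * gram (av z) (bv z)))^-1)
  @ Fl --> (4 * (gram a b * gram a b * gram a b))^-1 by exact: cvg_weight.
have hS : (fun z => Num.sqrt (gram (av z) (bv z))) @ Fl --> Num.sqrt (gram a b).
  by exact: cvg_sqrt_gram.
exact: (cvgM (cvgM (cvgB kN (cvgM (cvgM (cvgM c52 hN) kD) iD)) hW) hS).
Qed.

End DerivativeLimit.

(** * First variation of the energy *)

Section DerivativeOfIntegral.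
Context {R : realType}.
Let mu := (@lebesgue_measure R \x @lebesgue_measure R)%E.

(** Differentiation under the integral sign, dominated by a constant: the
    derivative is continuous on the product of a compact interval of times and K,
    hence bounded there. *)
Lemma is_derive_integral (K : set (R * R)) (e de : R -> R * R -> R) (r : R) :
  compact K -> 0 < r ->
  (forall t u, `|t| < r -> K u -> {for u, continuous (e t)}) ->
  (forall t u, `|t| < r -> K u -> is_derive t (1 : R) (e ^~ u) (de t u)) ->
  (forall t u, `|t| < r -> K u -> {for (t, u), continuous (fun p => de p.1 p.2)}) ->
  is_derive (0 : R) (1 : R) (fun t => (\int[mu]_(u in K) e t u)%R)
    (\int[mu]_(u in K) de 0 u)%R.
Proof.
move=> cK r0 ce hde cde.
(* The estimate is needed on a closed interval of times, hence the half of r. *)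
pose q := r / 2; have q0 : 0 < q by rewrite divr_gt0.
have qr : q < r by rewrite /q ltr_pdivrMr // ltr_pMr // ltr1n.
pose J : set R := `[- q, q]%classic.
have Jr t : J t -> `|t| < r.
  by rewrite /J /= in_itv /= -ler_norml => /le_lt_trans; apply.
have cJK : compact (J `*` K) by apply: compact_setX => //; exact: segment_compact.
have [|C hC] := bounded_pointwise (g := fun p : R * (R * R) => de p.1 p.2) cJK.
  by case=> t u [/= Jt Ku]; apply: cde => //; exact: Jr.
have mK := compact_measurable2 cK.
have Jo t : (`]- q, q[%classic : set R) t -> J t by exact: subset_itv_oo_cc.
have I0 : (`]- q, q[%classic : set R) 0 by rewrite /= in_itv /= oppr_lt0 q0.
have intf (t : R) : (`]- q, q[%classic : set R) t -> mu.-integrable K (EFin \o e t).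
  move=> /Jo /Jr tr; apply: integrable_pointwise => // u Ku; exact: ce.
have derf (t : R) u : (`]- q, q[%classic : set R) t -> K u -> derivable (e ^~ u) t 1.
  by move=> /Jo /Jr tr Ku; case: (hde t u tr Ku).
have deE (t : R) u : (`]- q, q[%classic : set R) t -> K u -> partial1of2 e t u = de t u.
  by move=> /Jo /Jr tr Ku; rewrite partial1of2E; case: (hde t u tr Ku).
have intC : mu.-integrable K (EFin \o cst `|C|).
  by apply: integrable_pointwise => // u _; exact: cst_continuous.
have GC (t : R) u : (`]- q, q[%classic : set R) t -> K u -> `|partial1of2 e t u| <= cst `|C| u.
  move=> It Ku; rewrite deE //=; apply: (le_trans _ (ler_norm C)).
  exact: (hC (t, u) (conj (Jo _ It) Ku)).
have C0 (u : R * R) : 0 <= cst `|C| u by [].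
have h1 := derivable_under_integral mK I0 intf derf C0 intC GC.
have h2 := differentiation_under_integral mK I0 intf derf C0 intC GC.
apply: DeriveDef => //; rewrite -derive1E h2; apply: eq_Rintegral => u Ku.
by apply: deE => //; apply/set_mem.
Qed.

End DerivativeOfIntegral.

Section Variation.
Context {R : realType} {m : nat}.
Let mu := (@lebesgue_measure R \x @lebesgue_measure R)%E.
Variables (U : set (R * R)) (f phi : R * R -> 'rV[R]_m).
Hypothesis oU : open U.
Hypothesis sf : smooth_on U f.
Hypothesis sphi : smooth_on U phi.
Hypothesis D0 : forall u, U u -> 0 < gram (pd 0 f u) (pd 1 f u).

(** The variation of a map and of each of its derivatives has this form. *)
Definition vary (g h : R * R -> 'rV[R]_m) (t : R) (u : R * R) := g u + t *: h u.

Lemma continuous_vary g h t u : {for u, continuous g} -> {for u, continuous h} ->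
  {for (t, u), continuous (fun p => vary g h p.1 p.2)}.
Proof.
move=> cg ch.
have c1 : (fun p : R * (R * R) => p.1) @ nbhs (t, u) --> t by exact: cvg_fst.
have c2 : (fun p : R * (R * R) => p.2) @ nbhs (t, u) --> u by exact: cvg_snd.
have cg' : (fun p : R * (R * R) => g p.2) @ nbhs (t, u) --> g u.
  exact: continuous_cvg c2.
have ch' : (fun p : R * (R * R) => h p.2) @ nbhs (t, u) --> h u.
  exact: continuous_cvg c2.
exact: cvgD cg' (cvgZ c1 ch').
Qed.

Lemma is_derive_vary g h t u : is_derive t (1 : R) (vary g h ^~ u) (h u).
Proof.
have := is_derive_funD (is_derive_funcst (g u) t 1)
  (is_derive_scale (is_derive_id t 1) (is_derive_funcst (h u) t 1)).
by move=> h1; apply: is_derive_eq h1 _; rewrite scaler0 addr0 scale1r add0r.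
Qed.

Lemma pd_vary g h t i u : smooth_on U g -> smooth_on U h -> U u ->
  pd i (vary g h t) u = vary (pd i g) (pd i h) t u.
Proof.
move=> sg sh Uu.
have dg := smooth_on_derive i sg Uu; have dh := smooth_on_derive i sh Uu.
have [_ e] := is_derive_funD dg (is_derive_scale (is_derive_funcst t u (ebasis i)) dh).
by move: e; rewrite scale0r add0r.
Qed.

Lemma pd2_vary g h t i j u : smooth_on U g -> smooth_on U h -> U u ->
  pd i (pd j (vary g h t)) u = vary (pd i (pd j g)) (pd i (pd j h)) t u.
Proof.
move=> sg sh Uu.
rewrite (eq_pd i oU (fun v Uv => pd_vary t j sg sh Uv) Uu).
by apply: pd_vary => //; exact: smooth_on_pd.
Qed.

(** Each point of K has a neighbourhood on which the two vectors remain
    independent for small times, and K is covered by finitely many of them. *)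
Lemma gram_vary_gt0 (K : set (R * R)) (g0 h0 g1 h1 : R * R -> 'rV[R]_m) :
  compact K ->
  (forall u, K u -> {for u, continuous g0}) -> (forall u, K u -> {for u, continuous h0}) ->
  (forall u, K u -> {for u, continuous g1}) -> (forall u, K u -> {for u, continuous h1}) ->
  (forall u, K u -> 0 < gram (g0 u) (g1 u)) ->
  exists2 r : R, 0 < r &
  forall t u, `|t| < r -> K u -> 0 < gram (vary g0 h0 t u) (vary g1 h1 t u).
Proof.
move=> cK cg0 ch0 cg1 ch1 Dg.
have near0 u : K u -> \forall u' \near u & t \near nbhs (0 : R),
    0 < gram (vary g0 h0 t u') (vary g1 h1 t u').
  move=> Ku.
  have c0 := @continuous_vary g0 h0 0 u (cg0 _ Ku) (ch0 _ Ku).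
  have c1 := @continuous_vary g1 h1 0 u (cg1 _ Ku) (ch1 _ Ku).
  have cG : (fun p => gram (vary g0 h0 p.1 p.2) (vary g1 h1 p.1 p.2))
      @ nbhs ((0 : R), u) --> gram (vary g0 h0 0 u) (vary g1 h1 0 u).
    exact: (cvg_gram c0 c1).
  have D0u : 0 < gram (vary g0 h0 0 u) (vary g1 h1 0 u).
    by rewrite /vary !scale0r !addr0; exact: Dg.
  (* The neighbourhood of (0, u) is a product, with its factors in the other order. *)
  have [[A B] /= [nA nB] AB] := cvgr_gt _ cG _ D0u.
  by exists (B, A) => //= -[v t] [/= Bv At]; exact: (AB (t, v)).
have [r /= r0 hr] := (compact_near_coveringP _).1 cK _ _
  (fun t u => 0 < gram (vary g0 h0 t u) (vary g1 h1 t u)) _ near0.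
exists r => // t u tr Ku; apply: (hr t) => //=.
by rewrite sub0r normrN.
Qed.

Lemma is_derive_integral_jet_energy (K : set (R * R))
    (g0 h0 g1 h1 g2 h2 g3 h3 g4 h4 : R * R -> 'rV[R]_m) (r : R) :
  compact K -> 0 < r ->
  (forall u, K u -> {for u, continuous g0}) -> (forall u, K u -> {for u, continuous h0}) ->
  (forall u, K u -> {for u, continuous g1}) -> (forall u, K u -> {for u, continuous h1}) ->
  (forall u, K u -> {for u, continuous g2}) -> (forall u, K u -> {for u, continuous h2}) ->
  (forall u, K u -> {for u, continuous g3}) -> (forall u, K u -> {for u, continuous h3}) ->
  (forall u, K u -> {for u, continuous g4}) -> (forall u, K u -> {for u, continuous h4}) ->
  (forall t u, `|t| < r -> K u -> 0 < gram (vary g0 h0 t u) (vary g1 h1 t u)) ->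
  is_derive (0 : R) (1 : R)
    (fun t => (\int[mu]_(u in K) jet_energy (vary g0 h0 t u) (vary g1 h1 t u)
       (vary g2 h2 t u) (vary g3 h3 t u) (vary g4 h4 t u))%R)
    (\int[mu]_(u in K) djet_energy (h0 u) (h1 u) (h2 u) (h3 u) (h4 u)
       (g0 u) (g1 u) (g2 u) (g3 u) (g4 u))%R.
Proof.
move=> cK r0 cg0 ch0 cg1 ch1 cg2 ch2 cg3 ch3 cg4 ch4 hr.
pose de t u := djet_energy (h0 u) (h1 u) (h2 u) (h3 u) (h4 u)
  (vary g0 h0 t u) (vary g1 h1 t u) (vary g2 h2 t u)
  (vary g3 h3 t u) (vary g4 h4 t u).
have -> : (fun u => djet_energy (h0 u) (h1 u) (h2 u) (h3 u) (h4 u)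
       (g0 u) (g1 u) (g2 u) (g3 u) (g4 u)) = de 0.
  by apply/funext => u; rewrite /de /vary !scale0r !addr0.
pose e t u := jet_energy (vary g0 h0 t u) (vary g1 h1 t u)
  (vary g2 h2 t u) (vary g3 h3 t u) (vary g4 h4 t u).
apply: (is_derive_integral (e := e) (de := de) cK r0).
- move=> t u tr Ku.
  have ct g h : {for u, continuous g} -> {for u, continuous h} ->
      vary g h t @ nbhs u --> vary g h t u.
    move=> cg ch; have ctt : (fun=> t) @ nbhs u --> t by exact: cvg_cst.
    exact: cvgD cg (cvgZ ctt ch).
  have k0 := ct _ _ (cg0 _ Ku) (ch0 _ Ku); have k1 := ct _ _ (cg1 _ Ku) (ch1 _ Ku).
  have k2 := ct _ _ (cg2 _ Ku) (ch2 _ Ku); have k3 := ct _ _ (cg3 _ Ku) (ch3 _ Ku).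
  have k4 := ct _ _ (cg4 _ Ku) (ch4 _ Ku).
  exact: (cvg_jet_energy k0 k1 k2 k3 k4 (hr _ _ tr Ku)).
- move=> t u tr Ku.
  exact: (is_derive_jet_energy (is_derive_vary g0 h0 t u) (is_derive_vary g1 h1 t u)
    (is_derive_vary g2 h2 t u) (is_derive_vary g3 h3 t u) (is_derive_vary g4 h4 t u)
    (hr _ _ tr Ku)).
- move=> t u tr Ku.
  have c2 : (fun p : R * (R * R) => p.2) @ nbhs (t, u) --> u by exact: cvg_snd.
  have cc g : {for u, continuous g} ->
      (fun p : R * (R * R) => g p.2) @ nbhs (t, u) --> (g u : 'rV[R]_m).
    by move=> cg; exact: continuous_cvg c2.
  have k0 := @continuous_vary _ _ t _ (cg0 _ Ku) (ch0 _ Ku).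
  have k1 := @continuous_vary _ _ t _ (cg1 _ Ku) (ch1 _ Ku).
  have k2 := @continuous_vary _ _ t _ (cg2 _ Ku) (ch2 _ Ku).
  have k3 := @continuous_vary _ _ t _ (cg3 _ Ku) (ch3 _ Ku).
  have k4 := @continuous_vary _ _ t _ (cg4 _ Ku) (ch4 _ Ku).
  exact: (cvg_djet_energy k0 k1 k2 k3 k4 (cc _ (ch0 _ Ku)) (cc _ (ch1 _ Ku))
    (cc _ (ch2 _ Ku)) (cc _ (ch3 _ Ku)) (cc _ (ch4 _ Ku)) (hr _ _ tr Ku)).
Qed.

Let f0 := pd 0 f. Let f1 := pd 1 f. Let f00 := pd 0 (pd 0 f).
Let fs u := pd 0 (pd 1 f) u + pd 1 (pd 0 f) u. Let f11 := pd 1 (pd 1 f).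
Let p0 := pd 0 phi. Let p1 := pd 1 phi. Let p00 := pd 0 (pd 0 phi).
Let ps u := pd 0 (pd 1 phi) u + pd 1 (pd 0 phi) u. Let p11 := pd 1 (pd 1 phi).

Let cf0 u : U u -> {for u, continuous f0}.
Proof. by apply: Ck_on_continuous (smooth_on_pd 0 sf 0). Qed.
Let cf1 u : U u -> {for u, continuous f1}.
Proof. by apply: Ck_on_continuous (smooth_on_pd 1 sf 0). Qed.
Let cp0 u : U u -> {for u, continuous p0}.
Proof. by apply: Ck_on_continuous (smooth_on_pd 0 sphi 0). Qed.
Let cp1 u : U u -> {for u, continuous p1}.
Proof. by apply: Ck_on_continuous (smooth_on_pd 1 sphi 0). Qed.
Let cf00 u : U u -> {for u, continuous f00}.
Proof. by apply: Ck_on_continuous (smooth_on_pd 0 (smooth_on_pd 0 sf) 0). Qed.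
Let cf11 u : U u -> {for u, continuous f11}.
Proof. by apply: Ck_on_continuous (smooth_on_pd 1 (smooth_on_pd 1 sf) 0). Qed.
Let cp00 u : U u -> {for u, continuous p00}.
Proof. by apply: Ck_on_continuous (smooth_on_pd 0 (smooth_on_pd 0 sphi) 0). Qed.
Let cp11 u : U u -> {for u, continuous p11}.
Proof. by apply: Ck_on_continuous (smooth_on_pd 1 (smooth_on_pd 1 sphi) 0). Qed.
Let smooth_mixed (g : R * R -> 'rV[R]_m) : smooth_on U g ->
  smooth_on U (fun u => pd 0 (pd 1 g) u + pd 1 (pd 0 g) u).
Proof. by move=> sg; apply: smooth_onD => //; do 2 apply: smooth_on_pd. Qed.
Let cfs u : U u -> {for u, continuous fs}.
Proof. by apply: Ck_on_continuous (smooth_mixed sf 0). Qed.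
Let cps u : U u -> {for u, continuous ps}.
Proof. by apply: Ck_on_continuous (smooth_mixed sphi 0). Qed.

Definition first_variation u := djet_energy (p0 u) (p1 u) (p00 u) (ps u) (p11 u)
  (f0 u) (f1 u) (f00 u) (fs u) (f11 u).

(** For small t the energy of f + t phi is the integral of jet_energy along the
    variation, because f + t phi is still an immersion on K. *)
Lemma is_derive_willmore_energy K : compact K -> K `<=` U ->
  is_derive (0 : R) (1 : R) (fun t : R => willmore_energy K (fun u => f u + t *: phi u))
    (\int[mu]_(u in K) first_variation u)%R.
Proof.
move=> cK KU.
have [r r0 hr] := gram_vary_gt0 cK (fun u Ku => cf0 (KU _ Ku)) (fun u Ku => cp0 (KU _ Ku))
  (fun u Ku => cf1 (KU _ Ku)) (fun u Ku => cp1 (KU _ Ku)) (fun u Ku => D0 (KU _ Ku)).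
have h := is_derive_integral_jet_energy cK r0
  (fun u Ku => cf0 (KU _ Ku)) (fun u Ku => cp0 (KU _ Ku))
  (fun u Ku => cf1 (KU _ Ku)) (fun u Ku => cp1 (KU _ Ku))
  (fun u Ku => cf00 (KU _ Ku)) (fun u Ku => cp00 (KU _ Ku))
  (fun u Ku => cfs (KU _ Ku)) (fun u Ku => cps (KU _ Ku))
  (fun u Ku => cf11 (KU _ Ku)) (fun u Ku => cp11 (KU _ Ku)) hr.
apply: near_eq_is_derive h.
exists r => //= t; rewrite /ball /= sub0r normrN => tr.
apply: eq_Rintegral => u /set_mem Ku; have Uu := KU _ Ku.
have D := hr _ _ tr Ku.
have e0 := pd_vary t 0 sf sphi Uu; have e1 := pd_vary t 1 sf sphi Uu.
have e00 := pd2_vary t 0 0 sf sphi Uu; have e01 := pd2_vary t 0 1 sf sphi Uu.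
have e10 := pd2_vary t 1 0 sf sphi Uu; have e11 := pd2_vary t 1 1 sf sphi Uu.
have es : pd 0 (pd 1 (vary f phi t)) u + pd 1 (pd 0 (vary f phi t)) u = vary fs ps t u.
  by rewrite e01 e10 /vary /fs /ps; genpd; rewrite scalerDr addrACA.
rewrite -/f0 -/p0 in e0; rewrite -/f1 -/p1 in e1.
rewrite -e0 -e1 in D.
have := energy_density D; rewrite es e0 e1 e00 e11.
exact.
Qed.

End Variation.

(** * First variation of a conformal immersion *)

(** In conformal coordinates hess_comb is a multiple of h, so that its products
    with a and b, which enter the density quadratically, do not contribute. *)
Lemma djet_energy_conformal (R : realType) m (a' b' c' s' d' a b c s d h : 'rV[R]_m) :
  dot a a = dot b b -> dot a b = 0 -> 0 < dot a a ->
  c + d = (2 * dot a a) *: h -> dot h a = 0 -> dot h b = 0 ->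
  djet_energy a' b' c' s' d' a b c s d =
  dot h (c' + d') + dot h h * (dot a a' + dot b b')
  - (2 * dot h c * dot a a' + dot h s * (dot a' b + dot a b')
     + 2 * dot h d * dot b b') / dot a a.
Proof.
move=> EG F0 E0 tr ha hb; pose l := dot a a.
have GE : dot b b = l by [].
have XE : hess_comb a b c s d = (2 * l ^+ 2) *: h.
  rewrite /hess_comb GE F0 scale0r subr0 -scalerDr tr scalerA.
  by congr (_ *: _); rewrite /l; ring.
have DE : gram a b = l ^+ 2 by rewrite /gram GE F0 expr0n subr0 expr2.
have SE : Num.sqrt (l ^+ 2) = l by rewrite sqrtr_sqr ger0_norm // ltW.
have hd : dot h d = 2 * l * dot h h - dot h c.
  by rewrite -dotZr -tr dotDr addrAC subrr add0r.
have l0 : l != 0 by rewrite gt_eqF.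
rewrite /djet_energy /dN /dx /dy /normal_sq /dD /dX /dE /dF /dG XE DE SE GE F0 -/l.
rewrite !(dotZl (2 * l ^+ 2) h) ha hb !mulr0 !mul0r !dotE hd.
rewrite (dotC c h) (dotC s h) (dotC d h) (dotC c' h) (dotC s' h) (dotC d' h) hd.
rewrite (dotC a' a) (dotC b' b).
move: l0; clear; move: l => l; gendot => l0; by field.
Qed.

Lemma Rintegral_dropl d (T : measurableType d) (R : realType)
    (mu : {measure set T -> \bar R}) (K : set T) (g h w : T -> R) :
  measurable K -> mu.-integrable K (EFin \o g) -> mu.-integrable K (EFin \o h) ->
  mu.-integrable K (EFin \o w) ->
  (\int[mu]_(x in K) g x)%R = 0 -> (\int[mu]_(x in K) h x)%R = 0 ->
  (\int[mu]_(x in K) (g x + h x + w x))%R = (\int[mu]_(x in K) w x)%R.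
Proof.
move=> mK ig ih iw g0 h0.
have igh : mu.-integrable K (EFin \o (fun x => g x + h x)) by exact: (integrableD mK ig ih).
by rewrite RintegralD // RintegralD // g0 h0 !add0r.
Qed.

Section Conformal.
Context {R : realType} {m : nat}.
Let mu := (@lebesgue_measure R \x @lebesgue_measure R)%E.
Variables (U : set (R * R)) (f : R * R -> 'rV[R]_m).
Hypothesis oU : open U.
Hypothesis sf : smooth_on U f.
Hypothesis D0 : forall u, U u -> 0 < gram (pd 0 f u) (pd 1 f u).
Hypothesis conf : forall u, U u -> conformal_at f u.
Local Notation H := (mean_curv f).

Lemma conformal_eq u : U u -> gij f 0 0 u = gij f 1 1 u.
Proof. by move=> /conf[+ _]; rewrite !mxE. Qed.

Lemma conformal_orth u : U u -> gij f 0 1 u = 0.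
Proof. by move=> /conf[_]; rewrite !mxE. Qed.

Lemma conformal_deq k u : U u -> dgij f k 0 0 u = dgij f k 1 1 u.
Proof.
move=> Uu; have d0 := derive_metric sf k 0 0 Uu; have d1 := derive_metric sf k 1 1 Uu.
exact: is_derive_unique (eq_is_derive oU conformal_eq Uu d0) d1.
Qed.

Lemma conformal_dorth k u : U u -> dgij f k 0 1 u = 0.
Proof.
move=> Uu; have d0 := derive_metric sf k 0 1 Uu.
apply: is_derive_unique (eq_is_derive oU conformal_orth Uu d0) _.
Qed.

(** The derivatives of |f_0| ^ 2 = |f_1| ^ 2 and f_0 . f_1 = 0 show that the
    flat Laplacian of f is normal. *)
Lemma conformal_trace u : U u ->
  pd 0 (pd 0 f) u + pd 1 (pd 1 f) u = (2 * gij f 0 0 u) *: H u.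
Proof.
move=> Uu; have e := mean_curv_comb oU sf D0 Uu.
have S := pd_sym_row 1 0 oU (sf 2) Uu.
have c0 := conformal_deq 0 Uu; have c1 := conformal_deq 1 Uu.
have o0 := conformal_dorth 0 Uu; have o1 := conformal_dorth 1 Uu.
have q := conformal_eq Uu; have o := conformal_orth Uu.
have E0 := dot_gt0_gram (D0 Uu).
move: e S c0 c1 o0 o1 q o E0; rewrite /dgij /gij /gramf.
generalize (H u) as h; generalize (pd 0 (pd 0 f) u) as c; generalize (pd 1 (pd 1 f) u) as d.
generalize (pd 0 (pd 1 f) u) as s; generalize (pd 1 (pd 0 f) u) as s'.
generalize (pd 0 f u) as a; generalize (pd 1 f u) as b.
move=> b a s' s d c h e -> {s'} c0 c1 o0 o1 q o E0.
have Xa : dot (c + d) a = 0.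
  move: c0 c1 o0 o1; rewrite dotDl (dotC a c) (dotC a d) (dotC b s) (dotC b d) (dotC a s).
  by gendot => *; lra.
have Xb : dot (c + d) b = 0.
  move: c0 c1 o0 o1; rewrite dotDl (dotC a c) (dotC a d) (dotC b s) (dotC b d) (dotC a s).
  by gendot => *; lra.
move: e; rewrite /= -q o mulr0 scale0r subr0 -scalerDr !dotZl Xa Xb !mulr0 dual_comb0 subr0.
rewrite /gram o -q expr0n /= subr0 => e.
have l0 : dot a a != 0 by rewrite gt_eqF.
by apply: (scalerI l0); rewrite -e scalerA; congr (_ *: _); ring.
Qed.

Lemma dot_tpart_conformal u j w : U u ->
  dot (tpart f j u) w = (hcoef f 0 j u * dot (pd 0 f u) w
    + hcoef f 1 j u * dot (pd 1 f u) w) / gij f 0 0 u.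
Proof.
move=> Uu; have q := conformal_eq Uu; have o := conformal_orth Uu.
have E0 := dot_gt0_gram (D0 Uu).
move: q o E0; rewrite /tpart /dual_comb /gij /gram.
generalize (hcoef f 0 j u) (hcoef f 1 j u).
generalize (pd 0 f u) as a; generalize (pd 1 f u) as b.
move=> b a x y q o E0; have E0' : dot a a != 0 by rewrite gt_eqF.
by move: E0'; rewrite -q o expr0n /= subr0 !dotE; gendot => E0'; field.
Qed.

Section Test.
Variables (phi : R * R -> 'rV[R]_m).
Hypothesis sphi : smooth_on U phi.

Definition div_flux u := pd 0 (fun v => flux f v 0) u + pd 1 (fun v => flux f v 1) u.

(** The field whose divergence separates the derivatives of phi from phi in the
    first variation. *)
Definition boundary_flux j u := dot (H u) (pd j phi u) - dot (flux f u j) (phi u).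

Lemma smooth_boundary_flux j : smooth_on U (boundary_flux j).
Proof.
have sH := smooth_mean_curv oU sf D0; have sF := smooth_flux oU sf D0 j.
exact: (smooth_onD oU (smooth_on_dot oU sH (smooth_on_pd j sphi))
  (smooth_onN oU (smooth_on_dot oU sF sphi))).
Qed.

Lemma pd_boundary_flux j u : U u -> pd j (boundary_flux j) u =
  dot (pd j H u) (pd j phi u) + dot (H u) (pd j (pd j phi) u)
  - (dot (pd j (fun v => flux f v j) u) (phi u) + dot (flux f u j) (pd j phi u)).
Proof.
move=> Uu; have sH := smooth_mean_curv oU sf D0; have sF := smooth_flux oU sf D0 j.
have dH := smooth_on_derive j sH Uu; have dF := smooth_on_derive j sF Uu.
have dp := smooth_on_derive j sphi Uu.
have dpp := smooth_on_derive j (smooth_on_pd j sphi) Uu.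
by have [_] := is_derive_funB (is_derive_dot dH dpp) (is_derive_dot dF dp).
Qed.

Lemma first_variationE u : U u -> first_variation f phi u =
  pd 0 (boundary_flux 0) u + pd 1 (boundary_flux 1) u + dot (div_flux u) (phi u).
Proof.
move=> Uu; have n0 := dot_mean_curv D0 0 Uu; have n1 := dot_mean_curv D0 1 Uu.
have q := conformal_eq Uu; have o := conformal_orth Uu; have tr := conformal_trace Uu.
have E0 := dot_gt0_gram (D0 Uu).
rewrite /first_variation (djet_energy_conformal _ _ _ _ _ _ q o E0 tr n0 n1).
rewrite (pd_boundary_flux 0 Uu) (pd_boundary_flux 1 Uu) /div_flux.
have F0 := dot_flux oU sf D0 (pd 0 phi u) 0 Uu.
have F1 := dot_flux oU sf D0 (pd 1 phi u) 1 Uu.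
have T0 := dot_tpart_conformal 0 (pd 0 phi u) Uu.
have T1 := dot_tpart_conformal 1 (pd 1 phi u) Uu.
have h10 := hcoefC oU sf 1 0 Uu.
have hs : dot (H u) (pd 0 (pd 1 f) u + pd 1 (pd 0 f) u) = hcoef f 0 1 u + hcoef f 1 0 u.
  exact: (dotDr (pd 0 (pd 1 f) u) (pd 1 (pd 0 f) u) (H u)).
have h00 : dot (H u) (pd 0 (pd 0 f) u) = hcoef f 0 0 u := erefl.
have h11 : dot (H u) (pd 1 (pd 1 f) u) = hcoef f 1 1 u := erefl.
have l0 : gij f 0 0 u != 0 by rewrite gt_eqF.
have lE : gij f 0 0 u = dot (pd 0 f u) (pd 0 f u) := erefl.
move: F0 F1 T0 T1 h10 hs h00 h11 l0 lE.
generalize (hcoef f 0 0 u) (hcoef f 0 1 u) (hcoef f 1 0 u) (hcoef f 1 1 u) (gij f 0 0 u).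
generalize (flux f u 0) (flux f u 1) (tpart f 0 u) (tpart f 1 u) (H u) (phi u); genpd.
move=> a b c d c1 c2 c3 c4 c5 c6 c7 c8 c9 c10 d1 d2 d3 d4 d5 d6.
move=> lE; rewrite -lE d3 d4 d5 d2 !dotE c8 c9 c10 d1 d2 (dotC s s4).
by move: d6; clear; gendot => l0; field.
Qed.

(** The boundary flux vanishes off K, so it is smooth on the whole plane, being
    smooth on U and on the complement of K, and its divergence integrates to 0. *)
Lemma is_derive_willmore_energy_conformal (K : set (R * R)) : compact K -> K `<=` U ->
  (forall u, ~ K u -> phi u = 0) ->
  is_derive (0 : R) (1 : R) (fun t : R => willmore_energy K (fun u => f u + t *: phi u))
    (\int[mu]_(u in K) dot (div_flux u) (phi u))%R.
Proof.
move=> cK KU phi0; have h := is_derive_willmore_energy oU sf sphi D0 cK KU.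
apply: is_derive_eq h _.
have oK : open (~` K).
  by apply: closed_openC; apply: compact_closed => //; exact: norm_hausdorff.
have psi0 j u : ~ K u -> boundary_flux j u = 0.
  move=> nK; rewrite /boundary_flux phi0 // (eq_pd (g := fun=> 0) j oK _ nK) //.
  by rewrite (_ : pd j _ u = 0) ?dot0r ?subr0 //; exact: derive_cst.
have sg j u : is_derive u (ebasis j) (boundary_flux j) (pd j (boundary_flux j) u)
    /\ {for u, continuous (pd j (boundary_flux j))}.
  have [Ku|nK] := pselect (K u).
    split; first exact: smooth_on_derive (smooth_boundary_flux j) (KU _ Ku).
    exact: Ck_on_continuous (smooth_on_pd j (smooth_boundary_flux j) 0) (KU _ Ku).
  have s0 : smooth_on (~` K) (boundary_flux j).
    apply: (eq_smooth_on oK (f := fun=> 0)); last exact: smooth_on_cst.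
    by move=> v nv; rewrite psi0.
  split; first exact: smooth_on_derive s0 nK.
  exact: Ck_on_continuous (smooth_on_pd j s0 0) nK.
have int0 j := integral_pd_eq0 cK (fun u => (sg j u).1) (fun u => (sg j u).2) (psi0 j).
have i0 j := integrable_pointwise cK (fun u _ => (sg j u).2).
have sW : smooth_on U (fun u => dot (div_flux u) (phi u)).
  have sF j := smooth_flux oU sf D0 j.
  exact: (smooth_on_dot oU (smooth_onD oU (smooth_on_pd 0 (sF 0)) (smooth_on_pd 1 (sF 1))) sphi).
have iW : mu.-integrable K (EFin \o (fun u => dot (div_flux u) (phi u))).
  by apply: integrable_pointwise => // u Ku; exact: Ck_on_continuous (sW 0) (KU _ Ku).
have mK := compact_measurable2 cK.
transitivity (\int[mu]_(u in K) ((pd 0 (boundary_flux 0) u + pd 1 (boundary_flux 1) u)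
    + dot (div_flux u) (phi u)))%R.
  by apply: eq_Rintegral => u /set_mem Ku; exact: first_variationE (KU _ Ku).
exact: (Rintegral_dropl mK (i0 0) (i0 1) iW (int0 0) (int0 1)).
Qed.

End Test.

Lemma willmore_on_conformal : willmore_on U f <-> forall u, U u -> div_flux u = 0.
Proof.
split=> [W|W K phi cK KU sphi phi0].
  apply: (fundamental_lemma oU).
    have sF j := smooth_flux oU sf D0 j.
    exact: (smooth_onD oU (smooth_on_pd 0 (sF 0)) (smooth_on_pd 1 (sF 1))).
  move=> K phi cK KU sphi phi0.
  have h := is_derive_willmore_energy_conformal sphi cK KU phi0.
  exact: is_derive_unique h (W K phi cK KU sphi phi0).
have h := is_derive_willmore_energy_conformal sphi cK KU phi0.
apply: is_derive_eq h _; transitivity (\int[mu]_(u in K) 0)%R.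
  by apply: eq_Rintegral => u /set_mem /KU /W ->; rewrite dot0l.
by rewrite Rintegral_cst ?mul0r //; exact: compact_measurable2.
Qed.

End Conformal.

(** * The equation in conformal coordinates, and the theorem *)

Lemma vec_of_wedgeN (R : realType) m (x y : multivector R m) :
  vec_of (wedge x (- y)) = - vec_of (wedge x y).
Proof.
have wN (z t : multivector R m) S : wedge z (- t) S = - wedge z t S.
  by rewrite !ffunE -sumrN; apply: eq_bigr => T _; rewrite ffunE mulrN.
apply/rowP => i; rewrite !mxE -wN; congr (wedge _ _ _).
by apply/ffunP => S; rewrite wN [RHS]ffunE.
Qed.

Section ConformalEquation.
Context {R : realType} {m : nat}.
Variables (U : set (R * R)) (f : R * R -> 'rV[R]_m.+2).
Variable (n : R * R -> multivector R m.+2).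
Hypothesis oU : open U.
Hypothesis sf : smooth_on U f.
Hypothesis D0 : forall u, U u -> 0 < gram (pd 0 f u) (pd 1 f u).
Hypothesis conf : forall u, U u -> conformal_at f u.
Hypothesis gn : forall u, U u -> gauss_at f u (n u).
Local Notation H := (mean_curv f).

(** The rotation by a right angle: conformal factors cancel. *)
Lemma hodge_conformal w u : U u ->
  hodge f w u 1 = w u 0 /\ hodge f w u 0 = - w u 1.
Proof.
move=> Uu; have q := conformal_eq conf Uu; have o := conformal_orth conf Uu.
have E0 := dot_gt0_gram (D0 Uu).
rewrite !(hodgeE erefl erefl (D0 Uu)).
move: q o E0; rewrite /gij /gram.
generalize (w u 0) (w u 1).
generalize (pd 0 f u) as a; generalize (pd 1 f u) as b => b a x y q o E0.
have E0' : dot a a != 0 by rewrite gt_eqF.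
rewrite -q o expr0n /= subr0 -expr2 sqrtr_sqr ger0_norm ?ltW //.
by rewrite !scale0r subr0 sub0r scalerN !scalerA mulVf // !scale1r.
Qed.

(** The rotated form of conservation_form. *)
Lemma conformal_flux_form u j : U u ->
  pd j H u - 3 *: nproj_form f (grad H) u j - wedge_gradperp_n H n u j
  = - 2 *: flux f u j.
Proof.
move=> Uu.
have c0 := conservation_form oU sf D0 gn 0 Uu.
have c1 := conservation_form oU sf D0 gn 1 Uu.
have [a1 a0] := hodge_conformal (grad H) Uu.
have [b1 b0] := hodge_conformal (nproj_form f (grad H)) Uu.
have [f1 f0] := hodge_conformal (flux f) Uu.
rewrite a0 b0 f0 in c0; rewrite a1 b1 f1 in c1.
have g0 : wedge_gradperp_n H n u 0 = - wedge_dn H n u 1.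
  by rewrite /wedge_gradperp_n /= vec_of_wedgeN.
have g1 : wedge_gradperp_n H n u 1 = wedge_dn H n u 0 by [].
case: (ord2P j) => ->.
  by rewrite g0 opprK.
rewrite g1; move: c0; rewrite -[pd 1 H u]/(grad H u 1).
generalize (grad H u 1) (nproj_form f (grad H) u 1) (wedge_dn H n u 0) (flux f u 1).
move=> x y z t c; apply: oppr_inj; rewrite -[RHS]scalerN -c scalerN.
by rewrite !opprD !opprK.
Qed.

Lemma conformal_equation u : U u ->
  laplacian H u - 3 *: div (nproj_form f (grad H)) u - div (wedge_gradperp_n H n) u
  = - 2 *: div_flux f u.
Proof.
move=> Uu.
have sH := smooth_mean_curv oU sf D0.
have spH i : smooth_on U (fun v => nproj_form f (grad H) v i).
  exact: (smooth_ncov oU sf D0 i).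
have sW j : smooth_on U (fun v => wedge_dn H n v j) := smooth_wedge_dn oU sf D0 gn j.
have sG j : smooth_on U (fun v => wedge_gradperp_n H n v j).
  case: (ord2P j) => ->; last exact: sW 0.
  have sN := smooth_onN oU (sW 1); apply: (eq_smooth_on oU _ sN) => v Uv.
  by rewrite /wedge_gradperp_n /= vec_of_wedgeN.
have sF j := smooth_flux oU sf D0 j.
have key j : pd j (pd j H) u - 3 *: pd j (fun v => nproj_form f (grad H) v j) u
    - pd j (fun v => wedge_gradperp_n H n v j) u = - 2 *: pd j (fun v => flux f v j) u.
  have d1 := is_derive_funB (is_derive_funB
      (smooth_on_derive j (smooth_on_pd j sH) Uu)
      (is_derive_scale (is_derive_funcst (3 : R) u (ebasis j)) (smooth_on_derive j (spH j) Uu)))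
    (smooth_on_derive j (sG j) Uu).
  have d2 := is_derive_scale (is_derive_funcst (- 2 : R) u (ebasis j))
    (smooth_on_derive j (sF j) Uu).
  rewrite scale0r add0r in d1; rewrite scale0r add0r in d2.
  exact: is_derive_unique (eq_is_derive oU (fun v Uv => conformal_flux_form j Uv) Uu d1) d2.
rewrite /laplacian /div !sum2 /div_flux; move: (key 0) (key 1); genpd => k0 k1.
by rewrite [RHS]scalerDr -k0 -k1; apply/rowP => i; rewrite !mxE; ring.
Qed.

End ConformalEquation.

Lemma open_unit_disc (R : realType) : open (@unit_disc R).
Proof.
have -> : @unit_disc R = (fun u : R * R => u.1 ^+ 2 + u.2 ^+ 2) @^-1` [set x | x < 1].
  by [].
apply: open_comp; last exact: open_lt.
move=> u _; have c1 : (fun v : R * R => v.1) @ nbhs u --> u.1 by exact: cvg_fst.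
have c2 : (fun v : R * R => v.2) @ nbhs u --> u.2 by exact: cvg_snd.
exact: cvgD (cvgM c1 c1) (cvgM c2 c2).
Qed.

Theorem theorem1 (R : realType) (m : nat) (hm : (3 <= m)%N) :
  (forall (S : oriented_surface R) (Phi : S -> 'rV[R]_m) (n : S -> multivector R m),
     smooth_immersion Phi -> gauss_map Phi n ->
     ((forall c : chart R S, atlas c -> forall u : R * R, ccod c u ->
         let f := Phi \o cinv c in
         let H := mean_curv f in
         laplacian_perp f H u - (2 * dot (H u) (H u)) *: H u + Atilde f u (H u) = 0)
      <->
      (forall c : chart R S, atlas c -> forall u : R * R, ccod c u ->
         let f := Phi \o cinv c in
         let H := mean_curv f in
         let dH := grad H in
         extd (fun v j => hodge f dH v j - 3 *: hodge f (nproj_form f dH) v j) u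
         + extd (wedge_dn H (n \o cinv c)) u = 0)))
  /\
  (forall (Phi : R * R -> 'rV[R]_m) (n : R * R -> multivector R m),
     smooth_immersion_on unit_disc Phi ->
     (forall u, unit_disc u -> conformal_at Phi u) ->
     (forall u, unit_disc u -> gauss_at Phi u (n u)) ->
     (willmore_on unit_disc Phi
      <->
      (forall u, unit_disc u ->
         let H := mean_curv Phi in
         laplacian H u - 3 *: div (nproj_form Phi (grad H)) u
         - div (wedge_gradperp_n H n) u = 0))).
Proof.
case: m hm => [|[|m]] // _; split=> [S Phi n imm gm|Phi n [sPhi iPhi] conf gn].
- have law c : atlas c -> forall u, ccod c u ->
      let f := Phi \o cinv c in let H := mean_curv f in
      (extd (fun v j => hodge f (grad H) v j - 3 *: hodge f (nproj_form f (grad H)) v j) u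
       + extd (wedge_dn H (n \o cinv c)) u = 0) <-> willmore_op f u = 0.
    move=> ac u cu f H; have [sf If] := imm c ac.
    have D0 v : ccod c v -> 0 < gram (pd 0 f v) (pd 1 f v).
      by move=> cv; exact: immersion_gram_gt0 (If _ cv).
    have oU : open (ccod c) by exact: ccod_open.
    have E := conservation_law (n := n \o cinv c) oU sf D0 (gm c ac) cu.
    have s0 : - 2 * area_density f u != 0.
      by rewrite mulf_neq0 ?oppr_eq0 // sqrt_gram_neq0 //; exact: D0.
    split=> [e|e]; first by apply: (scalerI s0); rewrite scaler0 -E.
    by rewrite [LHS]E e scaler0.
  by split=> h c ac u cu; [apply/(law c ac u cu)|apply/(law c ac u cu)]; exact: h.
- have D0 v : unit_disc v -> 0 < gram (pd 0 Phi v) (pd 1 Phi v).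
    by move=> cv; exact: immersion_gram_gt0 (iPhi _ cv).
  have oD := @open_unit_disc R.
  apply: (iff_trans (willmore_on_conformal oD sPhi D0 conf)).
  split=> h u Du; have E := conformal_equation oD sPhi D0 conf gn Du.
    by apply: (etrans E); rewrite h // scaler0.
  have two : (- 2 : R) != 0 by rewrite oppr_eq0.
  by apply: (scalerI two); rewrite scaler0 -E; exact: h.
Qed.
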